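(* The following identities of formal power series in $z$ hold with coefficients in the $\imath$Hall algebra ${}^{\imath}\widetilde{\mathcal H}(\Bbbk Q_J)$ (with scalars extended to $\mathbb Q(\mathbf v)$, $\mathbf v=\sqrt q$): $$\widehat H(z)\,\widehat E(-z)=\exp_q\Big(\frac{[K_S]z^2}{1-q}\Big),$$ $$\widehat\Theta(z)=\big(1-q[K_S]z^2\big)\frac{\widehat E(-z)}{\widehat E(-qz)}=\big(1-[K_S]z^2\big)^{-1}\frac{\widehat H(qz)}{\widehat H(z)},$$ $$\widehat\Theta(z)=\exp\Big(\sum_{r\ge1}\frac{q^r-1}{r}\widehat P_rz^r\Big)\exp\Big(\sum_{k\ge1}\frac{1-q^k}{2k}[K_S]^kz^{2k}\Big),$$ $$\widehat E(z)=\exp\Big(\sum_{r\ge1}\frac{(-1)^{r-1}}{r}\widehat P_rz^r\Big)\exp_q\Big(\frac{[K_S]z^2}{1-q}\Big)^{\frac12},$$ $$\widehat H(z)=\exp\Big(\sum_{r\ge1}\frac1r\widehat P_rz^r\Big)\exp_q\Big(\frac{[K_S]z^2}{1-q}\Big)^{\frac12}.$$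
   Context: Let $\Bbbk=\mathbb F_q$ be the field with $q$ elements. Let $\mathcal A$ be the category of finite-dimensional nilpotent representations of the Jordan quiver $Q_J$ over $\Bbbk$ (finite-dimensional $\Bbbk[x]$-modules on which $x$ is nilpotent). Its indecomposables are $S^{(n)}=\Bbbk[x]/(x^n)$, $n\ge1$; $S=S^{(1)}$; for a partition $\lambda=(\lambda_1,\ldots,\lambda_r)$ put $S^{(\lambda)}=S^{(\lambda_1)}\oplus\cdots\oplus S^{(\lambda_r)}$, with $S^{(0)}=S^{(\emptyset)}=0$. Let $\mathcal C_1(\mathcal A)$ be the abelian category of 1-periodic complexes: pairs $(M,d)$, $M\in\mathcal A$, $d:M\to M$ a morphism with $d^2=0$, morphisms being morphisms in $\mathcal A$ commuting with the differentials. Objects $M\in\mathcal A$ are identified with $(M,0)$; $H(M,d)=\ker d/\operatorname{Im}d$; $K_X=(X\oplus X,\begin{pmatrix}0&\mathrm{Id}\\0&0\end{pmatrix})$. The Hall algebra $\mathcal H(\mathcal C_1(\mathcal A))$ is the $\mathbb Q$-vector space with basis the isoclasses $[M]$ of objects and product $[M]\diamond[N]=\sum_{[L]}\frac{|\mathrm{Ext}^1(M,N)_L|}{|\mathrm{Hom}(M,N)|}[L]$, where $\mathrm{Ext}^1(M,N)_L$ is the set of extension classes $0\to N\to L'\to M\to0$ with $L'\cong L$. The $\imath$Hall algebra ${}^{\imath}\widetilde{\mathcal H}(\Bbbk Q_J)$ is the quotient of $\mathcal H(\mathcal C_1(\mathcal A))$ by the two-sided ideal generated by all $[M^\bullet]-[N^\bullet]$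 with $H(M^\bullet)\cong H(N^\bullet)$ and $\operatorname{Im}d_{M^\bullet},\operatorname{Im}d_{N^\bullet}$ having the same class in $K_0(\mathcal A)\cong\mathbb Z$ (i.e. the same dimension). It is a commutative algebra with unit $[0]=1$. Notation: $\varphi_r(t)=(1-t)(1-t^2)\cdots(1-t^r)$ for $r\ge0$; $\ell(\lambda)$ is the number of nonzero parts of $\lambda$; $\lambda\vdash r$ means $\lambda$ is a partition of $r$; $\mathrm{Aut}$ denotes the automorphism group. Define $\exp_q\big(\frac{x}{1-q}\big)=\sum_{r\ge0}\frac{x^r}{(1-q)(1-q^2)\cdots(1-q^r)}$; the power $\frac12$ of a power series with constant term $1$ is the square root with constant term $1$. The generating functions are $$\widehat E(z)=\sum_{r\ge0}\mathbf v^{r(r-1)}\frac{[S^{(1^r)}]}{|\mathrm{Aut}(S^{(1^r)})|}z^r,\qquad \widehat H(z)=\sum_{r\ge0}\sum_{\lambda\vdash r}\frac{[S^{(\lambda)}]}{|\mathrm{Aut}(S^{(\lambda)})|}z^r,\qquad \widehat\Theta(z)=\sum_{r\ge0}[S^{(r)}]z^r,$$ and, for $r\ge1$, $\widehat P_r=\sum_{\lambda\vdash r}\varphi_{\ell(\lambda)-1}(q)\frac{[S^{(\lambda)}]}{|\mathrm{Aut}(S^{(\lambda)})|}$. *)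

(* Defs.v *)
From HB Require Import structures.
From mathcomp Require Import all_boot all_order all_algebra all_field.
From mathcomp Require Import finmap.
From mathcomp Require Import generic_quotient ring_quotient.
From mathcomp Require Import boolp classical_sets fsbigop.
From mathcomp Require Import monalg.

Set Implicit Arguments.
Unset Strict Implicit.
Unset Printing Implicit Defensive.

Import GRing.Theory.

Local Open Scope ring_scope.
Local Open Scope quotient_scope.

(* Linear maps act on row vectors on the right: a map k^m -> k^n is a matrix
   f : 'M_(m, n), and "f followed by g" is f *m g.  An object of the category
   of finite-dimensional nilpotent representations of the Jordan quiver is a
   space k^n together with a nilpotent endomorphism. *)
Record nrep (k : fieldType) := Nrep {
  ndim : nat;
  nmx : 'M[k]_ndim;
  nmx_nil : exists m, nmx ^+ m = 0
}.

Definition nrep_hom (k : fieldType) (M N : nrep k)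
    (f : 'M[k]_(ndim M, ndim N)) : bool :=
  nmx M *m f == f *m nmx N.

Definition nrep_iso (k : fieldType) (M N : nrep k) : Prop :=
  exists f : 'M[k]_(ndim M, ndim N), [&& nrep_hom f, row_free f & row_full f].

Definition nrep_aut_card (k : finFieldType) (M : nrep k) : nat :=
  #|[set f : 'M[k]_(ndim M) | nrep_hom (M := M) (N := M) f & f \in unitmx]|.

Section NilpotentRepresentations.
Variable k : fieldType.

(* X . x^i = x^(i+1) in the basis 1, x, ..., x^(n-1) of k[x]/(x^n). *)
Definition jordan_mx n : 'M[k]_n := \matrix_(i, j) (i.+1 == j :> nat)%:R.

Lemma jordan_mx_exp n m (i j : 'I_n) :
  (jordan_mx n ^+ m) i j = ((i + m)%N == j :> nat)%:R.
Proof.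
elim: m i j => [|m IHm] i j; first by rewrite expr0 mxE addn0.
rewrite exprS mxE; have [lt_i|ge_i] := ltnP i.+1 n.
  rewrite (bigD1 (Ordinal lt_i)) //= mxE eqxx mul1r IHm /= addSnnS.
  rewrite big1 ?addr0 // => l ne_l; rewrite mxE.
  by rewrite eq_sym -[l == i.+1 :> nat]/(l == Ordinal lt_i) (negPf ne_l) mul0r.
rewrite big1 => [|l _].
  rewrite gtn_eqF // addnS; apply: leq_trans (ltn_ord j) _.
  exact: leq_trans ge_i (leq_addr _ _).
by rewrite mxE gtn_eqF ?mul0r // (leq_trans (ltn_ord l)).
Qed.

Lemma jordan_mx_nil n : exists m, jordan_mx n ^+ m = 0.
Proof.
exists n; apply/matrixP=> i j; rewrite jordan_mx_exp mxE gtn_eqF //.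
exact: leq_trans (ltn_ord j) (leq_addl _ _).
Qed.

Definition Sn (n : nat) : nrep k := Nrep (jordan_mx_nil n).

Lemma dsum_mx_exp m n (a : 'M[k]_m) (b : 'M[k]_n) (r : nat) :
  (block_mx a 0 0 b : 'M_(m + n)) ^+ r = block_mx (a ^+ r) 0 0 (b ^+ r).
Proof.
elim: r => [|r IHr]; first by rewrite !expr0 -scalar_mx_block.
by rewrite !exprS IHr -!mulmxE mulmx_block !mulmx0 !mul0mx !addr0 !add0r.
Qed.

Lemma dsum_mx_nil (M N : nrep k) :
  exists r, (block_mx (nmx M) 0 0 (nmx N) : 'M_(ndim M + ndim N)) ^+ r = 0.
Proof.
have [[a aM] [b bN]] := (nmx_nil M, nmx_nil N); exists (a + b)%N.
by rewrite dsum_mx_exp !exprD aM bN mul0r mulr0; exact: block_mx0.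
Qed.

Definition nrep_dsum (M N : nrep k) : nrep k := Nrep (dsum_mx_nil M N).

Definition Spart (l : seq nat) : nrep k := foldr (fun n => nrep_dsum (Sn n)) (Sn 0) l.

End NilpotentRepresentations.

Record cplx (k : fieldType) := Cplx {
  cobj :> nrep k;
  cdiff : 'M[k]_(ndim cobj);
  cdiff_hom : nrep_hom (M := cobj) (N := cobj) cdiff;
  cdiff_sq : cdiff *m cdiff = 0
}.

HB.instance Definition _ (k : fieldType) := gen_eqMixin (cplx k).
HB.instance Definition _ (k : fieldType) := gen_choiceMixin (cplx k).

Definition chom (k : fieldType) (M N : cplx k)
    (f : 'M[k]_(ndim M, ndim N)) : bool :=
  nrep_hom f && (cdiff M *m f == f *m cdiff N).

Definition cplx_iso (k : fieldType) (M N : cplx k) : Prop :=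
  exists f : 'M[k]_(ndim M, ndim N), [&& chom f, row_free f & row_full f].

Section Complexes.
Variable k : fieldType.
Implicit Types M N : cplx k.

Lemma stalk_hom (X : nrep k) : nrep_hom (M := X) (N := X) 0.
Proof. by rewrite /nrep_hom mulmx0 mul0mx. Qed.

Definition stalk (X : nrep k) : cplx k := Cplx (stalk_hom X) (mulmx0 _ 0).

(* The differential (a, b) |-> (b, 0) of K_X, for row vectors. *)
Definition Kdiff (X : nrep k) : 'M[k]_(ndim X + ndim X) := block_mx 0 0 1%:M 0.

Lemma Kdiff_hom (X : nrep k) :
  nrep_hom (M := nrep_dsum X X) (N := nrep_dsum X X) (Kdiff X).
Proof.
rewrite /nrep_hom /= !mulmx_block.
by rewrite !(mulmx0, mul0mx, mulmx1, mul1mx, addr0, add0r).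
Qed.

Lemma Kdiff_sq (X : nrep k) : Kdiff X *m Kdiff X = 0.
Proof.
rewrite mulmx_block !(mulmx0, mul0mx, addr0, add0r, mulmx1).
exact: block_mx0.
Qed.

Definition Kcplx (X : nrep k) : cplx k := Cplx (Kdiff_hom X) (Kdiff_sq X).

(* H(M) = ker d / Im d.  The rows of [cycles M] are a basis of ker d,
   [cycles_mx M] is the action of x on ker d in this basis, and [hproj M] is
   a surjection with kernel Im d from ker d onto a coordinate space. *)
Definition cycles M : 'M[k]_(\rank (kermx (cdiff M)), ndim M) :=
  row_base (kermx (cdiff M)).
Definition cycles_mx M := cycles M *m nmx M *m pinvmx (cycles M).
Definition bdry M := cdiff M *m pinvmx (cycles M).
Definition hproj M := col_base (cokermx (bdry M)).
Definition homology_mx M := pinvmx (hproj M) *m cycles_mx M *m hproj M.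

Lemma bdryK M : bdry M *m cycles M = cdiff M.
Proof.
apply: mulmxKpV; rewrite /cycles eq_row_base.
by apply/sub_kermxP; rewrite cdiff_sq.
Qed.

Lemma cycles_mxK M : cycles_mx M *m cycles M = cycles M *m nmx M.
Proof.
apply: mulmxKpV; rewrite /cycles eq_row_base; apply/sub_kermxP.
have /eqP hd := cdiff_hom M; rewrite -mulmxA hd mulmxA.
suff -> : row_base (kermx (cdiff M)) *m cdiff M = 0 by rewrite mul0mx.
by apply/sub_kermxP; rewrite eq_row_base.
Qed.

Lemma cycles_free M : row_free (cycles M).
Proof. exact: row_base_free. Qed.

Lemma hproj_full M : row_full (hproj M).
Proof. exact: col_base_full. Qed.

Lemma kermx_hproj M : (kermx (hproj M) == bdry M)%MS.
Proof.
have [U Uh] : exists U, hproj M = cokermx (bdry M) *m U.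
  exists (pinvmx (row_base (cokermx (bdry M)))).
  have := congr1 (mulmx^~ (pinvmx (row_base (cokermx (bdry M)))))
    (mulmx_base (cokermx (bdry M))).
  by rewrite -mulmxA mulmxVp ?row_base_free // mulmx1.
apply/andP; split.
  rewrite submxE; apply/eqP.
  transitivity (kermx (hproj M) *m (hproj M *m row_base (cokermx (bdry M)))).
    by congr (_ *m _); rewrite mulmx_base.
  by rewrite mulmxA mulmx_ker mul0mx.
by apply/sub_kermxP; rewrite Uh mulmxA mulmx_coker mul0mx.
Qed.

Lemma homology_mxK M : hproj M *m homology_mx M = cycles_mx M *m hproj M.
Proof.
set p := hproj M; set b := bdry M; set z := cycles_mx M.
have zb : b *m z = nmx M *m b.
  apply: (row_free_inj (cycles_free M)).
  rewrite /= -(mulmxA b z) -(mulmxA _ b) /z /b cycles_mxK bdryK mulmxA bdryK.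
  by have /eqP -> := cdiff_hom M.
have bp : b *m p = 0 by apply/sub_kermxP; case/andP: (kermx_hproj M).
have : ((1%:M - p *m pinvmx p)%R <= b)%MS.
  apply: submx_trans (proj1 (andP (kermx_hproj M))).
  by apply/sub_kermxP; rewrite mulmxBl mul1mx -mulmxA mulVpmx ?mulmx1 ?subrr ?hproj_full.
case/submxP=> D hD.
have : (1%:M - p *m pinvmx p) *m z *m p = 0.
  by rewrite hD -(mulmxA D) zb mulmxA -(mulmxA _ b) bp mulmx0.
by rewrite !mulmxBl mul1mx => /subr0_eq ->; rewrite /homology_mx !mulmxA.
Qed.

Lemma homology_nil M : exists m, homology_mx M ^+ m = 0.
Proof.
have [m xm] := nmx_nil M; exists m.
have zE r : cycles_mx M ^+ r *m cycles M = cycles M *m nmx M ^+ r.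
  elim: r => [|r IHr]; first by rewrite !expr0 mul1mx mulmx1.
  by rewrite exprSr -!mulmxE -mulmxA cycles_mxK mulmxA IHr -mulmxA exprSr mulmxE.
have hE r : hproj M *m homology_mx M ^+ r = cycles_mx M ^+ r *m hproj M.
  elim: r => [|r IHr]; first by rewrite !expr0 mul1mx mulmx1.
  by rewrite exprS -!mulmxE mulmxA homology_mxK -mulmxA IHr mulmxA exprS mulmxE.
have zm : cycles_mx M ^+ m = 0.
  by apply: (row_free_inj (cycles_free M)); rewrite zE xm mulmx0 mul0mx.
by apply: (row_full_inj (hproj_full M)); rewrite hE zm mul0mx mulmx0.
Qed.

Definition homology M : nrep k := Nrep (homology_nil M).

Lemma cplx_iso_refl M : cplx_iso M M.
Proof.
exists 1%:M; rewrite /chom /nrep_hom !mulmx1 !mul1mx !eqxx.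
by rewrite row_free_unit row_full_unit unitmx1.
Qed.

Lemma cplx_iso_sym M N : cplx_iso M N -> cplx_iso N M.
Proof.
case=> f /and3P[/andP[/eqP fx /eqP fd] ffree ffull].
have fV : f *m pinvmx f = 1%:M by rewrite mulmxVp.
have Vf : pinvmx f *m f = 1%:M by rewrite mulVpmx.
have comm (a : 'M_(ndim M)) (b : 'M_(ndim N)) :
    a *m f = f *m b -> b *m pinvmx f = pinvmx f *m a.
  by move=> ab; rewrite -[b]mul1mx -Vf -[_ *m f *m b]mulmxA -ab -!mulmxA fV mulmx1.
exists (pinvmx f); rewrite /chom /nrep_hom (comm _ _ fx) (comm _ _ fd) !eqxx /=.
by apply/andP; split; [apply/row_freeP; exists f | apply/row_fullP; exists f].
Qed.

Lemma cplx_iso_trans M N P : cplx_iso M N -> cplx_iso N P -> cplx_iso M P.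
Proof.
case=> f /and3P[/andP[/eqP fx /eqP fd] /row_freeP[f1 f1P] /row_fullP[f2 f2P]].
case=> g /and3P[/andP[/eqP gx /eqP gd] /row_freeP[g1 g1P] /row_fullP[g2 g2P]].
exists (f *m g); rewrite /chom /nrep_hom !mulmxA fx fd -!mulmxA gx gd !eqxx /=.
apply/andP; split; [apply/row_freeP|apply/row_fullP].
  by exists (g1 *m f1); rewrite mulmxA -[f *m g *m g1]mulmxA g1P mulmx1.
by exists (g2 *m f2); rewrite mulmxA -[g2 *m f2 *m f]mulmxA f2P mulmx1.
Qed.

Definition isob M N : bool := `[< cplx_iso M N >].

Lemma isob_equiv : equiv_class_of isob.
Proof.
split=> [M|M N|N M P].
- exact/asboolP/cplx_iso_refl.
- by apply/asboolP/asboolP; exact: cplx_iso_sym.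
- by move=> /asboolP MN /asboolP NP; apply/asboolP; exact: cplx_iso_trans NP.
Qed.

Canonical isob_equiv_rel := EquivRelPack isob_equiv.

End Complexes.

Definition isoclass (k : fieldType) := {eq_quot (@isob k)}.
HB.instance Definition _ (k : fieldType) := Choice.on (isoclass k).

Section Extensions.
Variable k : finFieldType.
Implicit Types M N L : cplx k.

Definition hom_card M N : nat := #|[set f : 'M[k]_(ndim M, ndim N) | chom f]|.

(* Pairs (i, p) such that 0 -> N -i-> L -p-> M -> 0 is exact. *)
Definition ses M N L :
    {set 'M[k]_(ndim N, ndim L) * 'M[k]_(ndim L, ndim M)} :=
  [set ip | [&& chom ip.1, chom ip.2, row_free ip.1, row_full ip.2
             & (ip.1 == kermx ip.2)%MS]].

Definition ses_equiv M N L :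
    rel ('M[k]_(ndim N, ndim L) * 'M[k]_(ndim L, ndim M)) :=
  fun ip jq => [exists g : 'M[k]_(ndim L),
    [&& chom (M := L) (N := L) g, g \in unitmx, ip.1 *m g == jq.1
      & ip.2 == g *m jq.2]].

(* |Ext^1(M, N)_L|: every class with middle term isomorphic to L is represented
   by a sequence whose middle term is L itself. *)
Definition ext_card M N L : nat :=
  #|equivalence_partition (@ses_equiv M N L) (ses M N L)|.

End Extensions.

Section HallAlgebra.
Variables (k : finFieldType) (F : fieldType).

(* Scalars are extended to F from the start: the structure constants below and
   the generators of the ideal are rational. *)
Definition hall := {malg F[isoclass k]}.
HB.instance Definition _ := GRing.Lmodule.on hall.

Definition hcls (M : cplx k) : hall := << \pi_(isoclass k) M >>.

(* Only finitely many L contribute, as dim L = dim M + dim N for these. *)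
Definition hprod (M N : isoclass k) : hall :=
  \sum_(L \in [set: isoclass k])
    ((ext_card (repr M) (repr N) (repr L))%:R
       / (hom_card (repr M) (repr N))%:R : F) *: (<< L >> : hall).

Definition hmul (x y : hall) : hall :=
  \sum_(M <- msupp x) \sum_(N <- msupp y) (x@_M * y@_N) *: hprod M N.

Lemma hmulEw (d1 d2 : {fset isoclass k}) (x y : hall) :
    (msupp x `<=` d1)%fset -> (msupp y `<=` d2)%fset ->
  hmul x y = \sum_(M <- d1) \sum_(N <- d2) (x@_M * y@_N) *: hprod M N.
Proof.
move=> sx sy; rewrite /hmul (big_fset_incl _ sx) /=; last first.
  by move=> M _ /mcoeff_outdom xM; rewrite big1 // => N _; rewrite xM mul0r scale0r.
apply: eq_bigr => M _; apply: big_fset_incl => // N _ /mcoeff_outdom yN.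
by rewrite yN mulr0 scale0r.
Qed.

Lemma hmul_linl (a : F) (x y z : hall) :
  hmul (a *: x + y) z = a *: hmul x z + hmul y z.
Proof.
pose d := (msupp (a *: x + y) `|` (msupp x `|` msupp y))%fset.
have sx : (msupp x `<=` d)%fset by rewrite /d fsetUCA fsubsetUl.
have sy : (msupp y `<=` d)%fset by rewrite /d fsetUA fsubsetUr.
rewrite (hmulEw (fsubsetUl _ (msupp x `|` msupp y)%fset) (fsubset_refl _)) -/d.
rewrite (hmulEw sx (fsubset_refl _)) (hmulEw sy (fsubset_refl _)).
rewrite scaler_sumr -big_split /=; apply: eq_bigr => M _.
rewrite scaler_sumr -big_split /=; apply: eq_bigr => N _.
by rewrite mcoeffD mcoeffZ mulrDl scalerDl scalerA mulrA.
Qed.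

Lemma hmul_linr (a : F) (x y z : hall) :
  hmul x (a *: y + z) = a *: hmul x y + hmul x z.
Proof.
pose d := (msupp (a *: y + z) `|` (msupp y `|` msupp z))%fset.
have sy : (msupp y `<=` d)%fset by rewrite /d fsetUCA fsubsetUl.
have sz : (msupp z `<=` d)%fset by rewrite /d fsetUA fsubsetUr.
rewrite (hmulEw (fsubset_refl _) (fsubsetUl _ (msupp y `|` msupp z)%fset)) -/d.
rewrite (hmulEw (fsubset_refl _) sy) (hmulEw (fsubset_refl _) sz).
rewrite scaler_sumr -big_split /=; apply: eq_bigr => M _.
rewrite scaler_sumr -big_split /=; apply: eq_bigr => N _.
by rewrite mcoeffD mcoeffZ mulrDr scalerDl scalerA mulrCA.
Qed.

(* The two-sided ideal.  K_0 of nilpotent representations is Z via the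
   dimension, so the class of Im d is the rank of d. *)
Inductive hideal : hall -> Prop :=
| Hideal_gen (M N : cplx k) of
    nrep_iso (homology M) (homology N) & \rank (cdiff M) = \rank (cdiff N) :
    hideal (hcls M - hcls N)
| Hideal_0 : hideal 0
| Hideal_lin (a : F) x y of hideal x & hideal y : hideal (a *: x + y)
| Hideal_mull x y of hideal y : hideal (hmul x y)
| Hideal_mulr x y of hideal x : hideal (hmul x y).

Definition hidealb : {pred hall} := fun x => `[< hideal x >].

Lemma hidealb_zmod : zmod_closed hidealb.
Proof.
split=> [|x y /asboolP Ix /asboolP Iy]; first exact/asboolP/Hideal_0.
by apply/asboolP; rewrite addrC -scaleN1r; exact: Hideal_lin.
Qed.

HB.instance Definition _ := GRing.isZmodClosed.Build hall hidealb hidealb_zmod.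

Definition iHall := Quotient.quot (hidealb : zmodClosed hall).
HB.instance Definition _ := GRing.Zmodule.on iHall.
HB.instance Definition _ := EqQuotient.on iHall.

Definition iscale (a : F) (x : iHall) : iHall := \pi_iHall (a *: repr x).
Definition imul (x y : iHall) : iHall := \pi_iHall (hmul (repr x) (repr y)).

Lemma iHall_eqP (x y : hall) :
  reflect (\pi_iHall x = \pi_iHall y) (x - y \in hidealb).
Proof. by rewrite Quotient.idealrBE; exact: eqP. Qed.

Lemma repr_iHall (x : hall) : hideal (repr (\pi_iHall x) - x).
Proof. by apply/asboolP/iHall_eqP; rewrite reprK. Qed.

Lemma pi_iscale (a : F) (x : hall) : \pi_iHall (a *: x) = iscale a (\pi_iHall x).
Proof.
apply/esym/iHall_eqP/asboolP; rewrite -scalerBr -[_ *: _]addr0.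
exact: Hideal_lin (repr_iHall x) (Hideal_0).
Qed.

Lemma pi_imul (x y : hall) :
  \pi_iHall (hmul x y) = imul (\pi_iHall x) (\pi_iHall y).
Proof.
apply/esym/iHall_eqP/asboolP.
set x' := repr (\pi_iHall x); set y' := repr (\pi_iHall y).
have Bl a b z : hmul (a - b) z = hmul a z - hmul b z.
  by rewrite addrC -scaleN1r hmul_linl scaleN1r addrC.
have Br a b z : hmul a (b - z) = hmul a b - hmul a z.
  by rewrite addrC -scaleN1r hmul_linr scaleN1r addrC.
have -> : hmul x' y' - hmul x y = 1 *: hmul (x' - x) y' + hmul x (y' - y).
  by rewrite scale1r Bl Br addrA subrK.
apply: (@Hideal_lin 1 (hmul (x' - x) y') (hmul x (y' - y))).
  exact: Hideal_mulr (repr_iHall x).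
exact: Hideal_mull (repr_iHall y).
Qed.

Lemma iscaleA (a b : F) (x : iHall) : iscale a (iscale b x) = iscale (a * b) x.
Proof. by rewrite -[x]reprK -(pi_iscale b) -!pi_iscale scalerA. Qed.

Lemma iscale1 : left_id 1 iscale.
Proof. by move=> x; rewrite -[x]reprK -pi_iscale scale1r. Qed.

Lemma iscaleDr : right_distributive iscale +%R.
Proof.
move=> a x y; rewrite -[x]reprK -[y]reprK -raddfD -!pi_iscale scalerDr.
exact: raddfD.
Qed.

Lemma iscaleDl (x : iHall) : {morph iscale^~ x : a b / a + b}.
Proof.
by move=> a b; rewrite -[x]reprK -!pi_iscale scalerDl; exact: raddfD.
Qed.

HB.instance Definition _ :=
  GRing.Zmodule_isLmodule.Build F iHall iscaleA iscale1 iscaleDr iscaleDl.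

Definition icls (M : cplx k) : iHall := \pi_iHall (hcls M).
Definition ione : iHall := icls (stalk (Sn k 0)).

End HallAlgebra.

Arguments icls {k} F M.
Arguments ione {k F}.

(* Formal power series over [iHall k F], as sequences of coefficients.  No ring
   structure on [iHall k F] is needed to write them down: powers are taken as
   f * (f * (... * 1)). *)
Section PowerSeries.
Variables (k : finFieldType) (F : fieldType).
Local Notation A := (iHall k F).

Definition series := nat -> A.
Implicit Types f g u : series.

Definition sone : series := fun n => if n == 0%N then ione else 0.
Definition smono (a : A) (m : nat) : series := fun n => if n == m then a else 0.
Definition ssub f g : series := fun n => f n - g n.
Definition smul f g : series := fun n => \sum_(i < n.+1) imul (f i) (g (n - i)%N).
Definition spow f m : series := iter m (smul f) sone.

(* f(a z) *)
Definition sdil (a : F) f : series := fun n => a ^+ n *: f n.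

(* sum_m c_m u^m, for a series u with zero constant term. *)
Definition ssubst (c : nat -> F) u : series :=
  fun n => \sum_(m < n.+1) c m *: spow u m n.

(* The sequence whose n-th term is [step g n], where [step g n] depends only on
   the terms of index < n of g. *)
Fixpoint srec_seq (step : series -> nat -> A) n : seq A :=
  if n is n'.+1 then
    let s := srec_seq step n' in rcons s (step (fun i => nth 0 s i) n')
  else [::].
Definition srec step : series := fun n => nth 0 (srec_seq step n.+1) n.

(* The inverse and the square root with constant term 1 of a series f with
   constant term 1, obtained by solving f g = 1 and g g = f for g. *)
Definition sinv f : series := srec (fun g n =>
  if n == 0%N then ione else - \sum_(1 <= i < n.+1) imul (f i) (g (n - i)%N)).
Definition ssqrt f : series := srec (fun g n =>
  if n == 0%N then ione
  else 2%:R^-1 *: (f n - \sum_(1 <= i < n) imul (g i) (g (n - i)%N))).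

Definition sdiv f g : series := smul f (sinv g).

Definition sexp u : series := ssubst (fun m => (m`!)%:R^-1) u.

End PowerSeries.

Arguments sone {k F}.

Section GeneratingFunctions.
Variables (k : finFieldType) (F : fieldType).
Local Notation A := (iHall k F).

Definition qcard : F := #|k|%:R.

Definition phiq (r : nat) : F := \prod_(1 <= i < r.+1) (1 - qcard ^+ i).

(* sexpq u = exp_q (u / (1 - q)) *)
Definition sexpq (u : series k F) : series k F := ssubst (fun r => (phiq r)^-1) u.

(* Partitions of r, without zero parts; the length of l is then [size l]. *)
Definition partitions (r : nat) : set (seq nat) :=
  [set l | [&& sorted geq l, all (leq 1) l & sumn l == r]].

Definition scls (M : nrep k) : A := icls F (stalk M).

Definition scls_aut (M : nrep k) : A := (nrep_aut_card M)%:R^-1 *: scls M.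

Definition KS : A := icls F (Kcplx (Sn k 1)).

Definition Ehat (v : F) : series k F :=
  fun r => v ^+ (r * r.-1) *: scls_aut (Spart k (nseq r 1%N)).

Definition Hhat : series k F :=
  fun r => \sum_(l \in partitions r) scls_aut (Spart k l).

Definition Thetahat : series k F := fun r => scls (Sn k r).

Definition Phat (r : nat) : A :=
  \sum_(l \in partitions r) phiq (size l).-1 *: scls_aut (Spart k l).

End GeneratingFunctions.

Arguments qcard k F : clear implicits.
Arguments KS {k F}.
Arguments Ehat {k F} v.
Arguments Hhat {k F}.
Arguments Thetahat {k F}.
Arguments Phat {k F} r.


Declare Scope series_scope.
Delimit Scope series_scope with PS.
Notation "1" := sone : series_scope.
Notation "f - g" := (ssub f g) : series_scope.
Notation "f * g" := (smul f g) : series_scope.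
Notation "f / g" := (sdiv f g) : series_scope.

(* Main.v *)
(* Let c(X, D) be the class of the complex with x acting by the matrix X and
   differential D.  Riedtmann's formula makes the product a sum over blocks:
   c(X, D) c(X', D') = q^(-mn) sum_(Y, C) c((X' 0; Y X), (D' 0; C D)), and a
   complex with rank m differential and homology H has class K^m [H].

   Let N_n(X) be the number of n-tuples generating the k[x]-module of a
   nilpotent matrix X; it is the value at T = q^n of the polynomial
   s_X(T) = T^(rank X) prod_(i < corank X) (T - q^i).  Put
   H_r = |GL_r|^-1 sum_X c(X, 0), G_r(T) = |GL_r|^-1 sum_X s_X(T) c(X, 0), and
   let g_m(T) = |GL_m|^-1 sum_(X nilpotent) s_X(T) be the scalar version of
   G_m(T).  Sorting the terms of Riedtmann's formula by the rank m of C, and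
   counting the submodules generated by n-tuples, one gets
     sum_(a + b = r) H_a G_b(T) = sum_m g_m(T) T^(r - 2m) K^m H_(r - 2m)
   for T = q^n, hence as polynomials in T.  At T = 0 the series G is E(-z), at
   T = q it is a scalar multiple of Theta, and its derivative at T = 1 is P;
   the g_m are found from the same identity for scalars.  This gives
     H(z) E(-z) = exp_q(K z^2 / (1 - q)),
     (1 - K z^2) H(z) Theta(z) = H(q z),
     H P = z H' + w H,
   where w depends on K z^2 only, and the exponential formulas follow by
   comparing logarithmic derivatives. *)
From HB Require Import structures.
From mathcomp Require Import all_boot all_order all_algebra all_field.
From mathcomp Require Import zify ring finmap generic_quotient ring_quotient boolp monalg.
From mathcomp Require classical_sets fsbigop.
Require Import Defs.

Set Implicit Arguments.
Unset Strict Implicit.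
Unset Printing Implicit Defensive.

Import GRing.Theory.

Local Open Scope ring_scope.
Local Open Scope quotient_scope.

(** * Riedtmann's formula *)

Section Riedtmann.
Variable k : finFieldType.
Implicit Types M N L : cplx k.

Definition autset L : {set 'M[k]_(ndim L)} :=
  [set g | chom (M := L) (N := L) g & g \in unitmx].

Lemma ses_fiber M N L ip jq (g0 : 'M[k]_(ndim L)) :
    ip \in ses M N L -> jq \in ses M N L ->
    g0 \in autset L -> ip.1 *m g0 = jq.1 -> ip.2 = g0 *m jq.2 ->
  #|[set g in autset L | (ip.1 *m g == jq.1) && (ip.2 == g *m jq.2)]|
  = hom_card M N.
Proof.
case: ip jq => i p [j q]; rewrite !inE /= => /and5P[/andP[/eqP ix /eqP id]
  /andP[/eqP px /eqP pd] /= fi fp /eqmxP ip].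
case/and5P=> /andP[/eqP jx /eqP jd] /andP[/eqP qx /eqP qd] /= fj fq /eqmxP jq.
case/andP=> /andP[/eqP g0x /eqP g0d] g0u ig0 pg0.
have jq0 : j *m q = 0 by apply/sub_kermxP; rewrite jq.
have ip0 : i *m p = 0 by apply/sub_kermxP; rewrite ip.
rewrite /hom_card -(card_imset (f := fun u : 'M_(ndim M, ndim N) => g0 + p *m u *m j)).
  apply: eq_card => g; rewrite !inE; apply/idP/imsetP.
    case/and3P=> /andP[/andP[/eqP gx /eqP gd] _] /eqP ig /eqP pg.
    have : (g - g0) *m q = 0 by rewrite mulmxBl -pg -pg0 subrr.
    move/sub_kermxP; rewrite -jq => /submxP[h gh].
    have : i *m h = 0.
      apply: (row_free_inj fj); rewrite /= -mulmxA -gh mulmxBr ig ig0 subrr.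
      by rewrite mul0mx.
    have [p' p'p] := row_fullP fp.
    move=> ih0; have hE : h = p *m (p' *m h).
      have : ((1%:M - p *m p')%R <= i)%MS.
        rewrite ip; apply/sub_kermxP.
        by rewrite mulmxBl mul1mx -mulmxA p'p mulmx1 subrr.
      case/submxP=> D hD; apply/eqP; rewrite -subr_eq0 mulmxA -{1}[h]mul1mx -mulmxBl.
      by rewrite hD -mulmxA ih0 mulmx0.
    exists (p' *m h); last by rewrite -hE -gh addrC subrK.
    rewrite inE; set u := p' *m h in hE *.
    have E : g - g0 = p *m u *m j by rewrite -hE.
    have inj (a b : 'M_(ndim M, ndim N)) : p *m a *m j = p *m b *m j -> a = b.
      by move/(row_free_inj fj)/(row_full_inj fp).
    apply/andP; split; apply/eqP; apply: inj.
      transitivity (nmx L *m (p *m u *m j)); first by rewrite !mulmxA px.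
      transitivity (p *m u *m j *m nmx L); last by rewrite -!mulmxA jx.
      by rewrite -E mulmxBl mulmxBr gx g0x.
    transitivity (cdiff L *m (p *m u *m j)); first by rewrite !mulmxA pd.
    transitivity (p *m u *m j *m cdiff L); last by rewrite -!mulmxA jd.
    by rewrite -E mulmxBl mulmxBr gd g0d.
  case=> u; rewrite inE => /andP[/eqP ux /eqP ud] ->.
  have uj : g0 + p *m u *m j = g0 *m (1%:M + q *m u *m j).
    by rewrite mulmxDr mulmx1 !mulmxA -pg0.
  have uu : (1%:M + q *m u *m j) *m (1%:M - q *m u *m j) = 1%:M.
    rewrite mulmxDl mul1mx mulmxBr mulmx1.
    rewrite -!mulmxA (mulmxA j) jq0 mul0mx !mulmx0 subr0.
    by rewrite subrK.
  have [uu1 _] := mulmx1_unit uu.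
  rewrite uj unitmx_mul g0u uu1 /= -uj.
  have cx : nmx L *m (p *m u *m j) = p *m u *m j *m nmx L.
    by rewrite !mulmxA px -(mulmxA p (nmx M)) ux -!mulmxA jx.
  have cd : cdiff L *m (p *m u *m j) = p *m u *m j *m cdiff L.
    by rewrite !mulmxA pd -(mulmxA p (cdiff M)) ud -!mulmxA jd.
  rewrite /chom /nrep_hom !mulmxDl !mulmxDr g0x g0d cx cd ig0 -pg0.
  by rewrite -(mulmxA _ j q) jq0 mulmx0 !mulmxA ip0 !mul0mx !addr0 !eqxx.
by move=> u u' /addrI /(row_free_inj fj) /(row_full_inj fp).
Qed.

Lemma ses_equiv_equiv M N L :
  {in ses M N L & &, equivalence_rel (@ses_equiv k M N L)}.
Proof.
have sym : symmetric (@ses_equiv k M N L).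
  suff h ip jq : @ses_equiv k M N L ip jq -> @ses_equiv k M N L jq ip.
    by move=> ip jq; apply/idP/idP; exact: h.
  case/existsP=> g /and4P[/andP[/eqP gx /eqP gd] gu /eqP ig /eqP pg].
  apply/existsP; exists (invmx g); rewrite unitmx_inv gu.
  rewrite -ig pg mulmxK // mulKmx // !eqxx !andbT.
  apply/andP; split; apply/eqP; apply: (can_inj (mulKmx gu)).
    by rewrite !mulmxA -gx mulmxV // mul1mx -mulmxA mulmxV ?mulmx1.
  by rewrite !mulmxA -gd mulmxV // mul1mx -mulmxA mulmxV ?mulmx1.
have tr : transitive (@ses_equiv k M N L).
  move=> y x z /existsP[g /and4P[/andP[/eqP gx /eqP gd] gu /eqP ig /eqP pg]].
  case/existsP=> h /and4P[/andP[/eqP hx /eqP hd] hu /eqP ih /eqP ph].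
  apply/existsP; exists (g *m h); rewrite unitmx_mul gu hu -ih -ig pg ph !mulmxA.
  by rewrite /chom /nrep_hom !mulmxA gx gd -!mulmxA hx hd !eqxx.
move=> x y z _ _ _; split; last by move=> xy; exact: (sym_left_transitive sym tr xy).
apply/existsP; exists 1%:M; rewrite unitmx1 mulmx1 mul1mx !eqxx !andbT.
by rewrite /chom /nrep_hom !mulmx1 !mul1mx !eqxx.
Qed.

Lemma ext_card_aut M N L :
  (ext_card M N L * #|autset L| = #|ses M N L| * hom_card M N)%N.
Proof.
have par := equivalence_partitionP (@ses_equiv_equiv M N L).
rewrite (card_partition par) big_distrl /= /ext_card -sum_nat_const.
apply: eq_bigr => B BP.
have [ip ipB] : exists ip, ip \in B.
  case/imsetP: BP => ip ips ->; exists ip.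
  rewrite inE ips /=; exact: (ses_equiv_equiv ips ips ips).1.
have ips : ip \in ses M N L.
  exact: subsetP (partitionS par BP) _ ipB.
have BE : B = [set jq in ses M N L | ses_equiv (L := L) ip jq].
  rewrite -(def_pblock (partition_trivIset par) BP ipB).
  apply/setP=> jq; rewrite inE; case: (boolP (jq \in ses M N L)) => jqs.
    by rewrite (pblock_equivalence_partition (@ses_equiv_equiv M N L)).
  apply/negP; rewrite (def_pblock (partition_trivIset par) BP ipB) => jqB.
  by case/negP: jqs; apply: subsetP (partitionS par BP) _ jqB.
have -> : #|autset L| = (\sum_(jq in B) \sum_(g in autset L |
    (ip.1 *m g == jq.1) && (ip.2 == g *m jq.2)) 1)%N.
  pose act (g : 'M[k]_(ndim L)) := (ip.1 *m g, invmx g *m ip.2).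
  rewrite (exchange_big_dep (mem (autset L))) /=; last by move=> ? ? _ /andP[].
  rewrite -sum1_card; apply: eq_bigr => g gs.
  rewrite (big_pred1 (act g)) // => jq; rewrite gs /=.
  move: (gs); rewrite inE => /andP[gc gu].
  have cE : (ip.1 *m g == jq.1) && (ip.2 == g *m jq.2) = (jq == act g).
    case: jq => j q; rewrite /act xpair_eqE /= eq_sym; congr (_ && _).
    apply/eqP/eqP=> [->|->]; first by rewrite mulKmx.
    by rewrite mulKVmx.
  rewrite cE andbC; case: eqP => //= ->; rewrite BE inE; apply/andP; split; last first.
    by apply/existsP; exists g; rewrite gc gu mulKVmx ?eqxx.
  move: ips; rewrite !inE /= => /and5P[/andP[/eqP ix /eqP id] /andP[/eqP px /eqP pd] fi fp /eqmxP k0].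
  move: gc => /andP[/eqP gx /eqP gd].
  have [gx' gd'] : nmx L *m invmx g = invmx g *m nmx L /\ cdiff L *m invmx g = invmx g *m cdiff L.
    split; apply: (can_inj (mulKmx gu)); rewrite mulKVmx // mulmxA -?gx -?gd -mulmxA mulmxV ?mulmx1 //.
  apply/and5P; split.
  - by rewrite /chom /nrep_hom !mulmxA ix id -!mulmxA gx gd !eqxx.
  - by rewrite /chom /nrep_hom !mulmxA gx' gd' -!mulmxA px pd !eqxx.
  - by rewrite /row_free mxrankMfree ?row_free_unit.
  - by rewrite /row_full eqmxMfull ?row_full_unit ?unitmx_inv.
  apply/eqmxP/eqmxP; apply/andP; split.
    apply/sub_kermxP; rewrite -mulmxA mulKVmx //; apply/sub_kermxP; rewrite k0 //.
  apply/row_subP=> r; set w := row r _.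
  have : w *m (invmx g *m ip.2) = 0 by apply/sub_kermxP; exact: row_sub.
  rewrite mulmxA => /sub_kermxP; rewrite -k0 => /submxP[D wD].
  by apply/submxP; exists D; rewrite mulmxA -wD mulmxKV.
rewrite -sum_nat_const; apply: eq_bigr => jq; rewrite BE inE.
case/andP=> jqs /existsP[g0 /and4P[g0c g0u /eqP ig0 /eqP pg0]].
rewrite -(@ses_fiber M N L ip jq g0) //; last by rewrite inE g0c.
by rewrite sum1_card; apply: eq_card => g; rewrite [RHS]inE.
Qed.

End Riedtmann.

Definition sim (k : finFieldType) d1 d2 (X D : 'M[k]_d1) (X' D' : 'M[k]_d2) : bool :=
  [exists f : 'M[k]_(d1, d2),
    [&& X *m f == f *m X', D *m f == f *m D', row_free f & row_full f]].

(* Matrices act on row vectors, so this is an extension of A by B. *)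
Definition lblock (k : fieldType) n m (B : 'M[k]_n) (Y : 'M[k]_(m, n)) (A : 'M[k]_m) :
  'M[k]_(n + m) := block_mx B 0 Y A.

Section RiedtmannBlocks.
Variable k : finFieldType.
Implicit Types M N L : cplx k.

Lemma cplx_isoE M N :
  cplx_iso M N <-> sim (nmx M) (cdiff M) (nmx N) (cdiff N).
Proof.
by split=> [[f]|/existsP[f]] h; [apply/existsP|]; exists f; move: h;
  rewrite /chom /nrep_hom -!andbA.
Qed.

Lemma card_sections M N L (ip : _ * _) : ip \in ses M N L ->
  #|[set s : 'M[k]_(ndim M, ndim L) | s *m ip.2 == 1%:M]|
  = (#|k| ^ (ndim M * ndim N))%N.
Proof.
case: ip => i p; rewrite inE /= => /and5P[_ _ fi /row_fullP[s0 s0p] /eqmxP ip].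
have ip0 : i *m p = 0 by apply/sub_kermxP; rewrite ip.
rewrite -card_mx -(card_imset (f := fun u : 'M_(ndim M, ndim N) => s0 + u *m i)).
  apply: eq_card => s; rewrite inE; apply/eqP/imsetP => [sp|[u _ ->]]; last first.
    by rewrite mulmxDl -mulmxA ip0 mulmx0 addr0.
  have : (s - s0) *m p = 0 by rewrite mulmxBl sp s0p subrr.
  move/sub_kermxP; rewrite -ip => /submxP[u su].
  by exists u; rewrite // -su addrC subrK.
by move=> u u' /addrI /(row_free_inj fi).
Qed.

Definition extset M N L : {set 'M[k]_(ndim M, ndim N) * 'M[k]_(ndim M, ndim N)} :=
  [set YC | sim (lblock (nmx N) YC.1 (nmx M)) (lblock (cdiff N) YC.2 (cdiff M))
                (nmx L) (cdiff L)].

Lemma card_ses_blocks M N L :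
  (#|ses M N L| * #|k| ^ (ndim M * ndim N) = #|extset M N L| * #|autset L|)%N.
Proof.
set m := ndim M; set n := ndim N; set d := ndim L.
pose isos (YC : 'M[k]_(m, n) * 'M[k]_(m, n)) := [set g : 'M[k]_(n + m, d) |
  [&& lblock (nmx N) YC.1 (nmx M) *m g == g *m nmx L,
      lblock (cdiff N) YC.2 (cdiff M) *m g == g *m cdiff L, row_free g & row_full g]].
have isosE YC : #|isos YC| = (if YC \in extset M N L then #|autset L| else 0)%N.
  rewrite inE; case: ifPn => [/existsP[g0 /and4P[/eqP gx /eqP gd gfree gfull]]|no]; last first.
    by apply: eq_card0 => g; apply/negbTE; apply/negP; rewrite inE => gP; case/existsP: no; exists g.
  rewrite -(card_imset (f := fun h : 'M_d => g0 *m h)); last exact: row_full_inj.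
  have [[v vg] [w gw]] := (row_fullP gfull, row_freeP gfree).
  have vw : v = w by rewrite -[v]mulmx1 -gw mulmxA vg mul1mx.
  apply: eq_card => g; rewrite inE; apply/idP/imsetP.
    case/and4P=> /eqP gX /eqP gD fr fl; exists (v *m g); last by rewrite mulmxA vw gw mul1mx.
    have [[v' vg'] [w' gw']] := (row_fullP fl, row_freeP fr).
    rewrite inE /chom /nrep_hom; apply/andP; split.
      apply/andP; split; apply/eqP; apply: (row_full_inj gfull); rewrite !mulmxA.
        by rewrite -gx vw -[_ *m w]mulmxA gw mulmx1 mul1mx gX.
      by rewrite -gd vw -[_ *m w]mulmxA gw mulmx1 mul1mx gD.
    by case: (@mulmx1_unit _ _ (v *m g) (w' *m g0)); rewrite // mulmxA -(mulmxA v) gw' mulmx1.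
  case=> h; rewrite inE => /andP[/andP[/eqP hx /eqP hd] hu] ->.
  rewrite !mulmxA gx gd -!mulmxA hx hd !eqxx /=; apply/andP; split.
    by rewrite /row_free mxrankMfree ?row_free_unit.
  by rewrite /row_full eqmxMfull // mxrank_unit.
pose T := [set t : 'M[k]_(n + m, d) * ('M[k]_(m, n) * 'M[k]_(m, n)) | t.1 \in isos t.2].
pose T' := [set t : ('M[k]_(n, d) * 'M[k]_(d, m)) * 'M[k]_(m, d) |
   (t.1 \in ses M N L) && (t.2 *m t.1.2 == 1%:M)].
have -> : (#|extset M N L| * #|autset L| = #|T|)%N.
  rewrite -sum_nat_const big_mkcond /=.
  under eq_bigr => YC _ do rewrite -isosE -sum1_card.
  rewrite (exchange_big_dep predT) //= pair_big_dep /= sum1_card.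
  by apply: eq_card => -[g YC]; rewrite [RHS]inE.
have -> : (#|ses M N L| * #|k| ^ (m * n) = #|T'|)%N.
  rewrite -sum_nat_const.
  under eq_bigr => ip ips do rewrite -(card_sections ips) -sum1_card.
  rewrite pair_big_dep /= sum1_card; apply: eq_card => -[ip s].
  rewrite [RHS]inE /=.
  by have -> : (s *m ip.2 == 1%:M) = (s \in [set s : 'M[k]_(m, d) | s *m ip.2 == 1%:M])
    by rewrite inE.
pose F (t : 'M[k]_(n + m, d) * ('M[k]_(m, n) * 'M[k]_(m, n))) :=
  ((usubmx t.1, pinvmx t.1 *m col_mx 0 1%:M : 'M_(d, m)), dsubmx t.1).
rewrite -(@card_in_imset _ _ F T); last first.
  case=> g [Y C] [g' [Y' C']]; rewrite !inE /= => /and4P[/eqP gx /eqP gd fr _].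
  case/and4P=> /eqP gx' /eqP gd' _ _ /eqP.
  rewrite !xpair_eqE -!andbA => /and3P[/eqP gu _ /eqP gl].
  have gg' : g = g' by rewrite -[g]vsubmxK gu gl vsubmxK.
  rewrite -{}gg' {gu gl} in gx' gd' *.
  have := row_free_inj fr (etrans gx (esym gx')).
  have := row_free_inj fr (etrans gd (esym gd')).
  by move=> /eq_block_mx[_ _ -> _] /eq_block_mx[_ _ -> _].
apply: eq_card => -[[i p] s]; rewrite !inE /=; apply/idP/imsetP.
  case/andP=> /and5P[/andP[/eqP ix /eqP id] /andP[/eqP px /eqP pd] fi fp /eqmxP ip] /eqP sp.
  have ip0 : i *m p = 0 by apply/sub_kermxP; rewrite ip.
  have ker (u : 'M_(m, d)) : u *m p = 0 -> u = u *m pinvmx i *m i.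
    by move/sub_kermxP; rewrite -ip => /mulmxKpV.
  pose Y := (s *m nmx L - nmx M *m s) *m pinvmx i.
  pose C := (s *m cdiff L - cdiff M *m s) *m pinvmx i.
  pose g := col_mx i s : 'M[k]_(n + m, d).
  have Yi : Y *m i + nmx M *m s = s *m nmx L.
    by rewrite -ker ?subrK // mulmxBl -!mulmxA px sp mulmx1 mulmxA sp mul1mx subrr.
  have Ci : C *m i + cdiff M *m s = s *m cdiff L.
    by rewrite -ker ?subrK // mulmxBl -!mulmxA pd sp mulmx1 mulmxA sp mul1mx subrr.
  have gp : g *m p = col_mx 0 1%:M by rewrite mul_col_mx ip0 sp.
  have fl : row_full g.
    rewrite -sub1mx; have -> : (1%:M : 'M_d) = p *m s + (1%:M - p *m s).
      by rewrite addrC subrK.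
    rewrite addmx_sub //.
      by apply: submx_trans (submxMl _ _) _; rewrite /g -addsmxE addsmxSr.
    have : ((1%:M - p *m s) *m p)%R = 0 by rewrite mulmxBl mul1mx -mulmxA sp mulmx1 subrr.
    move/sub_kermxP => h; apply: submx_trans h _; rewrite -ip /g -addsmxE.
    exact: addsmxSl.
  have fr : row_free g.
    rewrite /row_free eqn_leq rank_leq_row /=.
    have := mxrank_ker p; rewrite -ip (eqP fi) (eqP fp) -/d -/n -/m => nE.
    have mnd : (m <= d)%N by have := rank_leq_row p; rewrite (eqP fp).
    by rewrite (eqP fl) {1}nE subnK.
  exists (g, (Y, C)).
    rewrite inE /= inE /lblock fr fl !mul_block_col !mul0mx !addr0 ix id Yi Ci.
    by rewrite -!mul_col_mx !eqxx.
  rewrite /F /= col_mxKu col_mxKd -gp mulmxA mulVpmx ?mul1mx //.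
move=> h; case: h => -[g [Y C]]; rewrite !inE /= => /and4P[/eqP gx /eqP gd fr fl] [-> -> ->] {i p s}.
rewrite -[g]vsubmxK in gx gd.
move: gx gd; rewrite /lblock !mul_block_col !mul_col_mx !mul0mx !addr0.
move=> /eq_col_mx[ix Yx] /eq_col_mx[id Cd].
have gV : g *m pinvmx g = 1%:M by rewrite mulmxVp.
have Vg : pinvmx g *m g = 1%:M by rewrite mulVpmx.
have : col_mx (usubmx g *m pinvmx g *m col_mx 0 1%:M) (dsubmx g *m pinvmx g *m col_mx 0 1%:M) =
   col_mx 0 1%:M :> 'M_(n + m, m).
  by rewrite -!mul_col_mx vsubmxK gV mul1mx.
rewrite -!(mulmxA _ (pinvmx g)); set p := pinvmx g *m _ => /eq_col_mx[ip0 sp].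
have pE : p = pinvmx g *m col_mx 0 1%:M by [].
clearbody p; have gp : g *m p = col_mx 0 1%:M by rewrite pE mulmxA gV mul1mx.
have px (x : 'M_d) (a : 'M_m) (b : 'M_n) (y : 'M_(m, n)) :
     b *m usubmx g = usubmx g *m x -> y *m usubmx g + a *m dsubmx g = dsubmx g *m x ->
   x *m p = p *m a.
  move=> bx yx; apply: (row_full_inj fl).
  rewrite !mulmxA gp -[g]vsubmxK !mul_col_mx -bx -yx mulmxDl -!mulmxA ip0 sp !mulmx0.
  by rewrite mulmx1 add0r mul0mx mul1mx.
rewrite sp eqxx andbT /chom /nrep_hom -ix -id !eqxx /=.
rewrite (px _ _ _ _ ix Yx) (px _ _ _ _ id Cd) !eqxx /=.
apply/and3P; split.
- apply/row_freeP; exists (pinvmx g *m col_mx 1%:M 0).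
  by rewrite mul_usub_mx mulmxA gV mul1mx col_mxKu.
- by apply/row_fullP; exists (dsubmx g).
apply/eqmxP/eqmxP; apply/andP; split; first exact/sub_kermxP.
apply/row_subP=> r; set w := row r _.
have : w *m p = 0 by apply/sub_kermxP; exact: row_sub.
rewrite pE mulmxA -{1}[w *m _]hsubmxK mul_row_col mulmx0 mulmx1 add0r => w0.
apply/submxP; exists (lsubmx (w *m pinvmx g)).
rewrite -[w in LHS]mulmx1 -Vg mulmxA; move: (w *m pinvmx g) w0 => z z0.
by rewrite -{1}[z]hsubmxK -{1}[g]vsubmxK mul_row_col z0 mul0mx addr0.
Qed.

Lemma ext_card_hom_card M N L :
  (ext_card M N L * #|k| ^ (ndim M * ndim N) = #|extset M N L| * hom_card M N)%N.
Proof.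
have a0 : (0 < #|autset L|)%N.
  apply/card_gt0P; exists 1%:M; rewrite inE unitmx1 /chom /nrep_hom.
  by rewrite !mulmx1 !mul1mx !eqxx.
apply/eqP; rewrite -(eqn_pmul2r a0) mulnAC ext_card_aut mulnAC card_ses_blocks.
by rewrite mulnAC.
Qed.

End RiedtmannBlocks.

Section Similarity.
Variable k : finFieldType.

Lemma simP d1 d2 (X D : 'M[k]_d1) (X' D' : 'M[k]_d2) :
  sim X D X' D' <-> exists (f : 'M[k]_(d1, d2)) (g : 'M[k]_(d2, d1)),
    [/\ f *m g = 1%:M, g *m f = 1%:M, X *m f = f *m X' & D *m f = f *m D'].
Proof.
split=> [/existsP[f /and4P[/eqP Xf /eqP Df ffr ffu]]|[f [g [fg gf Xf Df]]]].
  by exists f, (pinvmx f); rewrite mulmxVp ?mulVpmx.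
apply/existsP; exists f; rewrite Xf Df !eqxx /=; apply/andP; split.
  by apply/row_freeP; exists g.
by apply/row_fullP; exists g.
Qed.

Lemma sim_refl d (X D : 'M[k]_d) : sim X D X D.
Proof. by apply/simP; exists 1%:M, 1%:M; rewrite !mulmx1 !mul1mx. Qed.

Lemma sim_sym d1 d2 (X D : 'M[k]_d1) (X' D' : 'M[k]_d2) :
  sim X D X' D' -> sim X' D' X D.
Proof.
case/simP=> f [g [fg gf Xf Df]]; apply/simP; exists g, f; split=> //.
  by rewrite -[LHS]mul1mx -gf -mulmxA (mulmxA f) -Xf -mulmxA fg mulmx1.
by rewrite -[LHS]mul1mx -gf -mulmxA (mulmxA f) -Df -mulmxA fg mulmx1.
Qed.

Lemma sim_trans d1 d2 d3 (X D : 'M[k]_d1) (X' D' : 'M[k]_d2) (X'' D'' : 'M[k]_d3) :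
  sim X D X' D' -> sim X' D' X'' D'' -> sim X D X'' D''.
Proof.
case/simP=> f [g [fg gf Xf Df]] /simP[f' [g' [fg' gf' Xf' Df']]].
apply/simP; exists (f *m f'), (g' *m g).
rewrite !mulmxA Xf Df -!mulmxA Xf' Df' (mulmxA f') fg' mul1mx fg.
by rewrite (mulmxA g) gf mul1mx gf'.
Qed.

Lemma sim_dim d1 d2 (X D : 'M[k]_d1) (X' D' : 'M[k]_d2) : sim X D X' D' -> d1 = d2.
Proof. by case/existsP=> f /and4P[_ _ /eqP fr /eqP fl]; exact: etrans (esym fr) fl. Qed.

Definition cplxP d (X D : 'M[k]_d) : Prop :=
  [/\ exists r, X ^+ r = 0, X *m D == D *m X & D *m D = 0].

Lemma sim_cplxP d1 d2 (X D : 'M[k]_d1) (X' D' : 'M[k]_d2) :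
  sim X D X' D' -> cplxP X' D' -> cplxP X D.
Proof.
move=> s; have d12 := sim_dim s; subst d2.
case/simP: s => f [g [fg gf Xf Df]] [[r Xr] /eqP XD DD].
have gfree (A B : 'M_d1) : A *m f = B *m f -> A = B.
  by move=> /(congr1 (mulmx^~ g)); rewrite -!mulmxA fg !mulmx1.
split.
- exists r; apply: gfree; rewrite mul0mx.
  suff -> : X ^+ r *m f = f *m X' ^+ r by rewrite Xr mulmx0.
  elim: (r) => [|s IH]; first by rewrite !expr0 mulmx1 mul1mx.
  by rewrite exprSr -mulmxE -mulmxA Xf mulmxA IH -mulmxA exprSr mulmxE.
- by apply/eqP; apply: gfree; rewrite -!mulmxA Df Xf !mulmxA Xf Df -!mulmxA XD.
- by apply: gfree; rewrite -!mulmxA Df mulmxA Df -mulmxA DD mulmx0 mul0mx.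
Qed.

Lemma lblock_exp n m (B : 'M[k]_n) (Y : 'M[k]_(m, n)) (A : 'M[k]_m) r :
  exists Z, lblock B Y A ^+ r = lblock (B ^+ r) Z (A ^+ r).
Proof.
elim: r => [|r [Z IH]]; first by exists 0; rewrite /lblock !expr0 -scalar_mx_block.
eexists; rewrite exprS IH /lblock -mulmxE mulmx_block !mulmx0 !mul0mx !addr0 add0r.
by rewrite !mulmxE -!exprS; reflexivity.
Qed.

Lemma lblock_nil n m (B : 'M[k]_n) (Y : 'M[k]_(m, n)) (A : 'M[k]_m) :
  (exists r, lblock B Y A ^+ r = 0) <-> (exists r, B ^+ r = 0) /\ (exists r, A ^+ r = 0).
Proof.
split=> [[r]|[[b Bb] [a Aa]]].
  have [Z ->] := lblock_exp B Y A r; rewrite -[0]block_mx0 /lblock.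
  by case/eq_block_mx => Br _ _ Ar; split; exists r.
exists (a + b)%N; have [[Z Za] [Z' Zb]] := (lblock_exp B Y A a, lblock_exp B Y A b).
rewrite exprD Za Zb Aa Bb -mulmxE /lblock mulmx_block.
by rewrite !mulmx0 !mul0mx !addr0 block_mx0.
Qed.

Lemma lblock_cplxP n m (X' D' : 'M[k]_n) (Y C : 'M[k]_(m, n)) (X D : 'M[k]_m) :
  cplxP (lblock X' Y X) (lblock D' C D) -> cplxP X D /\ cplxP X' D'.
Proof.
case=> /lblock_nil[nB nA] /eqP.
rewrite /lblock !mulmx_block !mulmx0 !mul0mx !addr0 !add0r => /eq_block_mx[XD' _ _ XD].
move=> /eqP; rewrite block_mx_eq0 => /and4P[/eqP DD' _ _ /eqP DD].
by split; split=> //; apply/eqP.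
Qed.

Definition mkcplx d (X D : 'M[k]_d) (h : cplxP X D) : cplx k :=
  let: And3 h1 h2 h3 := h in @Cplx k (Nrep h1) D h2 h3.

Lemma nmx_mkcplx d (X D : 'M[k]_d) (h : cplxP X D) (M : cplx k) :
  sim (nmx M) (cdiff M) X D -> cplx_iso M (mkcplx h).
Proof. by case: h => h1 h2 h3 s; apply/cplx_isoE. Qed.

Lemma cplx_cplxP (M : cplx k) : cplxP (nmx M) (cdiff M).
Proof. by split; [exact: nmx_nil | exact: (cdiff_hom M) | exact: cdiff_sq]. Qed.

End Similarity.

(** * Products of classes of matrices *)

Section HallClasses.
Import classical_sets fsbigop.
Variables (k : finFieldType) (F : fieldType).
Local Notation q := (#|k|%:R : F).

Definition hcl d (X D : 'M[k]_d) : hall k F :=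
  if pselect (cplxP X D) is left h then hcls F (mkcplx h) else 0.

Lemma hcls_iso (M N : cplx k) : cplx_iso M N -> hcls F M = hcls F N.
Proof. by move=> MN; congr (<< _ >>); apply/eqmodP/asboolP. Qed.

Lemma hcl_cplx (M : cplx k) : hcl (nmx M) (cdiff M) = hcls F M.
Proof.
rewrite /hcl; case: pselect => [h|[]]; last exact: cplx_cplxP.
by apply/esym/hcls_iso/nmx_mkcplx/sim_refl.
Qed.

Lemma hcl_eq0 d (X D : 'M[k]_d) : ~ cplxP X D -> hcl X D = 0.
Proof. by rewrite /hcl; case: pselect. Qed.

Lemma hcl_sim d1 d2 (X D : 'M[k]_d1) (X' D' : 'M[k]_d2) :
  sim X D X' D' -> hcl X D = hcl X' D'.
Proof.
move=> s; rewrite /hcl; case: pselect => [h|nh]; case: pselect => [h'|nh'] //.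
- apply: hcls_iso; apply: nmx_mkcplx; apply: sim_trans s.
  by case: (h) => *; exact: sim_refl.
- by case: nh'; apply: sim_cplxP h; exact: sim_sym.
- by case: nh; apply: sim_cplxP h'.
Qed.

Lemma sum_extset (a : F) (M N : cplx k) :
  \sum_(L \in [set: isoclass k]) (#|extset M N (repr L)|%:R * a) *: (<< L >> : hall k F)
  = a *: \sum_(YC : 'M[k]_(ndim M, ndim N) * 'M[k]_(ndim M, ndim N))
      hcl (lblock (nmx N) YC.1 (nmx M)) (lblock (cdiff N) YC.2 (cdiff M)).
Proof.
pose T : finType := ('M[k]_(ndim M, ndim N) * 'M[k]_(ndim M, ndim N))%type.
pose bX (t : T) := lblock (nmx N) t.1 (nmx M).
pose bD (t : T) := lblock (cdiff N) t.2 (cdiff M).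
pose cl (t : T) : isoclass k :=
  if pselect (cplxP (bX t) (bD t)) is left h then \pi_(isoclass k) (mkcplx h) else \pi_(isoclass k) M.
pose A := [fset L in [seq cl t | t <- enum T]]%fset.
have ext_cl (L : isoclass k) t : sim (bX t) (bD t) (nmx (repr L)) (cdiff (repr L)) ->
    cl t = L /\ hcl (bX t) (bD t) = << L >>.
  move=> s; rewrite /cl /hcl; case: pselect => [h|]; last first.
    by case; apply: sim_cplxP s _; exact: cplx_cplxP.
  suff -> : L = \pi_(isoclass k) (mkcplx h) by [].
  rewrite -[L]reprK; apply/eqmodP/asboolP/nmx_mkcplx.
  exact: sim_sym.
have cl_ext t : cplxP (bX t) (bD t) ->
    sim (bX t) (bD t) (nmx (repr (cl t))) (cdiff (repr (cl t))).
  move=> h'; rewrite /cl; case: pselect => // h.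
  have /eqmodP/asboolP/cplx_isoE := esym (reprK (\pi_(isoclass k) (mkcplx h))).
  by case: (h).
rewrite (fsbigTE A) => [|L LA]; last first.
  suff -> : extset M N (repr L) = finset.set0 by rewrite cards0 mul0r scale0r.
  apply/setP=> t; rewrite inE finset.in_set0; apply/negbTE/negP => s; have [clt _] := ext_cl _ _ s.
  by case/negP: LA; rewrite !inE; apply/mapP; exists t; rewrite ?mem_enum.
transitivity (a *: \sum_(L <- A) \sum_(t : T)
    if sim (bX t) (bD t) (nmx (repr L)) (cdiff (repr L)) then (<< L >> : hall k F) else 0).
  rewrite scaler_sumr; apply: eq_bigr => L _.
  rewrite -big_mkcond sumr_const mulrC -scalerA scaler_nat; congr (_ *: (_ *+ _)).
  by apply: eq_card => t; rewrite inE.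
rewrite exchange_big; congr (_ *: _); apply: eq_bigr => t _; rewrite -big_mkcond /=.
case: (pselect (cplxP (bX t) (bD t))) => [h|nh]; last first.
  rewrite hcl_eq0 // big1 // => L s.
  by case: nh; apply: sim_cplxP s _; exact: cplx_cplxP.
rewrite (eq_bigl (pred1 (cl t))) => [|L].
  rewrite big_mkcond (bigD1_seq (cl t)) ?fset_uniq //=; last first.
    by rewrite !inE; apply/mapP; exists t; rewrite ?mem_enum.
  rewrite eqxx big1 ?addr0 => [|L /negPf -> //].
  by have [_ ->] := ext_cl _ _ (cl_ext _ h).
apply/idP/eqP=> [/ext_cl[]//|->]; exact: cl_ext.
Qed.

Hypothesis char0 : [pchar F] =i pred0.

Lemma natr_neq0 n : (n%:R != 0 :> F) = (0 < n)%N.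
Proof. by rewrite (pcharf0P _).1 ?lt0n. Qed.

Lemma qcard_neq0 : q != 0.
Proof. by rewrite natr_neq0; apply/card_gt0P; exists 0. Qed.

Lemma hprodE (M N : isoclass k) : hprod F M N =
  q ^- (ndim (repr M) * ndim (repr N)) *:
    \sum_(YC : 'M[k]_(ndim (repr M), ndim (repr N)) * 'M[k]_(ndim (repr M), ndim (repr N)))
      hcl (lblock (nmx (repr N)) YC.1 (nmx (repr M)))
          (lblock (cdiff (repr N)) YC.2 (cdiff (repr M))).
Proof.
rewrite -sum_extset /hprod; apply: eq_fsbigr => L _; congr (_ *: _).
have hom0 : (hom_card (repr M) (repr N))%:R != 0 :> F.
  rewrite natr_neq0; apply/card_gt0P; exists 0.
  by rewrite inE /chom /nrep_hom !mulmx0 !mul0mx !eqxx.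
apply/eqP; rewrite -mulrC mulrC eqr_div ?expf_neq0 ?qcard_neq0 //.
by rewrite -natrX -!natrM ext_card_hom_card.
Qed.

Lemma hprod_hmul (M N : isoclass k) : hmul (<< M >> : hall k F) << N >> = hprod F M N.
Proof.
rewrite (hmulEw (d1 := [fset M]%fset) (d2 := [fset N]%fset)) ?msuppU_le //.
by rewrite !big_seq_fset1 !mcoeffUU mulr1 scale1r.
Qed.

Lemma sum_lblock_sim m m' n n' (X D : 'M[k]_m) (X1 D1 : 'M[k]_m')
    (X' D' : 'M[k]_n) (X1' D1' : 'M[k]_n') :
  sim X D X1 D1 -> sim X' D' X1' D1' ->
  \sum_(YC : 'M[k]_(m, n) * 'M[k]_(m, n)) hcl (lblock X' YC.1 X) (lblock D' YC.2 D)
  = \sum_(YC : 'M[k]_(m', n') * 'M[k]_(m', n')) hcl (lblock X1' YC.1 X1) (lblock D1' YC.2 D1).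
Proof.
case/simP=> f [g [fg gf Xf Df]] /simP[f' [g' [fg' gf' Xf' Df']]].
pose h (YC : 'M[k]_(m', n') * 'M[k]_(m', n')) := (f *m YC.1 *m g', f *m YC.2 *m g').
rewrite (reindex h) /=; last first.
  exists (fun YC => (g *m YC.1 *m f', g *m YC.2 *m f')) => -[Y C] _;
    congr pair; rewrite /= !mulmxA ?gf ?fg mul1mx -!mulmxA ?gf' ?fg' mulmx1 //.
apply: eq_bigr => -[Y C] _; apply: hcl_sim; apply/simP.
exists (block_mx f' 0 0 f), (block_mx g' 0 0 g).
rewrite !mulmx_block !(mulmx0, mul0mx, addr0, add0r) fg fg' gf gf' -!scalar_mx_block.
split=> //=.
  by rewrite Xf Xf' -(mulmxA _ g') gf' mulmx1.
by rewrite Df Df' -(mulmxA _ g') gf' mulmx1.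
Qed.

Lemma hmul_hcl m n (X D : 'M[k]_m) (X' D' : 'M[k]_n) :
  hmul (hcl X D) (hcl X' D') = q ^- (m * n) *:
    \sum_(YC : 'M[k]_(m, n) * 'M[k]_(m, n)) hcl (lblock X' YC.1 X) (lblock D' YC.2 D).
Proof.
have [[h h']|nh] := pselect (cplxP X D /\ cplxP X' D'); last first.
  rewrite big1 => [|YC _]; last first.
    by rewrite hcl_eq0 // => /lblock_cplxP.
  rewrite scaler0 /hmul; have [h|h] := pselect (cplxP X D).
    have h' : ~ cplxP X' D' by move=> h'; apply: nh.
    by rewrite (hcl_eq0 h') msupp0 big1 // => ? _; rewrite big_seq_fset0.
  by rewrite (hcl_eq0 h) msupp0 big_seq_fset0.
rewrite {1 2}/hcl; case: pselect => // {}h; case: pselect => // {}h'.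
rewrite /hcls hprod_hmul hprodE.
set M := \pi_(isoclass k) (mkcplx h); set N := \pi_(isoclass k) (mkcplx h').
have sM : sim (nmx (repr M)) (cdiff (repr M)) X D.
  have /eqmodP/asboolP/cplx_isoE := reprK M.
  by case: (h).
have sN : sim (nmx (repr N)) (cdiff (repr N)) X' D'.
  have /eqmodP/asboolP/cplx_isoE := reprK N.
  by case: (h').
by rewrite (sum_lblock_sim sM sN) (sim_dim sM) (sim_dim sN).
Qed.

End HallClasses.

(** * Jordan normal form of nilpotent matrices *)

Section JordanForm.
Variable k : finFieldType.

Lemma sim_dsum m n m' n' (A : 'M[k]_m) (B : 'M[k]_n) (A' : 'M[k]_m') (B' : 'M[k]_n') :
  sim A 0 A' 0 -> sim B 0 B' 0 ->
  sim (block_mx A 0 0 B : 'M_(m + n)) 0 (block_mx A' 0 0 B' : 'M_(m' + n')) 0.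
Proof.
case/simP=> f [g [fg gf Af _]] /simP[f' [g' [fg' gf' Bf _]]].
apply/simP; exists (block_mx f 0 0 f'), (block_mx g 0 0 g').
rewrite !mulmx_block !(mulmx0, mul0mx, addr0, add0r) fg gf fg' gf' Af Bf.
by rewrite -!scalar_mx_block.
Qed.

Lemma sim_unit d1 d2 (X : 'M[k]_d1) (X' : 'M[k]_d2) (f : 'M[k]_(d1, d2)) :
  d1 = d2 -> row_free f -> X *m f = f *m X' -> sim X 0 X' 0.
Proof.
move=> d12 fr Xf; apply/existsP; exists f.
rewrite Xf mulmx0 mul0mx !eqxx fr /= /row_full; subst d2; exact: fr.
Qed.

Lemma nil_split d (X : 'M[k]_d) e : X ^+ e.+1 = 0 -> X ^+ e != 0 ->
  exists d' (X' : 'M[k]_d'), [/\ d = (e.+1 + d')%N, X' ^+ e.+1 = 0 &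
    sim X 0 (block_mx (jordan_mx k e.+1) 0 0 X' : 'M_(e.+1 + d')) 0].
Proof.
move=> X0 /matrix0Pn[i [j Xij]].
pose P := \matrix_(a < e.+1, b < d) (X ^+ a) i b.
pose Q := \matrix_(b < d, a < e.+1) (X ^+ (e - a)) b j.
have big0 n : (e < n)%N -> X ^+ n = 0.
  by move=> en; rewrite -(subnK en) exprD X0 mulr0.
have PX : P *m X = jordan_mx k e.+1 *m P.
  apply/matrixP=> a b; rewrite !mxE.
  transitivity ((X ^+ a.+1) i b).
    by rewrite exprSr -mulmxE mxE; apply: eq_bigr => c _; rewrite mxE.
  have [ae|ae] := ltnP a.+1 e.+1.
    rewrite (bigD1 (Ordinal ae)) //= !mxE eqxx mul1r big1 ?addr0 // => c ca.
    by rewrite mxE eq_sym -[c == a.+1 :> nat]/(c == Ordinal ae) (negPf ca) mul0r.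
  rewrite big0 // mxE big1 // => c _; rewrite mxE gtn_eqF ?mul0r //.
  exact: leq_trans ae.
have XQ : X *m Q = Q *m jordan_mx k e.+1.
  apply/matrixP=> b a; rewrite !mxE.
  transitivity ((X ^+ (e - a).+1) b j).
    by rewrite exprS -mulmxE mxE; apply: eq_bigr => c _; rewrite mxE.
  case: (posnP a) => [a0|a0].
    rewrite a0 subn0 X0 mxE big1 // => c _; rewrite !mxE a0 mulr0 //.
  have ae : (a.-1 < e.+1)%N by rewrite prednK // ltnW.
  rewrite (bigD1 (Ordinal ae)) //= !mxE /= prednK // eqxx mulr1 big1 ?addr0 => [|c ca].
    by congr ((X ^+ _) b j); move: a0 (ltn_ord a); case: (a : nat) => //= a' _; rewrite ltnS => /subnSK ->.
  rewrite !mxE; case: eqP => [ca'|]; last by rewrite mulr0.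
  by case/eqP: ca; apply: val_inj; rewrite /= -ca'.
have PQ : P *m Q \in unitmx.
  rewrite unitmxE -det_tr det_trig.
    rewrite unitfE; apply/prodf_neq0 => a _; rewrite !mxE.
    rewrite (eq_bigr (fun c => (X ^+ a) i c * (X ^+ (e - a)) c j)); last first.
      by move=> c _; rewrite !mxE.
    have -> : \sum_c (X ^+ a) i c * (X ^+ (e - a)) c j = (X ^+ e) i j.
      have -> : X ^+ e = X ^+ a *m X ^+ (e - a) by rewrite mulmxE -exprD subnKC // -ltnS.
      by rewrite mxE.
    by [].
  apply/is_trig_mxP => a b ab; rewrite !mxE.
  transitivity ((X ^+ (b + (e - a))) i j).
    by rewrite exprD -mulmxE mxE; apply: eq_bigr => c _; rewrite !mxE.
  by rewrite big0 ?mxE // addnBA ?(ltn_ord a : a <= e)%N // ltn_subRL ltn_add2r.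
have rQ : \rank Q = e.+1.
  apply/eqP; rewrite eqn_leq rank_leq_col.
  by rewrite -{1}(mxrank_unit PQ) mxrankM_maxr.
pose N := row_base (kermx Q).
have Nfr : row_free N by exact: row_base_free.
have NQ : N *m Q = 0 by apply/sub_kermxP; rewrite eq_row_base.
pose X' := N *m X *m pinvmx N.
have XN : X' *m N = N *m X.
  apply: mulmxKpV; rewrite eq_row_base; apply/sub_kermxP.
  by rewrite -mulmxA XQ mulmxA NQ mul0mx.
exists (\rank (kermx Q)), X'.
have dE : d = (e.+1 + \rank (kermx Q))%N.
  by rewrite mxrank_ker rQ subnKC // -rQ rank_leq_row.
split=> //.
  apply: (row_free_inj Nfr) => /=; rewrite mul0mx.
  have XNr r : X' ^+ r *m N = N *m X ^+ r.
    elim: r => [|r IH]; first by rewrite !expr0 mul1mx mulmx1.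
    by rewrite exprSr -mulmxE -mulmxA XN mulmxA IH -mulmxA exprSr mulmxE.
  by rewrite XNr X0 mulmx0.
apply: sim_sym; apply: (@sim_unit _ _ _ _ (col_mx P N)) => //.
  apply: inj_row_free => v; rewrite -[v]hsubmxK mul_row_col => v0.
  have := congr1 (mulmx^~ Q) v0; rewrite /= mulmxDl -(mulmxA _ P) -(mulmxA _ N) NQ mulmx0 addr0 mul0mx => v1.
  have l0 : lsubmx v = 0 by rewrite -[lsubmx v](mulmxK PQ) v1 mul0mx.
  move: v0; rewrite l0 mul0mx add0r => v0.
  have -> : rsubmx v = 0 by apply: (row_free_inj Nfr); rewrite /= v0 mul0mx.
  exact: row_mx0.
by rewrite mul_block_col !mul0mx addr0 add0r XN -PX mul_col_mx.
Qed.

Definition is_part (l : seq nat) := sorted geq l && all (leq 1) l.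

Lemma nil_jordan d (X : 'M[k]_d) e : X ^+ e = 0 ->
  exists l, [/\ is_part l, all (geq e) l, sumn l = d & sim X 0 (nmx (Spart k l)) 0].
Proof.
have [n] := ubnP (d + e)%N; elim: n d e X => // n IH d e X den X0.
case: e X0 den => [|e] X0 den.
  exists [::]; have d0 : d = 0%N.
    case: d X X0 {den} => // d X /matrixP/(_ 0 0); rewrite !mxE eqxx => /eqP.
    by rewrite oner_eq0.
  by subst d; split=> //; apply: sim_unit (0 : 'M_0) _ _ _ => //;
    rewrite /row_free ?mxrank0 ?thinmx0.
have [Xe|Xe] := eqVneq (X ^+ e) 0.
  have [l [pl le sl s]] := IH d e X ltac:(by rewrite addnS in den) Xe.
  exists l; split=> //; apply: sub_all le => x /=; exact: leqW.
have [d' [X' [dE X'0 s]]] := nil_split X0 Xe.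
have d'n : (d' + e.+1 < n)%N.
  by move: den; rewrite dE ltnS => /(leq_trans _) -> //; rewrite addSn ltnS leq_add2r leq_addl.
have [l [/andP[srt pos] le sl s']] := IH d' e.+1 X' d'n X'0.
exists (e.+1 :: l); split; rewrite /is_part /= ?leqnn ?sl //.
  by rewrite path_sortedE ?srt ?pos ?le // => a b c /= ba cb; exact: leq_trans cb ba.
apply: sim_trans s _; apply: (sim_dsum (sim_refl _ _) s').
Qed.

Lemma jordan_tr n : sim (jordan_mx k n) 0 (jordan_mx k n)^T 0.
Proof.
pose f := \matrix_(i < n, j < n) ((rev_ord i == j)%:R : k).
have ff : f *m f = 1%:M.
  apply/matrixP=> i j; rewrite !mxE (bigD1 (rev_ord i)) //= !mxE eqxx mul1r rev_ordK.
  rewrite big1 ?addr0 // => l ne; rewrite !mxE eq_sym (negPf ne) mul0r //.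
apply/simP; exists f, f; rewrite !mulmx0 !mul0mx; split=> //.
apply/matrixP=> i j; rewrite !mxE.
rewrite [RHS](bigD1 (rev_ord i)) //= [X in _ = _ + X]big1; last first.
  by move=> l ne; rewrite !mxE eq_sym (negPf ne) mul0r.
rewrite !mxE eqxx mul1r addr0 /=.
rewrite [LHS](bigD1 (rev_ord j)) //= [X in _ + X]big1; last first.
  move=> l ne; rewrite !mxE; case: (rev_ord l =P j) => [lj|]; last by rewrite mulr0.
  by rewrite -lj rev_ordK eqxx in ne.
rewrite !mxE rev_ordK eqxx mulr1 addr0 /=; congr (nat_of_bool _)%:R.
have := ltn_ord i; have := ltn_ord j; move: (i : nat) (j : nat) => a b bn an.
lia.
Qed.

Lemma nil_tr d (X : 'M[k]_d) : (exists r, X ^+ r = 0) -> sim X 0 X^T 0.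
Proof.
case=> r /nil_jordan[l [_ _ _ s]].
have strT d1 d2 (A : 'M[k]_d1) (B : 'M[k]_d2) : sim A 0 B 0 -> sim A^T 0 B^T 0.
  case/simP=> f [g [fg gf Af _]]; apply/sim_sym/simP; exists f^T, g^T.
  by rewrite -!trmx_mul fg gf Af !trmx1 !mulmx0 !mul0mx.
apply: sim_trans s (sim_trans _ (sim_sym (strT _ _ _ _ s))).
elim: l => [|n l IH] /=; first exact: jordan_tr.
by rewrite tr_block_mx !trmx0; apply: sim_dsum IH; exact: jordan_tr.
Qed.

Lemma rank_jordan_exp n r : \rank (jordan_mx k n ^+ r) = (n - r)%N.
Proof.
apply/eqP; rewrite eqn_leq; apply/andP; split.
  have -> : jordan_mx k n ^+ r = pid_mx (n - r) *m jordan_mx k n ^+ r.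
    apply/matrixP=> i j; rewrite [RHS]mxE (bigD1 i) //= big1 => [|l li]; last first.
      by rewrite !mxE eq_sym (negPf (li : l != i :> nat)) mul0r.
    rewrite addr0 jordan_mx_exp mxE eqxx /= ltn_subRL addnC.
    case: eqP => [->|]; last by rewrite mulr0.
    by rewrite ltn_ord mulr1.
  by apply: leq_trans (mxrankM_maxl _ _) _; rewrite rank_pid_mx ?leq_subr.
rewrite leq_subLR -{1}(mxrank1 k n).
have -> : 1%:M = pid_mx r + (jordan_mx k n ^+ r)^T *m jordan_mx k n ^+ r.
  apply/matrixP=> i j; rewrite !mxE.
  under eq_bigr => l _ do rewrite mxE !jordan_mx_exp.
  have [ir|ri] := ltnP i r.
    rewrite big1 ?addr0 ?andbT // => l _; case: eqP => [li|]; last by rewrite mul0r.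
    by move: ir; rewrite -li ltnNge leq_addl.
  have lt : (i - r < n)%N by apply: leq_ltn_trans (leq_subr _ _) (ltn_ord i).
  rewrite andbF add0r (bigD1 (Ordinal lt)) //= subnK // eqxx mul1r.
  rewrite big1 ?addr0 // => l ne; case: eqP => [li|]; last by rewrite mul0r.
  by case/eqP: ne; apply: val_inj; rewrite /= -li addnK.
apply: leq_trans (mxrank_add _ _) _; rewrite leq_add ?mxrankM_maxr //.
by rewrite -pid_mx_minv rank_pid_mx ?geq_minl ?geq_minr.
Qed.

End JordanForm.

Section Partitions.
Variable k : finFieldType.

Lemma ndim_Spart l : ndim (Spart k l) = sumn l.
Proof. by elim: l => //= n l ->. Qed.

Lemma rank_Spart_exp l r : \rank (nmx (Spart k l) ^+ r) = (\sum_(n <- l) (n - r))%N.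
Proof.
elim: l => [|n l IH]; first by rewrite rank_jordan_exp big_nil sub0n.
by rewrite /= dsum_mx_exp rank_diag_block_mx rank_jordan_exp big_cons IH.
Qed.

Lemma corank_Spart l : is_part l ->
  (ndim (Spart k l) - \rank (nmx (Spart k l)) = size l)%N.
Proof.
case/andP=> _ pos.
have := rank_Spart_exp l 1; rewrite expr1 => ->; rewrite {1}ndim_Spart.
suff : (size l + \sum_(n <- l) (n - 1) = sumn l)%N by lia.
elim: l pos => [|n l IH] /=; first by rewrite big_nil.
by case/andP=> n0 /IH <-; rewrite big_cons; lia.
Qed.

Lemma sim_exp d1 d2 (X : 'M[k]_d1) (X' : 'M[k]_d2) r :
  sim X 0 X' 0 -> sim (X ^+ r) 0 (X' ^+ r) 0.
Proof.
case/simP=> f [g [fg gf Xf _]]; apply/simP; exists f, g; rewrite mulmx0 mul0mx.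
split=> //; elim: r => [|r IH]; first by rewrite !expr0 mul1mx mulmx1.
by rewrite exprSr -mulmxE -mulmxA Xf mulmxA IH -mulmxA exprSr mulmxE.
Qed.

Lemma sim_rank d1 d2 (X : 'M[k]_d1) (X' : 'M[k]_d2) : sim X 0 X' 0 -> \rank X = \rank X'.
Proof.
move=> s; have d12 := sim_dim s; subst d2; case/simP: s => f [g [fg gf Xf _]].
have fu : f \in unitmx by case: (mulmx1_unit fg).
have : \rank (X *m f) = \rank (f *m X') by rewrite Xf.
by rewrite mxrankMfree ?row_free_unit // eqmxMfull ?row_full_unit.
Qed.

Lemma is_part_inj (l m : seq nat) : is_part l -> is_part m ->
  (forall r, \sum_(n <- l) (n - r) = \sum_(n <- m) (n - r))%N -> l = m.
Proof.
move=> /andP[sl pl] /andP[sm pm] E.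
have tr : transitive geq by move=> a b c /= ba cb; exact: leq_trans cb ba.
have as_ : antisymmetric geq by move=> a b /= ; rewrite andbC; exact: anti_leq.
have cgt s r : (count (leq r.+1) s + \sum_(n <- s) (n - r.+1) = \sum_(n <- s) (n - r))%N.
  elim: s => [|n s IH]; first by rewrite !big_nil.
  rewrite !big_cons /= -IH; lia.
have ceq s r : (count_mem r s + count (leq r.+1) s = count (leq r) s)%N.
  elim: s => //= n s <-; lia.
apply: (sorted_eq tr as_) => //; apply/allP => x _ /=; apply/eqP.
have gt r : count (leq r.+1) l = count (leq r.+1) m.
  by have := cgt l r; have := cgt m r; rewrite !E; lia.
have cl (s : seq nat) : count_mem x s = (count (leq x) s - count (leq x.+1) s)%N.
  by rewrite -ceq addnK.
case: x cl => [|x] cl; last by rewrite !cl !gt.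
have c0 s : all (leq 1) s -> count_mem 0%N s = 0%N.
  by move=> ps; apply/count_memPn; apply/negP => /(allP ps).
by rewrite !c0.
Qed.

Lemma Spart_inj l m : is_part l -> is_part m ->
  sim (nmx (Spart k l)) 0 (nmx (Spart k m)) 0 -> l = m.
Proof.
move=> pl pm s; apply: is_part_inj => // r.
by rewrite -!rank_Spart_exp; apply: sim_rank; exact: sim_exp.
Qed.

End Partitions.

(** * Homology of a square-zero matrix *)

Section Homology.
Variable k : finFieldType.

(* V and Q identify ker D / Im D with a coordinate space on which x acts by
   V X Q: the rows of V are cycles, Q kills boundaries, and the last equation
   says that there are enough of them. *)
Definition hdata d (X D : 'M[k]_d) h (V : 'M[k]_(h, d)) (Q : 'M[k]_(d, h)) : Prop :=
  [/\ V *m D = 0, D *m Q = 0, V *m Q = 1%:M & (h + (\rank D).*2)%N = d].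

Lemma homology_hdata (M : cplx k) :
  exists V Q, @hdata _ (nmx M) (cdiff M) (ndim (homology M)) V Q
    /\ nmx (homology M) = V *m nmx M *m Q.
Proof.
exists (pinvmx (hproj M) *m cycles M), (pinvmx (cycles M) *m hproj M).
have cfr := cycles_free M; have hfl := hproj_full M.
split; last by rewrite /= /homology_mx /cycles_mx !mulmxA.
split.
- suff E : cycles M *m cdiff M = 0 by rewrite -mulmxA E mulmx0.
  by apply/sub_kermxP; rewrite eq_row_base.
- by rewrite mulmxA; apply/sub_kermxP; case/andP: (kermx_hproj M).
- rewrite mulmxA -(mulmxA _ (cycles M)) mulmxVp // mulmx1.
  exact: mulVpmx.
rewrite /= mxrank_coker.
have rb : \rank (bdry M) = \rank (cdiff M).
  by rewrite -[in RHS](bdryK M) mxrankMfree.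
rewrite rb mxrank_ker; have := rank_leq_row (cdiff M).
have : (\rank (cdiff M) <= \rank (kermx (cdiff M)))%N.
  by apply: mxrankS; apply/sub_kermxP; exact: cdiff_sq.
rewrite mxrank_ker; lia.
Qed.

Lemma hdata_homology (M : cplx k) h (V : 'M[k]_(h, ndim M)) (Q : 'M[k]_(ndim M, h)) :
  hdata (nmx M) (cdiff M) V Q -> sim (nmx (homology M)) 0 (V *m nmx M *m Q) 0.
Proof.
have cfr := cycles_free M; have hfl := hproj_full M.
set C := cycles M in cfr *; set X := nmx M; set D := cdiff M => -[VD DQ VQ dE].
have CD : C *m D = 0 by apply/sub_kermxP; rewrite eq_row_base.
have VC : V *m pinvmx C *m C = V.
  by apply: mulmxKpV; rewrite eq_row_base; apply/sub_kermxP.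
pose p := C *m Q.
have Vp : V *m pinvmx C *m p = 1%:M by rewrite /p mulmxA VC.
have pfl : row_full p by apply/row_fullP; exists (V *m pinvmx C).
have bp : bdry M *m p = 0 by rewrite /p mulmxA bdryK.
have rb : \rank (bdry M) = \rank D by rewrite /D -[in RHS](bdryK M) mxrankMfree.
have kE : (kermx p :=: bdry M)%MS.
  apply/eqmx_sym/eqmxP; rewrite -(geq_leqif (mxrank_leqif_eq _)); last exact/sub_kermxP.
  by rewrite rb mxrank_ker (eqP pfl) mxrank_ker -/D; lia.
have khE : (kermx (hproj M) :=: bdry M)%MS by exact/eqmxP/kermx_hproj.
have pE : p = hproj M *m (pinvmx (hproj M) *m p).
  apply/eqP; rewrite -subr_eq0 mulmxA -{1}[p]mul1mx -mulmxBl.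
  apply/eqP/sub_kermxP; rewrite kE -khE; apply/sub_kermxP.
  by rewrite mulmxBl mul1mx -mulmxA mulVpmx ?mulmx1 ?subrr.
set g := pinvmx (hproj M) *m p in pE; clearbody g.
have hd : \rank (cokermx (bdry M)) = h.
  by rewrite mxrank_coker rb mxrank_ker -/D; lia.
apply: (@sim_unit _ _ _ _ _ g) => //.
  have hg : (h <= \rank g)%N.
    by rewrite -{1}(eqP pfl); have := mxrankM_maxr (hproj M) g; rewrite -pE.
  by rewrite /row_free eqn_leq rank_leq_row; apply: leq_trans hg; rewrite hd.
apply: (row_full_inj hfl).
rewrite -[nmx (homology M)]/(homology_mx M) (mulmxA (hproj M) (homology_mx M)).
rewrite homology_mxK -(mulmxA _ (hproj M)) -pE (mulmxA (hproj M) g) -pE.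
have zC : cycles_mx M *m C = C *m X := cycles_mxK M.
have bC : bdry M *m C = D := bdryK M.
have CK : (C :=: kermx D)%MS by exact: eq_row_base.
clearbody C; rewrite /p !mulmxA zC.
suff : (C - C *m Q *m V) *m X *m Q = 0 by rewrite !mulmxBl => /eqP; rewrite subr_eq0 => /eqP.
have : (C - C *m Q *m V) *m D = 0 by rewrite mulmxBl CD -(mulmxA _ V) VD mulmx0 subrr.
move/sub_kermxP; rewrite -CK => /submxP[W WE].
have : W *m p = 0 by rewrite /p mulmxA -WE mulmxBl -(mulmxA _ V) VQ mulmx1 subrr.
move/sub_kermxP; rewrite kE => /submxP[W' W'E].
have XD : X *m D = D *m X by exact/eqP/(cdiff_hom M).
by rewrite WE W'E -(mulmxA W') bC -(mulmxA _ D) -XD -!mulmxA DQ !mulmx0.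
Qed.

Lemma rank_tr_hdata d (X D : 'M[k]_d) h (V : 'M[k]_(h, d)) (Q : 'M[k]_(d, h)) :
  hdata X D V Q -> hdata X^T D^T Q^T V^T.
Proof.
by case=> VD DQ VQ dE; split; rewrite -?trmx_mul ?VD ?DQ ?VQ ?trmx0 ?trmx1 // mxrank_tr.
Qed.

End Homology.

(** * Ring axioms in the iHall algebra *)

Section IHallRing.
Variables (k : finFieldType) (F : fieldType).
Hypothesis char0 : [pchar F] =i pred0.
Local Notation q := (#|k|%:R : F).
Local Notation A := (iHall k F).

Definition icl d (X D : 'M[k]_d) : A := \pi_(iHall k F) (hcl F X D).

Lemma icl_cplx (M : cplx k) : icl (nmx M) (cdiff M) = icls F M.
Proof. by rewrite /icl hcl_cplx. Qed.

Lemma icl_sim d1 d2 (X D : 'M[k]_d1) (X' D' : 'M[k]_d2) :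
  sim X D X' D' -> icl X D = icl X' D'.
Proof. by move=> s; rewrite /icl (hcl_sim _ s). Qed.

Lemma icl_eq0 d (X D : 'M[k]_d) : ~ cplxP X D -> icl X D = 0.
Proof. by move=> s; rewrite /icl (hcl_eq0 _ s) raddf0. Qed.

Lemma icls_homology (M N : cplx k) :
  sim (nmx (homology M)) 0 (nmx (homology N)) 0 -> \rank (cdiff M) = \rank (cdiff N) ->
  icls F M = icls F N.
Proof.
move=> s r; apply/iHall_eqP/asboolP/Hideal_gen => //.
by case/existsP: s => f /and4P[sf _ fr fl]; exists f; rewrite /nrep_hom sf fr fl.
Qed.

Lemma icl_hdata d d' (X D : 'M[k]_d) (X' D' : 'M[k]_d') h h'
    (V : 'M[k]_(h, d)) (Q : 'M[k]_(d, h)) (V' : 'M[k]_(h', d')) (Q' : 'M[k]_(d', h')) :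
  cplxP X D -> cplxP X' D' -> hdata X D V Q -> hdata X' D' V' Q' ->
  \rank D = \rank D' -> sim (V *m X *m Q) 0 (V' *m X' *m Q') 0 ->
  icl X D = icl X' D'.
Proof.
case=> x1 x2 x3 [y1 y2 y3] hx hy r s.
pose M := Cplx (cobj := Nrep x1) x2 x3; pose N := Cplx (cobj := Nrep y1) y2 y3.
rewrite (icl_cplx M : icl X D = _) (icl_cplx N : icl X' D' = _); apply: icls_homology; last exact: r.
have sM := @hdata_homology k M h V Q hx; have sN := @hdata_homology k N h' V' Q' hy.
exact: sim_trans (sim_trans sM s) (sim_sym sN).
Qed.

Lemma cplxP_hdata d (X D : 'M[k]_d) : cplxP X D ->
  exists h (V : 'M[k]_(h, d)) (Q : 'M[k]_(d, h)), hdata X D V Q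
   /\ exists r, (V *m X *m Q) ^+ r = 0.
Proof.
case=> x1 x2 x3; pose M := Cplx (cobj := Nrep x1) x2 x3.
have [V [Q [hVQ E]]] := homology_hdata M.
by exists (ndim (homology M)), V, Q; split=> //; rewrite -E; exact: homology_nil.
Qed.

Lemma cplxP_tr d (X D : 'M[k]_d) : cplxP X D -> cplxP X^T D^T.
Proof.
case=> -[r Xr] /eqP XD DD; split.
- exists r; have trX s : X^T ^+ s = (X ^+ s)^T.
    elim: s => [|s IH]; first by rewrite !expr0 trmx1.
    by rewrite exprS IH exprSr -!mulmxE trmx_mul.
  by rewrite trX Xr trmx0.
- by rewrite -!trmx_mul XD.
- by rewrite -trmx_mul DD trmx0.
Qed.

Lemma icl_tr d (X D : 'M[k]_d) : icl X D = icl X^T D^T.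
Proof.
have [h|nh] := pselect (cplxP X D); last first.
  by rewrite !icl_eq0 // => /cplxP_tr; rewrite !trmxK.
have [h' [V [Q [hVQ n]]]] := cplxP_hdata h.
apply: (icl_hdata h (cplxP_tr h) hVQ (rank_tr_hdata hVQ)); rewrite ?mxrank_tr //.
by rewrite -!trmx_mul mulmxA; exact: nil_tr.
Qed.

Lemma pi_ilin (a : F) (x y : hall k F) :
  \pi_(iHall k F) (a *: x + y) = a *: \pi_(iHall k F) x + \pi_(iHall k F) y.
Proof. by rewrite -[X in _ = X + _]pi_iscale; exact: raddfD. Qed.

Lemma imul_linl (a : F) (x y z : A) : imul (a *: x + y) z = a *: imul x z + imul y z.
Proof.
rewrite -[x]reprK -[y]reprK -[z]reprK -pi_ilin -!pi_imul hmul_linl.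
exact: pi_ilin.
Qed.

Lemma imul_linr (a : F) (x y z : A) : imul x (a *: y + z) = a *: imul x y + imul x z.
Proof.
rewrite -[x]reprK -[y]reprK -[z]reprK -pi_ilin -!pi_imul hmul_linr.
exact: pi_ilin.
Qed.

Lemma imul0r (x : A) : imul 0 x = 0.
Proof.
by have := imul_linl 1 0 0 x; rewrite scaler0 addr0 scale1r => /eqP; rewrite -subr_eq0 opprD addNKr oppr_eq0 => /eqP.
Qed.

Lemma imulr0 (x : A) : imul x 0 = 0.
Proof.
by have := imul_linr 1 x 0 0; rewrite scaler0 addr0 scale1r => /eqP; rewrite -subr_eq0 opprD addNKr oppr_eq0 => /eqP.
Qed.

Lemma imulDl : left_distributive (@imul k F) +%R.
Proof. by move=> x y z; rewrite -[x]scale1r imul_linl !scale1r. Qed.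

Lemma imulDr : right_distributive (@imul k F) +%R.
Proof. by move=> x y z; rewrite -[y]scale1r imul_linr !scale1r. Qed.

Lemma iscale_imull (a : F) (x y : A) : imul (a *: x) y = a *: imul x y.
Proof. by rewrite -[a *: x]addr0 imul_linl imul0r addr0. Qed.

Lemma iscale_imulr (a : F) (x y : A) : imul x (a *: y) = a *: imul x y.
Proof. by rewrite -[a *: y]addr0 imul_linr imulr0 addr0. Qed.

Lemma imul_suml I (r : seq I) (P : pred I) (f : I -> A) y :
  imul (\sum_(i <- r | P i) f i) y = \sum_(i <- r | P i) imul (f i) y.
Proof. exact: (big_morph (fun x => imul x y) (fun u v => imulDl u v y) (imul0r y)). Qed.

Lemma imul_sumr I (r : seq I) (P : pred I) (f : I -> A) y :
  imul y (\sum_(i <- r | P i) f i) = \sum_(i <- r | P i) imul y (f i).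
Proof. exact: (big_morph (imul y) (imulDr y) (imulr0 y)). Qed.

Lemma imul_icl m n (X D : 'M[k]_m) (X' D' : 'M[k]_n) :
  imul (icl X D) (icl X' D') = q ^- (m * n) *:
    \sum_(YC : 'M[k]_(m, n) * 'M[k]_(m, n)) icl (lblock X' YC.1 X) (lblock D' YC.2 D).
Proof. by rewrite -pi_imul hmul_hcl // pi_iscale raddf_sum. Qed.

Lemma iHall_ind (P : A -> Prop) : P 0 ->
  (forall a d (X D : 'M[k]_d) y, P y -> P (a *: icl X D + y)) -> forall x, P x.
Proof.
move=> P0 PD x; rewrite -[x]reprK [repr x]monalgE.
elim: (enum_fset (msupp (repr x))) => [|L s IH]; first by rewrite big_nil raddf0.
rewrite big_cons.
have -> : << (repr x)@_L *g L >> = (repr x)@_L *: (<< L >> : hall k F).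
  by apply/malgP => L'; rewrite mcoeffZ !mcoeffU mulrnAr mulr1.
rewrite pi_ilin -[L]reprK -[X in _ *: X + _]/(icls F (repr L)) -icl_cplx.
exact: PD.
Qed.

Lemma ilin_congr (a : F) (u v w : A) : u = v -> a *: u + w = a *: v + w.
Proof. by move->. Qed.

Lemma imulA : associative (@imul k F).
Proof.
move=> x y z; elim/iHall_ind: x => [|a1 m1 X1 D1 x IHx]; first by rewrite !imul0r.
rewrite (imul_linl a1 _ x (imul y z)) (imul_linl a1 _ x y) (imul_linl a1 _ (imul x y)) -IHx.
apply: ilin_congr => {x IHx}.
elim/iHall_ind: y => [|a2 m2 X2 D2 y IHy]; first by rewrite imul0r !imulr0 imul0r.
rewrite (imul_linl a2 _ y z) (imul_linr a2 _ _ (imul y z)) (imul_linr a2 _ _ y).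
rewrite (imul_linl a2 _ _ z) -IHy; apply: ilin_congr => {y IHy}.
elim/iHall_ind: z => [|a3 m3 X3 D3 z IHz]; first by rewrite !imulr0.
rewrite (imul_linr a3 (icl X2 D2) _ z) (imul_linr a3 (icl X1 D1)).
rewrite (imul_linr a3 (imul _ _) _ z) -IHz; apply: ilin_congr => {z IHz}.
rewrite !imul_icl iscale_imull iscale_imulr imul_suml imul_sumr.
under eq_bigr => YC _ do rewrite imul_icl.
under [in RHS]eq_bigr => YC _ do rewrite imul_icl.
rewrite -!scaler_sumr !scalerA -!invfM -!exprD.
congr (_^-1 *: _); first by congr (_ ^+ _); lia.
rewrite !pair_big /=.
rewrite (reindex (fun t : ('M[k]_(m1, m2) * 'M[k]_(m1, m2)) * ('M[k]_(m2 + m1, m3) * 'M[k]_(m2 + m1, m3)) =>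
  ((usubmx t.2.1, usubmx t.2.2),
   (row_mx (dsubmx t.2.1) t.1.1 : 'M_(m1, m3 + m2), row_mx (dsubmx t.2.2) t.1.2 : 'M_(m1, m3 + m2))))) /=; last first.
  exists (fun t : ('M[k]_(m2, m3) * 'M[k]_(m2, m3)) * ('M[k]_(m1, m3 + m2) * 'M[k]_(m1, m3 + m2)) =>
  ((rsubmx t.2.1, rsubmx t.2.2), (col_mx t.1.1 (lsubmx t.2.1), col_mx t.1.2 (lsubmx t.2.2)))).
    by case=> [[Y C] [Y' C']] _ /=; rewrite !row_mxKr !row_mxKl !vsubmxK.
  by case=> [[Y C] [Y' C']] _ /=; rewrite !col_mxKu !col_mxKd !hsubmxK.
apply: eq_bigr => -[[Y C] [Y' C']] _ /=.
rewrite -[in RHS](vsubmxK Y') -[in RHS](vsubmxK C').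
set Y1 := usubmx Y'; set Y2 := dsubmx Y'; set C1 := usubmx C'; set C2 := dsubmx C'.
rewrite /lblock.
have castE e (U W : 'M[k]_(m3 + m2 + m1)) :
    icl (castmx (e, e) U) (castmx (e, e) W : 'M_(m3 + (m2 + m1))) = icl U W.
  by move: U W; rewrite /castmx /=; case: _ / e.
rewrite -[0 : 'M_(m3, m2 + m1)](row_mx0 _ m3 m2 m1).
rewrite (block_mxA (A22 := X2)) (block_mxA (A22 := D2)) castE.
by rewrite col_mx0.
Qed.

Lemma imulC : commutative (@imul k F).
Proof.
move=> x y; elim/iHall_ind: x => [|a m X D x IHx]; first by rewrite imul0r imulr0.
rewrite imul_linl imul_linr -IHx; apply: ilin_congr => {x IHx}.
elim/iHall_ind: y => [|b n X' D' y IHy]; first by rewrite imul0r imulr0.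
rewrite imul_linl imul_linr -IHy; apply: ilin_congr => {y IHy}.
rewrite [in LHS](icl_tr X') [in LHS](icl_tr X) !imul_icl mulnC; congr (_ *: _).
rewrite (reindex (fun YC : 'M[k]_(n, m) * 'M[k]_(n, m) => (YC.1^T, YC.2^T))) /=; last first.
  exists (fun YC => (YC.1^T, YC.2^T)) => -[Y C] _ /=; by rewrite !trmxK.
apply: eq_bigr => -[Y C] _ /=; rewrite icl_tr /lblock !tr_block_mx !trmx0 !trmxK.
apply: icl_sim; apply/simP.
exists (block_mx 0 1%:M 1%:M 0 : 'M_(n + m, m + n)), (block_mx 0 1%:M 1%:M 0 : 'M_(m + n, n + m)).
by rewrite !mulmx_block !(mulmx0, mul0mx, mulmx1, mul1mx, addr0, add0r) -!scalar_mx_block.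
Qed.

Lemma ione_icl : ione = icl (0 : 'M_0) 0.
Proof.
rewrite /ione -icl_cplx; apply: icl_sim; rewrite [nmx _]thinmx0.
exact: sim_refl.
Qed.

Lemma imul1r : left_id (@ione k F) (@imul k F).
Proof.
move=> y; elim/iHall_ind: y => [|b n X' D' y IHy]; first by rewrite imulr0.
rewrite imul_linr IHy; apply: ilin_congr => {y IHy}.
rewrite ione_icl imul_icl mul0n expr0 invr1 scale1r.
rewrite (bigD1 (0, 0)) //= big1 ?addr0 => [|[Y C] ne].
  apply: icl_sim; apply/simP; exists (col_mx 1%:M 0), (row_mx 1%:M 0).
  rewrite /lblock !mul_block_col !mul_col_row !mul_row_col !mul_col_mx.
  rewrite !(mulmx0, mul0mx, mulmx1, mul1mx, addr0, add0r).
  by split=> //; rewrite (scalar_mx_block n 0) (thinmx0 (1%:M : 'M[k]_0)).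
by case/eqP: ne; rewrite [Y]flatmx0 [C]flatmx0.
Qed.

End IHallRing.

(** * Counting matrices and generating tuples *)

Section BlockSums.
Variables (K : finType) (R : Type) (idx : R) (op : Monoid.com_law idx).

Lemma big_row_mx m n1 n2 (f : 'M[K]_(m, n1 + n2) -> R) :
  \big[op/idx]_X f X
  = \big[op/idx]_(A : 'M[K]_(m, n1)) \big[op/idx]_(B : 'M[K]_(m, n2)) f (row_mx A B).
Proof.
rewrite pair_bigA /= (reindex (fun t : 'M[K]_(m, n1) * 'M[K]_(m, n2) => row_mx t.1 t.2)) //=.
exists (fun X => (lsubmx X, rsubmx X)) => [[A B]|X] _ /=; last exact: hsubmxK.
by rewrite row_mxKl row_mxKr.
Qed.

Lemma big_col_mx m1 m2 n (f : 'M[K]_(m1 + m2, n) -> R) :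
  \big[op/idx]_X f X
  = \big[op/idx]_(A : 'M[K]_(m1, n)) \big[op/idx]_(B : 'M[K]_(m2, n)) f (col_mx A B).
Proof.
rewrite pair_bigA /= (reindex (fun t : 'M[K]_(m1, n) * 'M[K]_(m2, n) => col_mx t.1 t.2)) //=.
exists (fun X => (usubmx X, dsubmx X)) => [[A B]|X] _ /=; last exact: vsubmxK.
by rewrite col_mxKu col_mxKd.
Qed.

Lemma big_block_mx m1 m2 n1 n2 (f : 'M[K]_(m1 + m2, n1 + n2) -> R) :
  \big[op/idx]_X f X
  = \big[op/idx]_(A : 'M[K]_(m1, n1)) \big[op/idx]_(B : 'M[K]_(m1, n2))
    \big[op/idx]_(C : 'M[K]_(m2, n1)) \big[op/idx]_(D : 'M[K]_(m2, n2)) f (block_mx A B C D).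
Proof.
rewrite big_col_mx big_row_mx; apply: eq_bigr => A _; apply: eq_bigr => B _.
exact: big_row_mx.
Qed.

End BlockSums.

Section MatrixCounting.
Variable k : finFieldType.
Local Notation q := #|k|.

Definition gl n := #|[set g : 'M[k]_n | g \in unitmx]|.

Lemma gl_gt0 n : (0 < gl n)%N.
Proof. by apply/card_gt0P; exists 1%:M; rewrite inE unitmx1. Qed.

Lemma unitmx_lblock n m (B : 'M[k]_n) (Y : 'M[k]_(m, n)) (A : 'M[k]_m) :
  (block_mx B 0 Y A \in unitmx) = (B \in unitmx) && (A \in unitmx).
Proof. by rewrite !unitmxE det_lblock unitrM. Qed.

Definition rankset a b m := [set C : 'M[k]_(a, b) | \rank C == m].

Definition std a m b : 'M[k]_(a + m, m + b) := block_mx 0 0 1%:M 0.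

Lemma rank_std a m b : \rank (std a m b) = m.
Proof.
rewrite /std block_mxEv row_mx0 -addsmxE adds0mx; apply/eqP.
by apply/row_freeP; exists (col_mx 1%:M 0); rewrite mul_row_col mul0mx mulmx1 addr0.
Qed.

Lemma rank_eq_equiv m n (C S : 'M[k]_(m, n)) : \rank C = \rank S ->
  exists g h, [/\ g \in unitmx, h \in unitmx & C = g *m S *m h].
Proof.
move=> rCS; exists (col_ebase C *m invmx (col_ebase S)), (invmx (row_ebase S) *m row_ebase C).
rewrite !unitmx_mul !unitmx_inv !col_ebase_unit !row_ebase_unit; split=> //.
have [cu ru SE] := And3 (col_ebase_unit S) (row_ebase_unit S) (mulmx_ebase S).
move: (col_ebase S) (row_ebase S) cu ru SE => c r cu ru SE.
by rewrite -[in RHS]SE -{1}(mulmx_ebase C) rCS !mulmxA mulmxKV ?mulmxK.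
Qed.

Lemma sum_bool_card (T : finType) (P : pred T) : (\sum_(x : T) P x = #|[set x | P x]|)%N.
Proof.
by rewrite -sum1_card [RHS]big_mkcond /=; apply: eq_bigr => x _; rewrite inE; case: (P x).
Qed.

Lemma card_std_stab a m b :
  #|[set gh : 'M[k]_(a + m) * 'M[k]_(m + b) | [&& gh.1 \in unitmx, gh.2 \in unitmx &
      gh.1 *m std a m b == std a m b *m gh.2]]|
  = (gl m * gl a * gl b * q ^ (m * a + m * b))%N.
Proof.
pose T := (('M[k]_m * 'M[k]_a) * ('M[k]_b * ('M[k]_(m, a) * 'M[k]_(b, m))))%type.
pose f (t : T) : 'M[k]_(a + m) * 'M[k]_(m + b) :=
  let: ((x, g1), (h1, (g2, h2))) := t in (block_mx g1 0 g2 x, block_mx x 0 h2 h1).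
have f_inj : injective f.
  case=> [[x g1] [h1 [g2 h2]]] [[x' g1'] [h1' [g2' h2']]] [] /eq_block_mx[-> _ -> ->].
  by case/eq_block_mx=> _ _ -> ->.
pose D := setX (setX [set x : 'M[k]_m | x \in unitmx] [set x : 'M[k]_a | x \in unitmx])
  (setX [set x : 'M[k]_b | x \in unitmx] [set: 'M[k]_(m, a) * 'M[k]_(b, m)]).
transitivity #|f @: D|; last first.
  rewrite card_imset // !cardsX -/(gl m) -/(gl a) -/(gl b) cardsT card_prod !card_mx.
  by rewrite -expnD (mulnC b) mulnA.
apply: eq_card => -[g h]; rewrite inE /=; apply/and3P/imsetP; last first.
  case=> -[[x g1] [h1 [g2 h2]]]; rewrite !inE /= => /andP[/andP[xu gu] /andP[hu _]] [-> ->].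
  rewrite !unitmx_lblock xu gu hu /std !mulmx_block.
  by rewrite !(mulmx0, mul0mx, mulmx1, mul1mx, addr0, add0r) eqxx.
rewrite -[g]submxK -[h]submxK /std !mulmx_block.
rewrite !(mulmx0, mul0mx, mulmx1, mul1mx, addr0, add0r) => -[gu hu /eqP/eq_block_mx[g0 _ gh h0]].
move: gu hu; rewrite g0 -h0 !unitmx_lblock => /andP[g1u g2u] /andP[h1u h2u].
exists ((drsubmx g, ulsubmx g), (drsubmx h, (dlsubmx g, dlsubmx h))).
  by rewrite !inE /= g1u g2u h2u.
by rewrite /f /= -gh.
Qed.

Lemma card_rankset a m b :
  (#|rankset (a + m) (m + b) m| * (gl m * gl a * gl b * q ^ (m * a + m * b))
   = gl (a + m) * gl (m + b))%N.
Proof.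
rewrite -card_std_stab /gl -[in RHS]cardsX.
pose f (gh : 'M[k]_(a + m) * 'M[k]_(m + b)) := gh.1 *m std a m b *m gh.2.
set D := setX _ _; rewrite -[in RHS]sum1_card (partition_big f (mem (rankset (a + m) (m + b) m))) /=.
  rewrite -sum_nat_const; apply: eq_bigr => C; rewrite inE => /eqP rC.
  have [g0 [h0 [g0u h0u CE]]] := rank_eq_equiv (etrans rC (esym (rank_std a m b))).
  rewrite sum1_card -[LHS](card_imset (f := fun gh : 'M[k]_(a + m) * 'M[k]_(m + b) =>
     (g0 *m gh.1, invmx gh.2 *m h0))).
    apply: eq_card => -[g h]; apply/imsetP/idP.
      case=> -[x y]; rewrite !inE /= => /and3P[xu yu /eqP xy] [-> ->].
      suff : ((g0 *m x, invmx y *m h0) \in D) && (f (g0 *m x, invmx y *m h0) == C) by [].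
      rewrite !inE /= !unitmx_mul g0u xu unitmx_inv yu h0u /f /= -(mulmxA g0) xy.
      by rewrite !mulmxA mulmxK // CE eqxx.
    move=> ghP; have : ((g, h) \in D) && (f (g, h) == C) := ghP.
    rewrite !inE /= => /andP[/andP[gu hu] /eqP ghE].
    exists (invmx g0 *m g, h0 *m invmx h).
      rewrite inE /= !unitmx_mul !unitmx_inv g0u gu h0u hu /=.
      rewrite -(inj_eq (can_inj (mulKmx g0u))) -(inj_eq (can_inj (mulmxK hu))).
      by rewrite !mulmxA mulmxV // mul1mx mulmxKV // -CE; apply/eqP.
    have hh : h0 *m invmx h \in unitmx by rewrite unitmx_mul h0u unitmx_inv.
    rewrite /= mulKVmx //; congr (_, _); apply: (can_inj (mulKmx hh)).
    by rewrite mulKVmx // mulmxKV.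
  move=> [x y] [x' y'] [] /(can_inj (mulKmx g0u)) -> /(can_inj (mulmxK h0u)) E.
  by rewrite -[y]invmxK E invmxK.
case=> g h; rewrite !inE /= => /andP[gu hu]; rewrite /f /=.
by rewrite mxrankMfree ?row_free_unit // eqmxMfull ?row_full_unit // rank_std.
Qed.

(* For X nilpotent, by Nakayama's lemma, the number of n-tuples generating the
   k[x]-module given by X. *)
Definition ngen n d (X : 'M[k]_d) := #|[set U : 'M[k]_(n, d) | row_full (col_mx U X)]|.

Lemma row_full_colP m n (A : 'M[k]_(m, n)) :
  reflect (forall w : 'cV_n, A *m w = 0 -> w = 0) (row_full A).
Proof.
rewrite /row_full -mxrank_tr -/(row_free A^T); apply: (iffP idP) => [fr w Aw|inj].
  apply: trmx_inj; apply: (row_free_inj fr) => /=.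
  by rewrite -trmx_mul Aw !trmx0 mul0mx.
apply: inj_row_free => v vA; apply: trmx_inj; rewrite trmx0; apply: inj.
by rewrite -[A]trmxK -trmx_mul vA trmx0.
Qed.

Lemma row_full_lblock n m b (U1 : 'M[k]_(n, m)) (U2 : 'M[k]_(n, b)) (I : 'M[k]_m)
    (Z : 'M[k]_(b, m)) (B : 'M[k]_b) (Q : 'M[k]_(\rank (kermx (col_mx U2 B)), n + b)) :
    row_full (col_mx U2 B) -> (Q :=: kermx (col_mx U2 B))%MS ->
  row_full (col_mx (row_mx U1 U2) (block_mx I 0 Z B))
  = row_full (col_mx (Q *m col_mx U1 Z) I).
Proof.
move=> fP QE; have /row_fullP[L LP] := fP.
have QP : Q *m col_mx U2 B = 0 by apply/sub_kermxP; rewrite QE.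
have mulE (w1 : 'cV_m) (w2 : 'cV_b) :
    (col_mx (row_mx U1 U2) (block_mx I 0 Z B) *m col_mx w1 w2 = 0) <->
    (I *m w1 = 0 /\ col_mx U1 Z *m w1 + col_mx U2 B *m w2 = 0).
  rewrite mul_col_mx mul_row_col mul_block_col mul0mx addr0 !mul_col_mx add_col_mx.
  split=> [/eqP|[-> /eqP]].
    by rewrite !col_mx_eq0 => /and3P[/eqP -> /eqP -> /eqP ->]; rewrite col_mx0.
  by rewrite col_mx_eq0 => /andP[/eqP -> /eqP ->]; rewrite !col_mx0.
apply/row_full_colP/row_full_colP => inj w.
  rewrite mul_col_mx => /eqP; rewrite col_mx_eq0 => /andP[/eqP Qw /eqP Iw].
  suff : col_mx w (- (L *m (col_mx U1 Z *m w))) = 0.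
    by move/eqP; rewrite col_mx_eq0 => /andP[/eqP].
  apply: inj; apply/mulE; split=> //; rewrite mulmxN mulmxA.
  have : ((1%:M - col_mx U2 B *m L) *m col_mx U2 B)%R = 0.
    by rewrite mulmxBl mul1mx -mulmxA LP mulmx1 subrr.
  move/sub_kermxP; rewrite -QE => /submxP[D DE].
  rewrite -{1}[col_mx U1 Z *m w]mul1mx -mulmxBl DE -mulmxA (mulmxA Q) Qw mulmx0 //.
rewrite -[w]vsubmxK => /mulE[Iw Rw].
have w10 : usubmx w = 0.
  apply: inj; rewrite mul_col_mx Iw.
  have := congr1 (mulmx Q) Rw; rewrite /= mulmxDr mulmx0 mulmxA (mulmxA Q (col_mx U2 B)) QP.
  by rewrite mul0mx addr0 => ->; rewrite col_mx0.
move: Rw; rewrite w10 mulmx0 add0r => Pw.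
have -> : dsubmx w = 0 by rewrite -[dsubmx w]mul1mx -LP -mulmxA Pw mulmx0.
exact: col_mx0.
Qed.

Lemma sum_ngen_lblock n m b (I : 'M[k]_m) (B : 'M[k]_b) :
  (\sum_(Z : 'M[k]_(b, m)) ngen n (block_mx I 0 Z B : 'M_(m + b))
   = q ^ (m * b) * (ngen n I * ngen n B))%N.
Proof.
have ngenE d (X : 'M[k]_d) e : ngen e X = (\sum_(U : 'M[k]_(e, d)) row_full (col_mx U X))%N.
  by rewrite sum_bool_card.
under eq_bigr => Z _ do rewrite ngenE big_row_mx.
rewrite exchange_big /=.
under eq_bigr => U1 _ do rewrite exchange_big /=.
rewrite exchange_big /= mulnA mulnC ngenE big_distrl /=; apply: eq_bigr => U2 _.
have [fP|nP] := boolP (row_full (col_mx U2 B)); last first.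
  rewrite mul0n big1 // => U1 _; rewrite big1 // => Z _.
  apply/eqP; rewrite eqb0; apply: contra nP => /row_full_colP inj.
  apply/row_full_colP => w; rewrite mul_col_mx => /eqP; rewrite col_mx_eq0 => /andP[/eqP Uw /eqP Bw].
  suff : col_mx (0 : 'cV_m) w = 0 by move/eqP; rewrite col_mx_eq0 => /andP[_ /eqP].
  apply: inj; rewrite mul_col_mx mul_row_col mul_block_col !mulmx0 mul0mx !add0r Uw Bw.
  by rewrite !col_mx0.
rewrite mul1n; set P := col_mx U2 B in fP *; have /row_fullP[L LP] := fP.
pose Q := row_base (kermx P).
have Qfr : row_free Q by exact: row_base_free.
have QE : (Q :=: kermx P)%MS by exact: eq_row_base.
under eq_bigr => U1 _ do under eq_bigr => Z _ do rewrite (row_full_lblock U1 I Z fP QE).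
rewrite -(big_col_mx _ (fun R => (row_full (col_mx (Q *m R) I) : nat))).
have QP : Q *m P = 0 by apply/sub_kermxP; rewrite QE.
have rQ : \rank (kermx P) = n by rewrite mxrank_ker (eqP fP) addnK.
have [J0 QJ0] := row_freeP Qfr; pose J := J0 - P *m L *m J0.
have QJ : Q *m J = 1%:M by rewrite mulmxBr QJ0 !mulmxA QP !mul0mx subr0.
have LJ : L *m J = 0 by rewrite mulmxBr !mulmxA LP mul1mx subrr.
clearbody J Q.
have JQ : J *m Q + P *m L = 1%:M.
  have : ((1%:M - P *m L) *m P)%R = 0.
    by rewrite mulmxBl mul1mx -mulmxA LP mulmx1 subrr.
  move/sub_kermxP; rewrite -QE => /submxP[D DE].
  have := congr1 (mulmx^~ J) DE; rewrite /= mulmxBl mul1mx -!mulmxA LJ QJ mulmx0 subr0 mulmx1.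
  by move=> ->; rewrite -DE subrK.
rewrite (reindex (fun t : 'M[k]_(\rank (kermx P), m) * 'M[k]_(b, m) => J *m t.1 + P *m t.2)) /=; last first.
  exists (fun R => (Q *m R, L *m R)) => [[S T]|R] _ /=.
    by rewrite !mulmxDr !mulmxA QJ QP LJ LP !mul1mx !mul0mx addr0 add0r.
  by rewrite !mulmxA -mulmxDl JQ mul1mx.
rewrite -(pair_bigA _ (fun S T => (row_full (col_mx (Q *m (J *m S + P *m T)) I) : nat))) /=.
under eq_bigr => S _ do under eq_bigr => T _ do
  rewrite mulmxDr !mulmxA QJ QP mul0mx mul1mx addr0.
under eq_bigr => S _ do rewrite sum_nat_const card_mx.
by rewrite -big_distrr /= -ngenE rQ (mulnC b).
Qed.

End MatrixCounting.

Section GeneratedSubspace.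
Variable k : finFieldType.
Local Notation q := #|k|.

(* The rows of P form a basis of the k[x]-submodule generated by the rows of U,
   where x acts as X. *)
Definition gen_by n b r (P : 'M[k]_(b, r)) (X : 'M[k]_r) (U : 'M[k]_(n, r)) :=
  [&& row_free P, (U <= P)%MS, (P *m X <= P)%MS & (P <= col_mx U (P *m X))%MS].

Lemma gen_by_min n b b' r (P : 'M[k]_(b, r)) (P' : 'M[k]_(b', r)) X (U : 'M[k]_(n, r)) :
  (exists s, X ^+ s = 0) -> gen_by P X U -> (U <= P')%MS -> (P' *m X <= P')%MS ->
  (P <= P')%MS.
Proof.
case=> s Xs /and4P[_ _ _ gP] UP' XP'.
have UX i : (U *m X ^+ i <= P')%MS.
  elim: i => [|i IH]; first by rewrite expr0 mulmx1.
  by rewrite exprSr -mulmxE mulmxA; apply: submx_trans XP'; exact: submxMr.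
suff PX i : (i <= s)%N -> (P *m X ^+ (s - i) <= P')%MS.
  by have := PX s (leqnn s); rewrite subnn expr0 mulmx1.
elim: i => [|i IH] is_; first by rewrite subn0 Xs mulmx0 sub0mx.
apply: submx_trans (submxMr _ gP) _; rewrite mul_col_mx -mulmxA mulmxE -exprS.
by rewrite subnSK // -addsmxE addsmx_sub UX IH // ltnW.
Qed.

Lemma gen_by_ex n r (X : 'M[k]_r) (U : 'M[k]_(n, r)) : (exists s, X ^+ s = 0) ->
  exists b (P : 'M[k]_(b, r)), gen_by P X U.
Proof.
case=> s Xs; pose W := (\sum_(i < s.+1) <<U *m X ^+ i>>)%MS.
have UW i : (U *m X ^+ i <= W)%MS.
  have [lt|ge] := ltnP i s.+1.
    by apply: (sumsmx_sup (Ordinal lt)); rewrite //= genmxE.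
  by rewrite -(subnK (ltnW ge)) exprD Xs mulr0 mulmx0 sub0mx.
have WE : (row_base W :=: W)%MS := eq_row_base W.
exists (\rank W), (row_base W); rewrite /gen_by row_base_free !WE.
have := UW 0%N; rewrite expr0 mulmx1 => -> /=.
rewrite (eqmxMr X WE); apply/andP; split.
  rewrite /W sumsmxMr; apply/sumsmx_subP => i _.
  by rewrite (eqmxMr X (genmxE _)) -mulmxA mulmxE -exprSr UW.
apply/sumsmx_subP => -[i lt] _ /=; rewrite genmxE -addsmxE; case: i lt => [|i] lt.
  by rewrite expr0 mulmx1 addsmxSl.
rewrite exprSr -mulmxE mulmxA; apply: submx_trans (submxMr _ _) (addsmxSr _ _).
by rewrite WE.
Qed.

Lemma card_gen_by n b r (P : 'M[k]_(b, r)) (X : 'M[k]_r) (U : 'M[k]_(n, r)) :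
  (exists s, X ^+ s = 0) -> gen_by P X U ->
  forall b', #|[set P' : 'M[k]_(b', r) | gen_by P' X U]| = (if b' == b then gl k b else 0)%N.
Proof.
move=> nX gP b'; have /and4P[fP UP XP PU] := gP.
have genPE (P' : 'M[k]_(b', r)) : gen_by P' X U -> (P' :=: P)%MS.
  move=> gP'; have /and4P[_ UP' XP' _] := gP'.
  by apply/eqmxP; rewrite (gen_by_min nX gP') ?(gen_by_min nX gP).
case: eqVneq => [E|ne]; last first.
  apply: eq_card0 => P'; rewrite inE; apply/negP=> gP'; case/eqP: ne.
  have /and4P[/eqP fP' _ _ _] := gP'.
  by rewrite -fP' (genPE _ gP') (eqP fP).
subst b'; rewrite /gl -(card_imset (f := fun g : 'M_b => g *m P)); last first.
  exact: (row_free_inj fP).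
apply: eq_card => P'; rewrite inE; apply/idP/imsetP => [gP'|[g]].
  have /eqmxP/andP[/submxP[g gE] _] := genPE _ gP'.
  exists g => //; rewrite inE -row_free_unit /row_free.
  have /and4P[/eqP fP' _ _ _] := gP'.
  by rewrite eqn_leq rank_leq_row -{1}fP' gE mxrankM_maxl.
rewrite inE => gu ->.
have gPE : (g *m P :=: P)%MS by apply: eqmxMfull; rewrite row_full_unit.
rewrite /gen_by /row_free !gPE (eqmxMr X gPE) UP XP -[\rank P == b]/(row_free P) fP /=.
by apply: submx_trans PU _; rewrite -!addsmxE addsmxS // (eqmxMr X gPE).
Qed.

End GeneratedSubspace.

Section CountingSubmodules.
Variables (k : finFieldType) (F : fieldType) (V : lmodType F).
Hypothesis char0 : [pchar F] =i pred0.
Local Notation q := (#|k|%:R : F).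
Variable c : forall d, 'M[k]_d -> V.
Hypothesis c_sim : forall d1 d2 (X : 'M[k]_d1) (X' : 'M[k]_d2), sim X 0 X' 0 -> c X = c X'.
Hypothesis c_nil : forall d (X : 'M[k]_d), ~ (exists s, X ^+ s = 0) -> c X = 0.

Lemma glr_neq0 n : (gl k n)%:R != 0 :> F.
Proof. by rewrite (natr_neq0 char0) gl_gt0. Qed.

Definition ext_sum n a b : V :=
  \sum_(A : 'M[k]_a) \sum_(B : 'M[k]_b) \sum_(Y : 'M[k]_(a, b)) (ngen n B)%:R *: c (lblock B Y A).

Lemma sum_gen_by n a b (P : 'M[k]_(b, b + a)) : row_free P ->
  \sum_(X : 'M[k]_(b + a)) \sum_(U : 'M[k]_(n, b + a) | gen_by P X U) c X = ext_sum n a b.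
Proof.
move=> fP; pose P0 : 'M[k]_(b, b + a) := row_mx 1%:M 0.
have fP0 : row_free P0 by apply/row_freeP; exists (col_mx 1%:M 0);
  rewrite mul_row_col mul0mx mulmx1 addr0.
have [g [h [gu hu PE]]] := rank_eq_equiv (etrans (eqP fP) (esym (eqP fP0))).
transitivity (\sum_(X : 'M[k]_(b + a)) \sum_(U : 'M[k]_(n, b + a) | gen_by P0 X U) c X).
  rewrite (reindex (fun X => invmx h *m X *m h)) /=; last first.
    by exists (fun X => h *m X *m invmx h) => X _ /=; rewrite !mulmxA ?mulmxV ?mulVmx // mul1mx
      -mulmxA ?mulmxV ?mulVmx // mulmx1.
  apply: eq_bigr => X _.
  rewrite (reindex (fun U : 'M[k]_(n, b + a) => U *m h)) /=; last first.
    by exists (fun U => U *m invmx h) => U _; rewrite ?mulmxK ?mulmxKV.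
  apply: eq_big => [U|U _]; last first.
    apply: c_sim; apply/simP; exists (invmx h), h.
    by rewrite mulVmx // mulmxV // mulmxK // mulmx0 mul0mx.
  have hfr : row_free h by rewrite row_free_unit.
  have gPE : (g *m P0 :=: P0)%MS by apply: eqmxMfull; rewrite row_full_unit.
  have E : g *m P0 *m h *m (invmx h *m X *m h) = g *m P0 *m X *m h.
    by rewrite !mulmxA mulmxK.
  have colE : (col_mx U (g *m P0 *m X) :=: col_mx U (P0 *m X))%MS.
    apply: eqmx_trans (eqmx_sym (addsmxE _ _)) _.
    exact: eqmx_trans (adds_eqmx (eqmx_refl U) (eqmxMr X gPE)) (addsmxE _ _).
  by rewrite /gen_by fP fP0 PE E -mul_col_mx !submxMfree // !gPE (eqmxMr X gPE) colE.
rewrite /ext_sum big_block_mx.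
transitivity (\sum_(B : 'M[k]_b) \sum_(Y : 'M[k]_(a, b)) \sum_(A : 'M[k]_a)
   (ngen n B)%:R *: c (lblock B Y A)); last first.
  rewrite [RHS]exchange_big; apply: eq_bigr => B _; exact: exchange_big.
apply: eq_bigr => B _; rewrite (bigD1 (0 : 'M_(b, a))) //= [X in _ + X]big1 ?addr0; last first.
  move=> Z Z0; rewrite big1 // => Y _; rewrite big1 // => A _; rewrite big_pred0 // => U.
  apply/negP=> /and4P[_ _ + _]; rewrite /P0 mul_row_block !mul1mx !mul0mx !addr0.
  case/submxP=> D; rewrite mul_mx_row mulmx0 => /eq_row_mx[_ Z00].
  by rewrite Z00 eqxx in Z0.
apply: eq_bigr => Y _; apply: eq_bigr => A _.
rewrite sumr_const [RHS]scaler_nat; congr (_ *+ _).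
rewrite /ngen -(card_imset (f := fun U1 : 'M_(n, b) => row_mx U1 (0 : 'M_(n, a)))); last first.
  by move=> U U' /eq_row_mx[].
apply: eq_card => U; rewrite -[U]hsubmxK; set U1 := lsubmx U; set U2 := rsubmx U.
have genE : (P0 <= col_mx (row_mx U1 0) (P0 *m block_mx B 0 Y A))%MS = row_full (col_mx U1 B).
  rewrite /P0 mul_row_block !mul1mx !mul0mx !addr0 -sub1mx.
  have -> : col_mx (row_mx U1 0) (row_mx B 0) = row_mx (col_mx U1 B) (0 : 'M_(n + b, a)).
    by rewrite -block_mxEv block_mxEh col_mx0.
  apply/submxP/submxP => -[D DE]; exists D.
    by move: DE; rewrite mul_mx_row => /eq_row_mx[].
  by rewrite mul_mx_row -DE mulmx0.
apply/idP/imsetP => [/and4P[_ /submxP[D]]|].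
  rewrite mul_mx_row mulmx0 => /eq_row_mx[_ U20] _; rewrite U20 genE => fU.
  by exists U1; rewrite ?inE.
case=> U1'; rewrite inE => fU /eq_row_mx[U1E U20]; rewrite U20 /gen_by.
rewrite -[_ \in _]/(gen_by P0 (block_mx B 0 Y A) (row_mx U1 0)) /gen_by fP0 genE U1E fU andbT /=.
rewrite /P0 mul_row_block !mul1mx !mul0mx !addr0; apply/andP; split; apply/submxP.
  by exists U1'; rewrite mul_mx_row mulmx1 mulmx0.
by exists B; rewrite mul_mx_row mulmx1 mulmx0.
Qed.

Lemma card_row_free a b :
  (#|[set P : 'M[k]_(b, b + a) | row_free P]| * (gl k a * #|k| ^ (a * b)) = gl k (b + a))%N.
Proof.
have := card_rankset k 0 b a.
have -> : gl k 0 = 1%N.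
  rewrite /gl -[RHS](card_mx k 0 0); apply: eq_card => g.
  by rewrite inE unitmxE det_mx00 unitr1.
rewrite muln0 muln1 add0n => E; have b0 : (0 < gl k b)%N by exact: gl_gt0.
apply/eqP; rewrite -(eqn_pmul2l b0) -E (mulnC b a); apply/eqP.
set x := (#|k| ^ _)%N; set y := #|_|.
by ring.
Qed.

Lemma ext_sum_generated n r :
  \sum_(b < r.+1) ((gl k (r - b) * gl k b * #|k| ^ ((r - b) * b))%:R^-1) *: ext_sum n (r - b) b
  = (q ^+ (n * r) / (gl k r)%:R) *: \sum_(X : 'M[k]_r) c X.
Proof.
have split1 (X : 'M[k]_r) (U : 'M[k]_(n, r)) : c X =
    \sum_(b < r.+1) \sum_(P : 'M[k]_(b, r) | gen_by P X U) (gl k b)%:R^-1 *: c X.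
  have [nX|nX] := pselect (exists s, X ^+ s = 0); last first.
    by rewrite c_nil // big1 // => b _; rewrite big1 // => P _; rewrite scaler0.
  have [b [P gP]] := gen_by_ex U nX.
  have br : (b < r.+1)%N by have /and4P[/eqP fP _ _ _] := gP; have := rank_leq_col P; rewrite fP ltnS.
  rewrite (bigD1 (Ordinal br)) //= [X in _ + X]big1 ?addr0 => [|b' ne]; last first.
    rewrite big_pred0 // => P'; apply/negbTE/negP => gP'.
    have := card_gen_by nX gP b'; rewrite ifN // => /eqP; rewrite cards_eq0 => /eqP/setP/(_ P').
    by rewrite !inE gP'.
  rewrite sumr_const -scaler_nat scalerA.
  have -> : #|[pred P' : 'M_(b, r) | gen_by P' X U]| = gl k b.
    by have := card_gen_by nX gP b; rewrite eqxx => <-; apply: eq_card => P'; rewrite !inE.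
  by rewrite divff ?scale1r ?glr_neq0.
apply: (@scalerI _ _ (gl k r)%:R); first exact: glr_neq0.
rewrite scalerA mulrC divfK ?glr_neq0 //.
transitivity (\sum_(X : 'M[k]_r) \sum_(U : 'M[k]_(n, r)) c X); last first.
  rewrite scaler_sumr; apply: eq_bigr => X _.
  by rewrite sumr_const card_mx -scaler_nat natrX.
under [RHS]eq_bigr => X _ do under eq_bigr => U _ do rewrite (split1 X U).
under [RHS]eq_bigr => X _ do rewrite exchange_big /=.
rewrite exchange_big /= scaler_sumr; apply: eq_bigr => b _.
under [RHS]eq_bigr => X _ do rewrite (exchange_big_dep xpredT) //=.
rewrite exchange_big /=.
have rE : r = (b + (r - b))%N by rewrite subnKC // -ltnS.
move: (r - b)%N rE => a rE; move: (b : nat) rE => {b} b rE; subst r => {split1}.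
rewrite (bigID (fun P => row_free P)) /= [X in _ = _ + X]big1 ?addr0; last first.
  move=> P nP; rewrite big1 // => X _; rewrite big_pred0 // => U.
  by apply/negbTE/negP => /and4P[fP]; rewrite fP in nP.
under [RHS]eq_bigr => P fP do under eq_bigr => X _ do rewrite -scaler_sumr.
under [RHS]eq_bigr => P fP do rewrite -scaler_sumr sum_gen_by //.
rewrite sumr_const -scaler_nat !scalerA; congr (_ *: _).
have <- : #|[set P : 'M[k]_(b, b + a) | row_free P]| = #|[pred P : 'M[k]_(b, b + a) | row_free P]|.
  by apply: eq_card => P; rewrite !inE.
rewrite -card_row_free !natrM.
have := glr_neq0 a; have := glr_neq0 b; have : (#|k| ^ (a * b))%:R != 0 :> F.
  by rewrite (natr_neq0 char0) expn_gt0; apply/orP; left; apply/card_gt0P; exists 0.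
by move=> h1 h2 h3; field; rewrite h1 h2 h3.
Qed.

End CountingSubmodules.

(** * The action of the class K *)

Section KsAction.
Variables (k : finFieldType) (F : fieldType).
Hypothesis char0 : [pchar F] =i pred0.
Local Notation q := (#|k|%:R : F).
Local Notation A := (iHall k F).

Let KD : 'M[k]_(1 + 1) := block_mx 0 0 1%:M 0.

Lemma KS_icl : KS = icl F (0 : 'M[k]_(1 + 1)) KD.
Proof.
rewrite /KS -icl_cplx.
have -> : nmx (Kcplx (Sn k 1)) = 0; last by [].
rewrite /=; have -> : jordan_mx k 1 = 0.
  by apply/matrixP=> i j; rewrite !mxE gtn_eqF // (leq_trans (ltn_ord j)).
exact: block_mx0.
Qed.

Section KExtension.
Variables (d : nat) (X D : 'M[k]_d) (Y C : 'M[k]_(1 + 1, d)).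
Hypothesis cXD : cplxP X D.

Lemma KS_ext_cplxP : cplxP (lblock X Y 0) (lblock D C KD) <->
  usubmx C = - (dsubmx C *m D) /\ usubmx Y = dsubmx Y *m D - dsubmx C *m X.
Proof.
have [nX /eqP XD DD] := cXD; rewrite -[Y]vsubmxK -[C]vsubmxK !col_mxKu !col_mxKd.
set y1 := usubmx Y; set y2 := dsubmx Y; set c1 := usubmx C; set c2 := dsubmx C.
have KDD : KD *m KD = 0.
  by rewrite mulmx_block !(mulmx0, mul0mx, addr0, add0r) block_mx0.
have sq : lblock D (col_mx c1 c2) KD *m lblock D (col_mx c1 c2) KD =
  block_mx 0 0 (col_mx (c1 *m D) (c2 *m D + c1)) 0.
  rewrite /lblock mulmx_block !(mulmx0, mul0mx, addr0, add0r) DD KDD /KD mul_block_col mul_col_mx.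
  by rewrite !(mulmx0, mul0mx, mul1mx, addr0, add0r) add_col_mx addr0.
have cm : (lblock X (col_mx y1 y2) 0 *m lblock D (col_mx c1 c2) KD =
    lblock D (col_mx c1 c2) KD *m lblock X (col_mx y1 y2) 0) <->
  (y1 *m D = c1 *m X /\ y2 *m D = c2 *m X + y1).
  rewrite /lblock !mulmx_block !(mulmx0, mul0mx, addr0, add0r) XD /KD mul_block_col !mul_col_mx.
  rewrite !(mulmx0, mul0mx, mul1mx, addr0, add0r) add_col_mx addr0; split.
    by case/eq_block_mx=> _ _ /eq_col_mx.
  by case=> -> ->.
split=> [[_ /eqP/cm[_ y2E] /eqP]|[c1E y1E]].
  rewrite sq block_mx_eq0 col_mx_eq0 => /and4P[_ _ /andP[_ c2E] _].
  by split; apply/eqP; [rewrite -addr_eq0 addrC | rewrite y2E addrC addKr].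
split.
- by apply/lblock_nil; split=> //; exists 1%N; rewrite expr1.
- apply/eqP/cm; rewrite y1E c1E; split; last by rewrite addrC subrK.
  by rewrite mulmxBl mulNmx -!mulmxA DD XD mulmx0 sub0r.
- by rewrite sq c1E mulNmx -mulmxA DD mulmx0 oppr0 subrr col_mx0 block_mx0.
Qed.

Lemma KS_ext_hdata h (V : 'M[k]_(h, d)) (Q : 'M[k]_(d, h)) :
  usubmx C = - (dsubmx C *m D) -> hdata X D V Q ->
  \rank (lblock D C KD) = (\rank D).+1 /\
  hdata (lblock X Y 0) (lblock D C KD) (row_mx V 0) (col_mx Q (col_mx (- (dsubmx C *m Q)) 0)).
Proof.
rewrite -[C]vsubmxK !col_mxKu !col_mxKd; set c1 := usubmx C; set c2 := dsubmx C.
move=> c1E [VD DQ VQ dE].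
have rk : \rank (lblock D (col_mx c1 c2) KD) = (\rank D).+1.
  pose L := block_mx 1%:M 0 (col_mx (- c2) 0) 1%:M : 'M[k]_(d + (1 + 1)).
  pose W := block_mx 1%:M 0 (col_mx c2 0) 1%:M : 'M[k]_(d + (1 + 1)).
  have Lu : L \in unitmx by rewrite unitmx_lblock !unitmx1.
  have Wu : W \in unitmx by rewrite unitmx_lblock !unitmx1.
  have -> : lblock D (col_mx c1 c2) KD = L *m block_mx D 0 0 KD *m W.
    rewrite /L /W !mulmx_block !(mulmx0, mul0mx, addr0, add0r, mulmx1, mul1mx).
    rewrite mul_col_mx mul0mx mulNmx /KD mul_block_col !(mulmx0, mul0mx, addr0, add0r, mul1mx).
    by rewrite add_col_mx addr0 add0r /lblock c1E.
  rewrite mxrankMfree ?row_free_unit // eqmxMfull ?row_full_unit //.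
  by rewrite rank_diag_block_mx (rank_std k 1 1 1 : \rank KD = 1%N) addn1.
split=> //; split.
- by rewrite /lblock mul_row_block !mul0mx !addr0 VD mulmx0 row_mx0.
- rewrite /lblock mul_block_col !mul0mx addr0 DQ mul_col_mx /KD mul_block_col.
  rewrite !(mulmx0, mul0mx, mul1mx, addr0, add0r) add_col_mx addr0 c1E mulNmx -mulmxA DQ.
  by rewrite mulmx0 oppr0 subrr !col_mx0.
- by rewrite mul_row_col mul0mx addr0.
by rewrite rk -[in RHS]dE; lia.
Qed.

End KExtension.

Lemma imul_KS d (X D : 'M[k]_d) h (V : 'M[k]_(h, d)) (Q : 'M[k]_(d, h))
    d' (X' D' : 'M[k]_d') (V' : 'M[k]_(h, d')) (Q' : 'M[k]_(d', h)) :
  cplxP X D -> hdata X D V Q -> cplxP X' D' -> hdata X' D' V' Q' ->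
  \rank D' = (\rank D).+1 -> V' *m X' *m Q' = V *m X *m Q ->
  imul KS (icl F X D) = icl F X' D'.
Proof.
move=> cXD hVQ cXD' hVQ' rD' E; rewrite KS_icl (imul_icl char0).
pose good (YC : 'M[k]_(1 + 1, d) * 'M[k]_(1 + 1, d)) :=
  (usubmx YC.2 == - (dsubmx YC.2 *m D)) && (usubmx YC.1 == dsubmx YC.1 *m D - dsubmx YC.2 *m X).
rewrite (bigID good) /= [X in _ + X]big1 ?addr0; last first.
  move=> [Y C] ng; apply: icl_eq0 => /(KS_ext_cplxP _ _ cXD)[c1 y1].
  by move: ng; rewrite /good /= c1 y1 !eqxx.
rewrite (eq_bigr (fun _ => icl F X' D')) => [|[Y C] /andP[/eqP /= c1 /eqP /= y1]]; last first.
  have [rk hd] := KS_ext_hdata Y c1 hVQ.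
  have cc : cplxP (lblock X Y 0) (lblock D C KD) by exact/(KS_ext_cplxP _ _ cXD).
  apply: (icl_hdata F cc cXD' hd hVQ'); first by rewrite rk.
  rewrite mul_row_block mul0mx mul0mx !addr0 mulmx0 mul_row_col mul0mx addr0 E.
  exact: sim_refl.
rewrite sumr_const -scaler_nat scalerA.
have -> : #|good| = (#|k| ^ (2 * d))%N.
  pose f (t : 'M[k]_(1, d) * 'M[k]_(1, d)) : 'M[k]_(1 + 1, d) * 'M[k]_(1 + 1, d) :=
    (col_mx (t.1 *m D - t.2 *m X) t.1, col_mx (- (t.2 *m D)) t.2).
  transitivity #|f @: setT|.
    apply: eq_card => -[Y C]; apply/idP/imsetP => [/andP[/eqP /= c1 /eqP /= y1]|[[y c] _ [-> ->]]].
      by exists (dsubmx Y, dsubmx C); rewrite // /f /= -c1 -y1 !vsubmxK.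
    by rewrite unfold_in /good /= !col_mxKu !col_mxKd !eqxx.
  rewrite card_imset; last by move=> [y c] [y' c'] [] /eq_col_mx[_ ->] /eq_col_mx[_ ->].
  by rewrite cardsT card_prod !card_mx mul1n -expnD addnn mul2n.
by rewrite natrX mulVf ?scale1r // expf_neq0 // (qcard_neq0 _ char0).
Qed.

Definition Kpow m : A := iter m (imul KS) ione.

Lemma icl_Kpow d (X D : 'M[k]_d) h (V : 'M[k]_(h, d)) (Q : 'M[k]_(d, h)) :
  cplxP X D -> hdata X D V Q ->
  icl F X D = imul (Kpow (\rank D)) (icl F (V *m X *m Q) 0).
Proof.
move=> cXD hVQ; set H := V *m X *m Q.
have nH : exists r, H ^+ r = 0.
  have [h' [V' [Q' [hVQ' [r nr]]]]] := cplxP_hdata cXD.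
  have [x1 x2 x3] := cXD; pose M := Cplx (cobj := Nrep x1) x2 x3.
  have s := sim_trans (sim_sym (@hdata_homology k M h V Q hVQ)) (@hdata_homology k M h' V' Q' hVQ').
  have cH' : cplxP (V' *m X *m Q') 0.
    by split; [exists r | rewrite mulmx0 mul0mx | rewrite mulmx0].
  by have [] := sim_cplxP s cH'.
have cH : cplxP H 0 by split; rewrite ?mulmx0 ?mul0mx.
suff [d' [X' [D' [V' [Q' [cXD' hVQ' rD' E1 E2]]]]]] : exists d' (X' D' : 'M[k]_d')
    (V' : 'M[k]_(h, d')) (Q' : 'M[k]_(d', h)),
    [/\ cplxP X' D', hdata X' D' V' Q', \rank D' = \rank D, V' *m X' *m Q' = H &
      icl F X' D' = imul (Kpow (\rank D)) (icl F H 0)].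
  rewrite -E2; apply: (icl_hdata F cXD cXD' hVQ hVQ'); first by rewrite rD'.
  by rewrite E1; exact: sim_refl.
elim: (\rank D) => [|m [d' [X' [D' [V' [Q' [cXD' hVQ' rD' E1 E2]]]]]]].
  exists h, H, 0, 1%:M, 1%:M; split; rewrite ?mxrank0 ?mulmx1 ?mul1mx //.
    by split; rewrite ?mulmx0 ?mul0mx ?mulmx1 ?mxrank0 // addn0.
  by rewrite /= (imul1r char0).
have c1 : usubmx (0 : 'M[k]_(1 + 1, d')) = - (dsubmx (0 : 'M[k]_(1 + 1, d')) *m D').
  by rewrite !linear0 mul0mx oppr0.
have [rk hd] := KS_ext_hdata 0 c1 hVQ'.
have cc : cplxP (lblock X' 0 0) (lblock D' 0 KD).
  by apply/(KS_ext_cplxP _ _ cXD'); rewrite !linear0 !mul0mx oppr0 addr0.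
have EE : row_mx V' 0 *m lblock X' 0 0 *m
    col_mx Q' (col_mx (- (dsubmx (0 : 'M[k]_(1 + 1, d')) *m Q')) (0 : 'M[k]_(1, h))) = H.
  by rewrite /lblock mul_row_block !(mulmx0, mul0mx, addr0) mul_row_col mul0mx addr0.
do 5![eexists]; split; [exact: cc | exact: hd | by rewrite rk rD' | exact: EE |].
by rewrite -(imul_KS cXD' hVQ' cc hd rk (etrans EE (esym E1))) E2 /= (imulA char0).
Qed.

End KsAction.

(** * The main identity at powers of q *)

Section MainCount.
Variables (k : finFieldType) (F : fieldType).
Hypothesis char0 : [pchar F] =i pred0.
Local Notation q := (#|k|%:R : F).

Lemma ngen_equiv n d (X g h : 'M[k]_d) : g \in unitmx -> h \in unitmx ->
  ngen n (g *m X *m h) = ngen n X.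
Proof.
move=> gu hu; rewrite /ngen -[RHS](card_imset (f := fun U : 'M_(n, d) => U *m h)); last first.
  by apply: row_free_inj; rewrite row_free_unit.
have E (U : 'M_(n, d)) : row_full (col_mx (U *m h) (g *m X *m h)) = row_full (col_mx U X).
  have -> : col_mx (U *m h) (g *m X *m h) = (block_mx 1%:M 0 0 g) *m (col_mx U X) *m h.
    by rewrite mul_block_col !mul0mx addr0 add0r mul1mx mul_col_mx.
  rewrite /row_full mxrankMfree ?row_free_unit // eqmxMfull // row_full_unit.
  by rewrite unitmx_lblock unitmx1.
apply: eq_card => U; rewrite inE; apply/idP/imsetP => [fU|[U' fU' ->]].
  by exists (U *m invmx h); rewrite ?inE ?mulmxKV // -E mulmxKV.
by rewrite E; rewrite inE in fU'.
Qed.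

Lemma sum_std_blocks (V : lmodType F) n a m b
    (T : 'M[k]_(m + b) -> 'M[k]_(a + m, m + b) -> 'M[k]_(a + m) -> V)
    (w : 'M[k]_m -> F) (t : 'M[k]_b -> 'M[k]_(a, b) -> 'M[k]_a -> V) :
  (forall B11 B12 Z B Y A A12 W A22, ~ [/\ B12 = 0, A12 = 0 & A22 = B11] ->
     T (block_mx B11 B12 Z B) Y (block_mx A A12 W A22) = 0) ->
  (forall I Z B Y A W,
     T (block_mx I 0 Z B) Y (block_mx A 0 W I) = w I *: t B (ursubmx Y) A) ->
  \sum_(A : 'M[k]_(a + m)) \sum_(B : 'M[k]_(m + b)) \sum_(Y : 'M[k]_(a + m, m + b))
     (ngen n B)%:R *: T B Y A
  = (q ^+ (m * a + a * m + m * m + m * b + m * b) * \sum_I w I * (ngen n I)%:R) *: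
     \sum_(A : 'M[k]_a) \sum_(B : 'M[k]_b) \sum_(Y : 'M[k]_(a, b)) (ngen n B)%:R *: t B Y A.
Proof.
move=> T0 TE.
have sumZ d1 d2 (v : V) : \sum_(Z : 'M[k]_(d1, d2)) v = q ^+ (d1 * d2) *: v.
  by rewrite sumr_const card_mx -scaler_nat natrX.
transitivity (\sum_(A : 'M[k]_a) \sum_(W : 'M[k]_(m, a)) \sum_(I : 'M[k]_m) \sum_(Z : 'M[k]_(b, m))
    \sum_(B : 'M[k]_b) \sum_(Y : 'M[k]_(a + m, m + b))
     ((ngen n (block_mx I 0 Z B : 'M_(m + b)))%:R * w I) *: t B (ursubmx Y) A).
  rewrite big_block_mx; apply: eq_bigr => A _.
  rewrite (bigD1 (0 : 'M_(a, m))) //= [X in _ + X]big1 ?addr0 => [|A12 ne]; last first.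
    rewrite big1 // => W _; rewrite big1 // => A22 _; rewrite big_block_mx big1 // => B11 _.
    rewrite big1 // => B12 _; rewrite big1 // => Z _; rewrite big1 // => B _.
    by rewrite big1 // => Y _; rewrite T0 ?scaler0 // => -[_ /eqP]; rewrite (negPf ne).
  apply: eq_bigr => W _; under eq_bigr => A22 _ do rewrite big_block_mx.
  rewrite exchange_big; apply: eq_bigr => I _ /=.
  rewrite (bigD1 I) //= [X in _ + X]big1 ?addr0 => [|A22 ne]; last first.
    rewrite big1 // => B12 _; rewrite big1 // => Z _; rewrite big1 // => B _.
    by rewrite big1 // => Y _; rewrite T0 ?scaler0 // => -[_ _ /eqP]; rewrite (negPf ne).
  rewrite (bigD1 (0 : 'M_(m, b))) //= [X in _ + X]big1 ?addr0 => [|B12 ne]; last first.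
    rewrite big1 // => Z _; rewrite big1 // => B _.
    by rewrite big1 // => Y _; rewrite T0 ?scaler0 // => -[/eqP]; rewrite (negPf ne).
  apply: eq_bigr => Z _; apply: eq_bigr => B _; apply: eq_bigr => Y _.
  by rewrite TE scalerA.
pose S A B := \sum_(Y : 'M[k]_(a, b)) t B Y A.
transitivity (\sum_(A : 'M[k]_a) \sum_(W : 'M[k]_(m, a)) \sum_(I : 'M[k]_m) \sum_(B : 'M[k]_b)
   (q ^+ (a * m + m * m + m * b + m * b) * (w I * (ngen n I)%:R) * (ngen n B)%:R) *: S A B).
  apply: eq_bigr => A _; apply: eq_bigr => W _; apply: eq_bigr => I _.
  rewrite exchange_big; apply: eq_bigr => B _ /=.
  transitivity (\sum_(Z : 'M[k]_(b, m)) ((ngen n (block_mx I 0 Z B : 'M_(m + b)))%:R * w I *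
      q ^+ (a * m + m * m + m * b)) *: S A B).
    apply: eq_bigr => Z _; rewrite -scaler_sumr -scalerA; congr (_ *: _).
    rewrite big_block_mx.
    under eq_bigr => Y11 _ do under eq_bigr => Y12 _ do under eq_bigr => Y21 _ do
      under eq_bigr => Y22 _ do rewrite block_mxKur.
    rewrite /S.
    under eq_bigr => Y11 _ do under eq_bigr => Y12 _ do rewrite !sumZ.
    by rewrite sumZ -!scaler_sumr !scalerA -!exprD; congr (_ ^+ _ *: _); lia.
  rewrite -scaler_suml -!mulr_suml; congr (_ *: _).
  rewrite -natr_sum sum_ngen_lblock !natrM natrX !exprD.
  by move: (q ^+ (m * b)) (q ^+ (a * m)) (q ^+ (m * m)) => x y z; ring.
under eq_bigr => A _ do rewrite sumZ.
rewrite [RHS]scaler_sumr; apply: eq_bigr => A _.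
rewrite exchange_big !scaler_sumr; apply: eq_bigr => B _ /=.
rewrite -scaler_suml -mulr_suml -mulr_sumr -scaler_sumr !scalerA; congr (_ *: _).
rewrite !exprD.
by move: (q ^+ (m * b)) (q ^+ (a * m)) (q ^+ (m * m)) (q ^+ (m * a)) => x y z u; ring.
Qed.

End MainCount.

Lemma sum_shift_diag (V : nmodType) (f : nat -> nat -> nat -> V) r :
  \sum_(b < r.+1) \sum_(m < r.+1 | ((m <= r - b) && (m <= b))%N) f m (r - b - m)%N (b - m)%N
  = \sum_(m < r.+1 | (m.*2 <= r)%N) \sum_(b < (r - m.*2).+1) f m (r - m.*2 - b)%N b.
Proof.
rewrite (exchange_big_dep (fun m : 'I_r.+1 => m.*2 <= r)%N) /=; last by move=> b m _; lia.
apply: eq_bigr => m mr.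
rewrite (reindex_onto (fun b : 'I_(r - m.*2).+1 => inord (b + m) : 'I_r.+1)
  (fun b : 'I_r.+1 => inord (b - m))) /=; last first.
  move=> b bm; have lt := ltn_ord b; have E : (inord (b - m) : 'I_(r - m.*2).+1) = (b - m)%N :> nat.
    by rewrite inordK //; lia.
  by apply: val_inj; rewrite /= inordK E; lia.
have bE (b : 'I_(r - m.*2).+1) : (inord (b + m) : 'I_r.+1) = (b + m)%N :> nat.
  by rewrite inordK //; have := ltn_ord b; lia.
apply: eq_big => [b|b _].
  rewrite bE; have := ltn_ord b => lt; apply/andP; split; first lia.
  by apply/eqP/val_inj; rewrite /= inordK; lia.
by rewrite bE; congr (f _ _ _); lia.
Qed.

Section MainIdentity.
Variables (k : finFieldType) (F : fieldType).
Hypothesis char0 : [pchar F] =i pred0.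
Local Notation q := (#|k|%:R : F).
Local Notation A := (iHall k F).

Lemma icl0_sim d1 d2 (X : 'M[k]_d1) (X' : 'M[k]_d2) : sim X 0 X' 0 -> icl F X 0 = icl F X' 0.
Proof. exact: icl_sim. Qed.

Lemma icl0_nil d (X : 'M[k]_d) : ~ (exists s, X ^+ s = 0) -> icl F X 0 = 0.
Proof. by move=> nX; apply: icl_eq0 => -[]. Qed.

Definition Hc r : A := (gl k r)%:R^-1 *: \sum_(X : 'M[k]_r) icl F X 0.

Definition Gc n r : A := (gl k r)%:R^-1 *: \sum_(X : 'M[k]_r) (ngen n X)%:R *: icl F X 0.

Definition cnil d (X : 'M[k]_d) : F := `[< exists r, X ^+ r = 0 >]%:R.

Definition gc n m : F := (gl k m)%:R^-1 * \sum_(I : 'M[k]_m) cnil I * (ngen n I)%:R.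

Let esum := ext_sum (fun d (X : 'M[k]_d) => icl F X 0).

Definition HG_stratum n a b (C : 'M[k]_(a, b)) : A :=
  \sum_(Xa : 'M[k]_a) \sum_(Xb : 'M[k]_b) \sum_(Y : 'M[k]_(a, b))
    (ngen n Xb)%:R *: icl F (lblock Xb Y Xa) (lblock 0 C 0).

Lemma imul_HG n a b :
  imul (Hc a) (Gc n b) = (gl k a * gl k b * #|k| ^ (a * b))%:R^-1 *: \sum_C @HG_stratum n a b C.
Proof.
rewrite /Hc /Gc iscale_imull iscale_imulr scalerA imul_suml.
under eq_bigr => X _ do rewrite imul_sumr.
under eq_bigr => X _ do under eq_bigr => X' _ do
  rewrite iscale_imulr (imul_icl char0) scalerA mulrC -scalerA.
under eq_bigr => X _ do rewrite -scaler_sumr.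
rewrite -scaler_sumr scalerA !natrM natrX !invfM; congr (_ *: _).
rewrite /HG_stratum [RHS]exchange_big; apply: eq_bigr => X _ /=.
rewrite [RHS]exchange_big; apply: eq_bigr => X' _ /=.
by rewrite [RHS]exchange_big [RHS]pair_bigA scaler_sumr.
Qed.

Lemma FF_equiv n a b (C : 'M[k]_(a, b)) g h : g \in unitmx -> h \in unitmx ->
  HG_stratum n (g *m C *m h) = HG_stratum n C.
Proof.
move=> gu hu; rewrite /HG_stratum.
rewrite (reindex (fun X : 'M[k]_a => g *m X *m invmx g)) /=; last first.
  by exists (fun X => invmx g *m X *m g) => X _; rewrite !mulmxA ?mulmxV ?mulVmx // mul1mx
    -mulmxA ?mulmxV ?mulVmx // mulmx1.
apply: eq_bigr => X _.
rewrite (reindex (fun X : 'M[k]_b => invmx h *m X *m h)) /=; last first.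
  by exists (fun X => h *m X *m invmx h) => X' _; rewrite !mulmxA ?mulmxV ?mulVmx // mul1mx
    -mulmxA ?mulmxV ?mulVmx // mulmx1.
apply: eq_bigr => X' _.
rewrite (reindex (fun Y : 'M[k]_(a, b) => g *m Y *m h)) /=; last first.
  by exists (fun Y => invmx g *m Y *m invmx h) => Y _; rewrite !mulmxA ?mulmxV ?mulVmx // mul1mx
    -mulmxA ?mulmxV ?mulVmx // mulmx1.
have hu' : invmx h \in unitmx by rewrite unitmx_inv.
apply: eq_bigr => Y _; rewrite (ngen_equiv n X' hu' hu); apply: (congr1 (fun x => _ *: x)).
apply: icl_sim; apply/simP; exists (block_mx (invmx h) 0 0 g), (block_mx h 0 0 (invmx g)).
rewrite /lblock !mulmx_block !(mulmx0, mul0mx, addr0, add0r) !mulmxV ?mulVmx //.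
by rewrite !mulmxK // !mulmxKV // -!scalar_mx_block.
Qed.

Lemma icl_std_eq0 a m b (B11 : 'M[k]_m) B12 Z (B : 'M[k]_b) Y (A1 : 'M[k]_a) A12 W (A22 : 'M[k]_m) :
  ~ [/\ B12 = 0, A12 = 0 & A22 = B11] ->
  icl F (lblock (block_mx B11 B12 Z B) Y (block_mx A1 A12 W A22)) (lblock 0 (std k a m b) 0) = 0.
Proof.
move=> ne; apply: icl_eq0 => -[_ /eqP E _]; case: ne; move: E.
rewrite /lblock !mulmx_block !(mulmx0, mul0mx, addr0, add0r) /std.
case/eq_block_mx=> _ _; rewrite !mulmx1 !mul1mx => /eq_block_mx[-> _ -> <-] _.
by split.
Qed.

Lemma icl_std a m b (I : 'M[k]_m) Z (B : 'M[k]_b) Y (A1 : 'M[k]_a) W :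
  icl F (lblock (block_mx I 0 Z B) Y (block_mx A1 0 W I)) (lblock 0 (std k a m b) 0)
  = cnil I *: imul (Kpow k F m) (icl F (lblock B (ursubmx Y) A1) 0).
Proof.
set X := lblock _ _ _; set D := lblock _ _ _.
have comm : X *m D = D *m X.
  by rewrite /X /D /lblock !mulmx_block !(mulmx0, mul0mx, addr0, add0r, mulmx1, mul1mx).
have DD : D *m D = 0.
  by rewrite /D /lblock mulmx_block !(mulmx0, mul0mx, addr0, add0r) block_mx0.
have nilE : (exists r, X ^+ r = 0) <-> [/\ exists r, I ^+ r = 0, exists r, B ^+ r = 0
     & exists r, A1 ^+ r = 0].
  split=> [/lblock_nil[/lblock_nil[nI nB] /lblock_nil[nA _]] //|[nI nB nA]].
  by apply/lblock_nil; split; apply/lblock_nil.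
have nil2 : (exists r, lblock B (ursubmx Y) A1 ^+ r = 0) <->
   [/\ exists r, B ^+ r = 0 & exists r, A1 ^+ r = 0].
  by split=> [/lblock_nil[]|[nB nA]] //; apply/lblock_nil.
rewrite /cnil; case: asboolP => [nI|nI]; last first.
  by rewrite scale0r; apply: icl_eq0 => -[/nilE[]].
rewrite scale1r.
have [nBA|nBA] := pselect (exists r, lblock B (ursubmx Y) A1 ^+ r = 0); last first.
  rewrite (icl_eq0 F (X := lblock B (ursubmx Y) A1)); last by case.
  rewrite imulr0; apply: icl_eq0 => -[/nilE[_ nB nA] _ _].
  by case: nBA; apply/nil2.
have cXD : cplxP X D.
  by split; [apply/nilE; have [nB nA] := proj1 nil2 nBA | exact/eqP | exact: DD].
pose VV : 'M[k]_(b + a, (m + b) + (a + m)) := block_mx (row_mx 0 1%:M) 0 0 (row_mx 1%:M 0).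
pose QQ : 'M[k]_((m + b) + (a + m), b + a) := block_mx (col_mx 0 1%:M) 0 0 (col_mx 1%:M 0).
have rD : \rank D = m.
  rewrite /D /lblock block_mxEv row_mx0 -addsmxE adds0mx -[LHS]mxrank_tr tr_row_mx trmx0.
  by rewrite -addsmxE addsmx0 mxrank_tr rank_std.
have hVQ : hdata X D VV QQ.
  split.
  - rewrite /D /lblock /VV mulmx_block !(mulmx0, mul0mx, addr0, add0r) /std mul_row_block.
    by rewrite !(mulmx0, mul0mx, mulmx1, mul1mx, addr0, add0r) row_mx0 block_mx0.
  - rewrite /D /lblock /QQ mulmx_block !(mulmx0, mul0mx, addr0, add0r) /std mul_block_col.
    by rewrite !(mulmx0, mul0mx, mulmx1, mul1mx, addr0, add0r) col_mx0 block_mx0.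
  - rewrite /VV /QQ mulmx_block !(mulmx0, mul0mx, addr0, add0r) !mul_row_col.
    by rewrite !(mulmx0, mul0mx, mulmx1, mul1mx, addr0, add0r) -scalar_mx_block.
  - by rewrite rD; lia.
rewrite (icl_Kpow char0 cXD hVQ) rD; congr (imul _ (icl F _ 0)).
rewrite /VV /X /QQ /lblock !mulmx_block !(mulmx0, mul0mx, addr0, add0r).
rewrite !mul_row_block -[in row_mx _ 0 *m Y](submxK Y) !mul_row_block.
rewrite !(mulmx0, mul0mx, mulmx1, mul1mx, addr0, add0r) !mul_row_col.
by rewrite !(mulmx0, mul0mx, mulmx1, mul1mx, addr0, add0r).
Qed.

Lemma FF_std n a m b : HG_stratum n (std k a m b) =
  (q ^+ (m * a + a * m + m * m + m * b + m * b) * ((gl k m)%:R * gc n m)) *: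
    imul (Kpow k F m) (esum n a b).
Proof.
rewrite /HG_stratum (@sum_std_blocks k F A n a m b (fun B Y X => icl F (lblock B Y X) (lblock 0 (std k a m b) 0))
  (@cnil m) (fun B Y X => imul (Kpow k F m) (icl F (lblock B Y X) 0))); last first.
- by move=> *; exact: icl_std.
- by move=> *; exact: icl_std_eq0.
rewrite /gc mulVKf ?(glr_neq0 k char0) //; congr (_ *: _).
rewrite /esum /ext_sum imul_sumr; apply: eq_bigr => X _.
rewrite imul_sumr; apply: eq_bigr => Y _.
rewrite imul_sumr; apply: eq_bigr => Z _.
by rewrite iscale_imulr.
Qed.

Lemma imul_HG_rank n a b r : (b <= r)%N -> a = (r - b)%N ->
  imul (Hc a) (Gc n b) = \sum_(m < r.+1 | ((m <= a) && (m <= b))%N)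
    gc n m *: imul (Kpow k F m) ((gl k (a - m) * gl k (b - m) * #|k| ^ ((a - m) * (b - m)))%:R^-1 *:
       esum n (a - m) (b - m)).
Proof.
move=> br aE; rewrite imul_HG.
rewrite (partition_big (fun C : 'M[k]_(a, b) => inord (\rank C) : 'I_r.+1)
  (fun m : 'I_r.+1 => (m <= a) && (m <= b))%N) /=; last first.
  move=> C _; rewrite inordK ?rank_leq_row ?rank_leq_col //.
  by rewrite ltnS (leq_trans (rank_leq_col C)).
rewrite scaler_sumr; apply: eq_bigr => m /andP[ma mb].
have rankE (C : 'M[k]_(a, b)) : (inord (\rank C) == m) = (\rank C == m).
  by rewrite -val_eqE /= inordK // ltnS (leq_trans (rank_leq_col C)).
under eq_bigl => C do rewrite rankE.
rewrite iscale_imulr scalerA.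
have [a' aE'] : exists a', a = (a' + m)%N by exists (a - m)%N; rewrite subnK.
have [b' bE'] : exists b', b = (m + b')%N by exists (b - m)%N; rewrite subnKC.
move: (m : nat) {aE rankE ma mb} aE' bE' => {}m aE' bE'; clear br; subst a b; rewrite addnK addKn.
rewrite (eq_bigr (fun _ => HG_stratum n (std k a' m b'))); last first.
  move=> C /eqP rC; have [g [h [gu hu ->]]] := rank_eq_equiv (etrans rC (esym (rank_std k a' m b'))).
  exact: FF_equiv.
rewrite sumr_const -scaler_nat scalerA FF_std scalerA; congr (_ *: _).
have := card_rankset k a' m b'.
have -> : #|rankset k (a' + m) (m + b') m| =
   #|[pred C : 'M[k]_(a' + m, m + b') | \rank C == m]|.
  by apply: eq_card => C; rewrite !inE.
move=> /(congr1 (fun x => x%:R : F)); rewrite !natrM => E.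
have g0 d := glr_neq0 k char0 d.
have q0 : q != 0 := qcard_neq0 k char0.
set R := #|[pred C : 'M[k]_(a' + m, m + b') | \rank C == m]| in E.
have R0 : R%:R != 0 :> F.
  apply/eqP => R0; move: E; rewrite R0 mul0r => /esym/eqP.
  by rewrite mulf_eq0 !(negPf (g0 _)).
rewrite -E -[#|_|]/R !natrX !(mulnDl, mulnDr) !exprD (mulnC a' m).
have qn0 e : q ^+ e != 0 by rewrite expf_neq0.
move: (g0 m) (g0 a') (g0 b') R0 (qn0 (m * a')%N) (qn0 (m * m)%N) (qn0 (m * b')%N) (qn0 (a' * b')%N).
move: (q ^+ _) (q ^+ _) (q ^+ _) (q ^+ _) (R%:R) (gc n m) => x1 x2 x3 x4 x5 x6.
move: (gl k m)%:R (gl k a')%:R (gl k b')%:R => y1 y2 y3 h1 h2 h3 h4 h5 h6 h7 h8.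
by field; rewrite h1 h2 h3 h4 h5 h6 h7 h8.
Qed.

Lemma imul_HG_main n r :
  \sum_(b < r.+1) imul (Hc (r - b)) (Gc n b)
  = \sum_(m < r.+1 | (m.*2 <= r)%N)
      (gc n m * q ^+ (n * (r - m.*2))) *: imul (Kpow k F m) (Hc (r - m.*2)).
Proof.
under eq_bigr => b _ do rewrite (@imul_HG_rank n _ b r) ?leq_ord //.
rewrite (sum_shift_diag (fun m a b => gc n m *: imul (Kpow k F m)
  ((gl k a * gl k b * #|k| ^ (a * b))%:R^-1 *: esum n a b))).
apply: eq_bigr => m mr; set r' := (r - m.*2)%N.
transitivity (gc n m *: imul (Kpow k F m) (\sum_(b < r'.+1)
  (gl k (r' - b) * gl k b * #|k| ^ ((r' - b) * b))%:R^-1 *: esum n (r' - b) b)).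
  by rewrite imul_sumr scaler_sumr.
rewrite /esum (ext_sum_generated char0 icl0_sim icl0_nil n r') /Hc.
set S := \sum_X _; rewrite (iscale_imulr (_ / _)) (iscale_imulr (_^-1)).
by rewrite scalerA scalerA mulrA.
Qed.

End MainIdentity.

Section GeneratingTuples.
Variables (k : finFieldType) (F : fieldType).
Hypothesis char0 : [pchar F] =i pred0.
Local Notation q := (#|k|%:R : F).

Lemma card_row_full n c :
  (#|[set U : 'M[k]_(n, c) | row_full U]|)%:R = \prod_(i < c) (q ^+ n - q ^+ i).
Proof.
elim: c => [|c IH].
  rewrite big_ord0; have -> : [set U : 'M[k]_(n, 0) | row_full U] = [set: 'M_(n, 0)].
    by apply/setP=> U; rewrite !inE /row_full thinmx0 mxrank0.
  by rewrite cardsT card_mx muln0.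
rewrite big_ord_recr /= -IH -sum_bool_card (big_row_mx _ (n1 := 1) (n2 := c)) exchange_big /=.
rewrite -sum_bool_card !natr_sum mulr_suml; apply: eq_bigr => U _.
have [fU|nU] := boolP (row_full U); last first.
  rewrite mul0r big1 // => u _; apply/eqP; rewrite eqb0; apply: contra nU => /row_full_colP inj.
  apply/row_full_colP => w Uw; suff : col_mx (0 : 'cV_1) w = 0.
    by move/eqP; rewrite col_mx_eq0 => /andP[_ /eqP].
  by apply: inj; rewrite [LHS](mul_row_col u U) mulmx0 add0r.
have E (u : 'M_(n, 1)) : row_full (row_mx u U) = (u \notin [set U *m w | w : 'cV_c]).
  apply/row_full_colP/negP => [inj /imsetP[w _ uE]|nu w].
    have : col_mx (1%:M : 'cV_1) (- w) = 0.
      by apply: inj; rewrite [LHS](mul_row_col u U) mulmx1 mulmxN -uE subrr.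
    by move/eqP; rewrite col_mx_eq0 => /andP[/eqP/matrixP/(_ 0 0)]; rewrite !mxE => /eqP; rewrite oner_eq0.
  rewrite -[w](@vsubmxK _ 1 c) (mul_row_col u U); set w1 := usubmx _; set w2 := dsubmx _ => E.
  have w1E : w1 = (w1 0 0)%:M by rewrite [LHS]mx11_scalar.
  have w10 : w1 0 0 = 0.
    apply/eqP/negP=> /negP w10; case: nu; apply/imsetP; exists (- (w1 0 0)^-1 *: w2); first by [].
    move/eqP: E; rewrite addr_eq0 [X in u *m X]w1E -scalemx1 -scalemxAr mulmx1 => /eqP E.
    by rewrite -scalemxAr scaleNr -scalerN -E scalerA mulVf ?scale1r.
  have w1z : w1 = 0 by rewrite w1E w10 -scalemx1 scale0r.
  move: E; rewrite w1z mulmx0 add0r => Uw.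
  by rewrite (row_full_colP U fU _ Uw) col_mx0.
under eq_bigr => u _ do rewrite E.
rewrite sum_bool_card mul1r.
have cI : #|[set U *m w | w : 'cV_c]| = (#|k| ^ c)%N.
  rewrite card_imset ?cardsT ?card_mx ?muln1 //; exact: row_full_inj.
have -> : [set u : 'M_(n, 1) | u \notin [set U *m w | w : 'cV_c]] = ~: [set U *m w | w : 'cV_c].
  by apply/setP => u; rewrite !inE.
have := cardsC [set U *m w | w : 'cV_c]; rewrite cI card_mx muln1 => /(congr1 (fun x => x%:R : F)).
by rewrite natrD !natrX => <-; rewrite addrC addKr.
Qed.

Definition spoly d c : {poly F} := 'X^(d - c) * \prod_(i < c) ('X - (q ^+ i)%:P).

Lemma ngen_spoly n d (X : 'M[k]_d) : (ngen n X)%:R = (spoly d (d - \rank X)).[q ^+ n].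
Proof.
have := rank_leq_row X; set r := \rank X => rd.
have [c dE] : exists c, d = (r + c)%N by exists (d - r)%N; rewrite subnKC.
move: (erefl r) rd; rewrite {1}/r; move: r dE => r dE; subst d => rX _.
rewrite addKn /spoly addnK hornerM hornerXn horner_prod.
pose P : 'M[k]_(r + c) := block_mx 1%:M 0 0 0.
have rP : \rank P = r by rewrite /P rank_diag_block_mx mxrank1 mxrank0 addn0.
have [g [h [gu hu ->]]] := rank_eq_equiv (etrans rX (esym rP)).
rewrite ngen_equiv // /ngen -sum_bool_card big_row_mx.
have E (U1 : 'M[k]_(n, r)) (U2 : 'M[k]_(n, c)) : row_full (col_mx (row_mx U1 U2) P) = row_full U2.
  apply/row_full_colP/row_full_colP => inj w.
    move=> Uw; suff : col_mx (0 : 'cV_r) w = 0 by move/eqP; rewrite col_mx_eq0 => /andP[_ /eqP].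
    apply: inj; rewrite mul_col_mx mul_row_col mul_block_col !mulmx0 !mul0mx !add0r Uw.
    by rewrite !col_mx0.
  rewrite -[w]vsubmxK mul_col_mx mul_row_col mul_block_col !mul0mx !addr0 mul1mx => /eqP.
  rewrite !col_mx_eq0 => /and3P[/eqP Uw /eqP w0 _]; move: Uw; rewrite w0 mulmx0 add0r => /inj ->.
  exact: col_mx0.
transitivity ((\sum_(U1 : 'M[k]_(n, r)) \sum_(U2 : 'M[k]_(n, c)) row_full U2)%N%:R : F).
  by congr _%:R; apply: eq_bigr => U1 _; apply: eq_bigr => U2 _; rewrite E.
rewrite sum_nat_const sum_bool_card natrM card_row_full card_mx natrX exprM; congr (_ * _).
by apply: eq_bigr => i _; rewrite hornerXsubC.
Qed.

End GeneratingTuples.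

(** * Interpolation in T *)

Section PolyForm.
Variables (F : fieldType) (V : lmodType F).

Lemma qpoly_zero (Q : F) (a : nat -> V) N :
  (forall i j, Q ^+ i = Q ^+ j -> i = j) ->
  (forall n, \sum_(j < N) (Q ^+ n) ^+ j *: a j = 0) -> forall j, (j < N)%N -> a j = 0.
Proof.
move=> Qinj; elim: N a => [//|N IH] a E.
have a0 j : (j < N)%N -> a j = 0.
  move=> jN; have QjN : Q ^+ j - Q ^+ N != 0.
    by rewrite subr_eq0; apply/eqP => /Qinj jE; rewrite jE ltnn in jN.
  apply: (scalerI QjN); rewrite scaler0.
  apply: (IH (fun j => (Q ^+ j - Q ^+ N) *: a j)) jN => n.
  transitivity (\sum_(j < N) (Q ^+ n.+1) ^+ j *: a j - Q ^+ N *: \sum_(j < N) (Q ^+ n) ^+ j *: a j).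
    rewrite scaler_sumr -sumrB; apply: eq_bigr => i _; rewrite !scalerA -scalerBl exprS exprMn.
    by rewrite mulrBr; congr ((_ - _) *: _); exact: mulrC.
  have := E n; have := E n.+1; rewrite !big_ord_recr /=.
  move=> /eqP; rewrite addr_eq0 => /eqP -> /eqP; rewrite addr_eq0 => /eqP ->.
  by rewrite scalerN opprK scalerA exprS exprMn addNr.
move=> j; rewrite ltnS leq_eqVlt => /orP[/eqP ->|]; last exact: a0.
have := E 0%N; rewrite big_ord_recr /= big1 ?add0r => [|i _]; first by rewrite expr0 expr1n scale1r.
by rewrite a0 ?scaler0.
Qed.

(* The shape of an expression that is linear in a functional psi on
   polynomials: it is determined by the functionals p |-> p.[Q ^+ n]. *)
Definition polyform (Phi : ({poly F} -> F) -> V) :=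
  exists s : seq ({poly F} * V), forall psi, Phi psi = \sum_(t <- s) psi t.1 *: t.2.

Lemma polyform_base p v : polyform (fun psi => psi p *: v).
Proof. by exists [:: (p, v)] => psi; rewrite big_seq1. Qed.

Lemma polyform_sum I (r : seq I) (P : pred I) (Phi : I -> ({poly F} -> F) -> V) :
  (forall i, polyform (Phi i)) -> polyform (fun psi => \sum_(i <- r | P i) Phi i psi).
Proof.
move=> h; elim: r => [|i r [s sE]]; first by exists [::] => psi; rewrite !big_nil.
have [s' s'E] := h i; case: (boolP (P i)) => Pi.
  by exists (s' ++ s) => psi; rewrite big_cons Pi big_cat s'E sE.
by exists s => psi; rewrite big_cons (negPf Pi) sE.
Qed.

Lemma polyform_interp (Q : F) Phi : (forall i j, Q ^+ i = Q ^+ j -> i = j) ->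
  polyform Phi -> (forall n, Phi (fun p => p.[Q ^+ n]) = 0) ->
  forall psi : {poly F} -> F, linear_for *%R psi -> Phi psi = 0.
Proof.
move=> Qinj [s sE] Phi0 psi psi_lin.
pose N := (\max_(t <- s) size t.1)%N.
have sN t : t \in s -> (size t.1 <= N)%N.
  by move=> ts; rewrite /N (big_rem t) //= leq_maxl.
pose a j := \sum_(t <- s) t.1`_j *: t.2.
have a0 j : (j < N)%N -> a j = 0.
  apply: (qpoly_zero Qinj) => n.
  transitivity (Phi (fun p => p.[Q ^+ n])); last exact: Phi0.
  rewrite sE /a.
  rewrite (eq_bigr (fun j : 'I_N => \sum_(t <- s) (Q ^+ n) ^+ j *: (t.1`_j *: t.2))); last first.
    by move=> i _; rewrite scaler_sumr.
  rewrite exchange_big /= big_seq [RHS]big_seq; apply: eq_bigr => t ts.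
  rewrite (horner_coef_wide _ (sN t ts)) scaler_suml; apply: eq_bigr => i _.
  by rewrite scalerA mulrC.
have psi0 : psi 0 = 0.
  by have := psi_lin (-1) 0 0; rewrite scaler0 addr0 mulN1r addNr.
have psiE t : t \in s -> psi t.1 = \sum_(j < N) t.1`_j * psi 'X^j.
  move=> ts; have {1}-> : t.1 = \sum_(j < N) t.1`_j *: 'X^j.
    rewrite -poly_def; apply/polyP => j; rewrite coef_poly; case: ltnP => // Nj.
    by rewrite nth_default // (leq_trans (sN t ts)).
  elim: (N) => [|M IH]; first by rewrite !big_ord0.
  by rewrite !big_ord_recr /= [X in psi X]addrC psi_lin IH [RHS]addrC.
rewrite sE (eq_big_seq (fun t : {poly F} * V => \sum_(j < N) psi 'X^j *: (t.1`_j *: t.2))).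
  by rewrite exchange_big big1 // => j _; rewrite -scaler_sumr [X in _ *: X]a0 ?scaler0.
move=> t ts; rewrite (psiE t ts) scaler_suml; apply: eq_bigr => j _.
by rewrite scalerA mulrC.
Qed.

End PolyForm.

Lemma polyform_lin (F : fieldType) (V W : lmodType F) (f : V -> W) Phi :
  (forall a x y, f (a *: x + y) = a *: f x + f y) -> polyform Phi -> polyform (fun psi => f (Phi psi)).
Proof.
move=> fl [s sE]; exists [seq (t.1, f t.2) | t <- s] => psi; rewrite sE big_map.
have f0 : f 0 = 0 by have := fl (-1) 0 0; rewrite scaler0 addr0 scaleN1r addNr.
elim: s {sE} => [|t s IH]; first by rewrite !big_nil.
by rewrite !big_cons fl IH.
Qed.

Lemma polyformB (F : fieldType) (V : lmodType F) (Phi Psi : ({poly F} -> F) -> V) :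
  polyform Phi -> polyform Psi -> polyform (fun psi => Phi psi - Psi psi).
Proof.
move=> [s sE] [s' s'E]; exists (s ++ [seq (t.1, - t.2) | t <- s']) => psi.
rewrite big_cat big_map sE s'E -sumrN; congr (_ + _).
by apply: eq_bigr => t _; rewrite scalerN.
Qed.

Section Functionals.
Variables (k : finFieldType) (F : fieldType).
Hypothesis char0 : [pchar F] =i pred0.
Local Notation q := (#|k|%:R : F).
Local Notation A := (iHall k F).

Lemma natr_inj (m n : nat) : m%:R = n%:R :> F -> m = n.
Proof.
suff h a b : (a <= b)%N -> a%:R = b%:R :> F -> a = b.
  by case: (leqP m n) => [|/ltnW] mn E; [exact: h | apply/esym/h].
move=> ab E; have : (b - a)%:R = 0 :> F by rewrite natrB // E subrr.
by move/eqP; rewrite (pcharf0P _).1 // subn_eq0 => ba; apply/eqP; rewrite eqn_leq ab.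
Qed.

Lemma card_field_gt1 : (1 < #|k|)%N.
Proof.
have -> : 2%N = #|[set 0; 1 : k]| by rewrite cards2 eq_sym oner_neq0.
exact: max_card.
Qed.

Lemma qcard_inj i j : q ^+ i = q ^+ j -> i = j.
Proof. by rewrite -!natrX => /natr_inj; exact: expnI card_field_gt1 _ _. Qed.

Definition spolyX d (X : 'M[k]_d) := spoly k F d (d - \rank X).

(* For psi the evaluation at q ^ n these are [Gc n] and, up to the factor
   [q ^ (n e)], [gc n]. *)
Definition Gpsi (psi : {poly F} -> F) b : A :=
  (gl k b)%:R^-1 *: \sum_(X : 'M[k]_b) psi (spolyX X) *: icl F X 0.

Definition gpsi (psi : {poly F} -> F) m e : F :=
  (gl k m)%:R^-1 * \sum_(I : 'M[k]_m) cnil F I * psi (spolyX I * 'X^e).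

Definition hc r : F := (gl k r)%:R^-1 * \sum_(X : 'M[k]_r) cnil F X.

Lemma imul_HG_psi (psi : {poly F} -> F) r : linear_for *%R psi ->
  \sum_(b < r.+1) imul (Hc k F (r - b)) (Gpsi psi b)
  = \sum_(m < r.+1 | (m.*2 <= r)%N) gpsi psi m (r - m.*2) *: imul (Kpow k F m) (Hc k F (r - m.*2)).
Proof.
move=> psil; apply/eqP; rewrite -subr_eq0; apply/eqP.
apply: (polyform_interp (Q := q) (Phi := fun psi =>
  \sum_(b < r.+1) imul (Hc k F (r - b)) (Gpsi psi b) -
  \sum_(m < r.+1 | (m.*2 <= r)%N) gpsi psi m (r - m.*2) *: imul (Kpow k F m) (Hc k F (r - m.*2)))
  qcard_inj _ _ psil).
  apply: polyformB; apply: polyform_sum => i.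
    apply: (polyform_lin (f := imul (Hc k F (r - i)))); first by move=> a x y; exact: imul_linr.
    apply: (polyform_lin (f := fun x => _ *: x)).
      by move=> a x y; rewrite scalerDr !scalerA mulrC.
    by apply: polyform_sum => X; exact: polyform_base.
  apply: (polyform_lin (V := F^o) (f := fun x : F^o => x *: _)).
    by move=> a x y; rewrite scalerDl scalerA.
  apply: (polyform_lin (V := F^o) (f := fun x : F^o => _ * x : F^o)).
    by move=> a x y; rewrite mulrDr mulrCA.
  apply: polyform_sum => X.
  apply: (polyform_lin (V := F^o) (f := fun x : F^o => _ * x : F^o)).
    by move=> a x y; rewrite mulrDr mulrCA.
  have := polyform_base (V := F^o) (spolyX X * 'X^(r - i.*2)) 1.
  by case=> s sE; exists s => p; rewrite -sE /= [RHS]mulr1.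
move=> n; apply/eqP; rewrite subr_eq0; apply/eqP.
have GE b : Gpsi (fun p => p.[q ^+ n]) b = Gc k F n b.
  by congr (_ *: _); apply: eq_bigr => X _; rewrite /spolyX -ngen_spoly.
under eq_bigr => b _ do rewrite GE.
rewrite (imul_HG_main k char0); apply: eq_bigr => m _; apply: (congr1 (fun x => x *: _)).
rewrite /gpsi /gc -mulrA; congr (_ * _); rewrite mulr_suml; apply: eq_bigr => I _.
by rewrite hornerM hornerXn -ngen_spoly // mulrA exprM.
Qed.

Lemma cnil_sim d1 d2 (X : 'M[k]_d1) (X' : 'M[k]_d2) : sim X 0 X' 0 -> cnil F X = cnil F X'.
Proof.
move=> s; rewrite /cnil; congr (nat_of_bool _)%:R; apply: asbool_equiv_eq.
have cc d (Y : 'M[k]_d) : (exists r, Y ^+ r = 0) -> cplxP Y 0.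
  by split; rewrite ?mulmx0 ?mul0mx.
by split=> /cc h; [have [] := sim_cplxP (sim_sym s) h | have [] := sim_cplxP s h].
Qed.

Lemma cnil_nil d (X : 'M[k]_d) : ~ (exists s, X ^+ s = 0) -> cnil F X = 0.
Proof. by move=> nX; rewrite /cnil asboolF. Qed.

Lemma hc_psi (psi : {poly F} -> F) r : linear_for *%R psi ->
  \sum_(b < r.+1) hc (r - b) * gpsi psi b 0 = psi 'X^r * hc r.
Proof.
move=> psil; apply/eqP; rewrite -subr_eq0; apply/eqP.
apply: (polyform_interp (V := F^o) (Q := q) (Phi := fun psi =>
  \sum_(b < r.+1) hc (r - b) * gpsi psi b 0 - psi 'X^r * hc r) qcard_inj _ _ psil).
  apply: (polyformB (V := F^o)); last exact: (polyform_base (V := F^o)).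
  apply: (polyform_sum (V := F^o)) => i.
  apply: (polyform_lin (V := F^o) (f := fun x : F^o => _ * x : F^o)).
    by move=> a x y; rewrite mulrDr mulrCA.
  apply: (polyform_lin (V := F^o) (f := fun x : F^o => _ * x : F^o)).
    by move=> a x y; rewrite mulrDr mulrCA.
  apply: (polyform_sum (V := F^o)) => X.
  apply: (polyform_lin (V := F^o) (f := fun x : F^o => _ * x : F^o)).
    by move=> a x y; rewrite mulrDr mulrCA.
  have := polyform_base (V := F^o) (spolyX X * 'X^0) 1.
  by case=> s sE; exists s => p; rewrite -sE /= [RHS]mulr1.
move=> n; apply/eqP; rewrite subr_eq0; apply/eqP.
rewrite hornerXn -exprM.
transitivity ((q ^+ (n * r) / (gl k r)%:R) * \sum_(X : 'M[k]_r) cnil F X); last first.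
  by rewrite /hc mulrA.
apply: etrans (ext_sum_generated (V := F^o) char0 cnil_sim cnil_nil n r).
apply: eq_bigr => b _; rewrite /hc /gpsi.
transitivity ((gl k (r - b) * gl k b * #|k| ^ ((r - b) * b))%:R^-1 *
  (q ^+ ((r - b) * b) * ((\sum_(X : 'M[k]_(r - b)) cnil F X) *
     \sum_(I : 'M[k]_b) cnil F I * (spolyX I * 'X^0).[q ^+ n]))).
  rewrite !natrM natrX !invfM; have h := expf_neq0 ((r - b) * b) (qcard_neq0 k char0).
  move: (q ^+ _) h => x h; set S1 := \sum_X _; set S2 := \sum_I _.
  have := glr_neq0 k char0 b; have := glr_neq0 k char0 (r - b) => h1 h2.
  by field; rewrite h h1 h2.
congr (_ * _); rewrite /ext_sum mulr_suml mulr_sumr; apply: eq_bigr => X _.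
rewrite !mulr_sumr; apply: eq_bigr => I _.
have -> : (spolyX I * 'X^0).[q ^+ n] = (ngen n I)%:R.
  by rewrite expr0 mulr1 -ngen_spoly.
have lE Y : cnil F (lblock I Y X) = cnil F X * cnil F I.
  rewrite /cnil -natrM mulnb; congr (nat_of_bool _)%:R.
  apply/asboolP/andP => [/lblock_nil[hI hX]|[/asboolP hX /asboolP hI]].
    by split; apply/asboolP.
  exact/lblock_nil.
under eq_bigr => Y _ do rewrite lE.
rewrite sumr_const card_mx -[RHS]mulr_natl natrX; congr (_ * _).
by rewrite mulrA; exact: mulrC.
Qed.

End Functionals.

Import classical_sets fsbigop.

(** * Specialisations *)

Section SumOverPartitions.
Variables (k : finFieldType) (F : fieldType) (V : lmodType F).
Hypothesis char0 : [pchar F] =i pred0.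
Variable c : forall d, 'M[k]_d -> V.
Hypothesis c_sim : forall d1 d2 (X : 'M[k]_d1) (X' : 'M[k]_d2), sim X 0 X' 0 -> c X = c X'.
Hypothesis c_nil : forall d (X : 'M[k]_d), ~ (exists s, X ^+ s = 0) -> c X = 0.

Lemma card_sim (M : nrep k) r : ndim M = r ->
  (#|[set X : 'M[k]_r | sim X 0 (nmx M) 0]| * nrep_aut_card M = gl k r)%N.
Proof.
case: M => d x nx /= dr; subst r; rewrite /nrep_aut_card /gl /nrep_hom /=.
pose f (g : 'M[k]_d) := g *m x *m invmx g.
rewrite -[RHS]sum1_card (partition_big f (mem [set X : 'M[k]_d | sim X 0 x 0])) /=; last first.
  move=> g; rewrite !inE => gu; apply/simP; exists g, (invmx g).
  by rewrite mulmxV // mulVmx // /f mulmxKV // mulmx0 mul0mx.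
rewrite -sum_nat_const; apply: eq_bigr => X; rewrite inE => /simP[g0 [h0 [gh hg Xg _]]].
have g0u : g0 \in unitmx by case: (mulmx1_unit gh).
rewrite sum1_card -[LHS](card_imset (f := fun g : 'M[k]_d => g0 *m g)); last exact: (can_inj (mulKmx g0u)).
apply: eq_card => g; apply/imsetP/idP => [[h]|].
  rewrite inE => /andP[/eqP xh hu] ->.
  suff : (g0 *m h \in [set g | g \in unitmx]) && (f (g0 *m h) == X) by [].
  rewrite inE unitmx_mul g0u hu /f /= -(mulmxA g0) -xh mulmxA -Xg -(mulmxA X) mulmxK //.
  by rewrite unitmx_mul g0u.
move=> gP; have : (g \in [set g | g \in unitmx]) && (f g == X) := gP.
rewrite inE => /andP[gu /eqP fg]; exists (invmx g0 *m g); last by rewrite mulKVmx.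
have xX : x *m invmx g0 = invmx g0 *m X.
  by apply: (can_inj (mulKmx g0u)); rewrite !mulmxA -Xg mulmxK // mulmxV // mul1mx.
have gx : g *m x = X *m g by rewrite -fg /f mulmxKV.
rewrite inE unitmx_mul unitmx_inv g0u gu !andbT /=; apply/eqP.
transitivity (invmx g0 *m (X *m g)); first by rewrite mulmxA xX -mulmxA.
by rewrite -gx mulmxA.
Qed.

Lemma partitionsP r l : partitions r l <-> is_part l /\ sumn l = r.
Proof.
rewrite /partitions /is_part /=; split=> [/and3P[-> -> /eqP]|[/andP[-> ->] ->]] //=.
Qed.

Lemma Spart_cast r l : sumn l = r -> exists X : 'M[k]_r, sim X 0 (nmx (Spart k l)) 0.
Proof. by rewrite -(ndim_Spart k) => <-; exists (nmx (Spart k l)); exact: sim_refl. Qed.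

Lemma sum_partitions r (f : nat -> F) :
  \sum_(l \in partitions r)
     f (size l) *: ((nrep_aut_card (Spart k l))%:R^-1 *: c (nmx (Spart k l)))
  = (gl k r)%:R^-1 *: \sum_(X : 'M[k]_r) f (r - \rank X)%N *: c X.
Proof.
have /choice[lam lamP] : forall X : 'M[k]_r, exists l, (exists s, X ^+ s = 0) ->
    [/\ is_part l, sumn l = r & sim X 0 (nmx (Spart k l)) 0].
  move=> X; have [[s /nil_jordan[l [pl _ sl Xl]]]|nX] := pselect (exists s, X ^+ s = 0).
    by exists l.
  by exists [::].
pose nilb (X : 'M[k]_r) := `[< exists s, X ^+ s = 0 >].
pose S := undup [seq lam X | X <- enum 'M[k]_r & nilb X].
have lamS l (X : 'M[k]_r) : is_part l -> sim X 0 (nmx (Spart k l)) 0 -> nilb X /\ lam X = l.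
  move=> pl s; have nX : exists s, X ^+ s = 0.
    by have [] := sim_cplxP s (d2 := ndim (Spart k l)); first by
      split; [exact: nmx_nil | rewrite mulmx0 mul0mx | rewrite mulmx0].
  split; first exact/asboolP.
  have [pl' _ s'] := lamP X nX; apply: (Spart_inj (k := k)) => //.
  exact: sim_trans (sim_sym s') s.
have -> : partitions r = [set` S]%classic.
  apply/seteqP; split=> l /=; rewrite mem_undup.
    move/partitionsP=> [pl sl]; have [X XS] := Spart_cast sl.
    have [nX <-] := lamS l X pl XS; apply/mapP; exists X => //.
    by rewrite mem_filter nX mem_enum.
  case/mapP=> X; rewrite mem_filter => /andP[/asboolP nX _] ->.
  by apply/partitionsP; have [] := lamP X nX.
rewrite -fsbig_seq ?undup_uniq //.
rewrite (bigID nilb) /= [X in _ *: (_ + X)]big1 ?addr0; last first.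
  by move=> X /asboolP nX; rewrite c_nil ?scaler0.
rewrite scaler_sumr.
transitivity (\sum_(l <- S) \sum_(X : 'M[k]_r | nilb X && (lam X == l))
    (gl k r)%:R^-1 *: (f (r - \rank X)%N *: c X)); last first.
  under eq_bigr => l _ do rewrite big_mkcondr.
  rewrite exchange_big /=; apply: eq_bigr => X nX; rewrite -big_mkcond /=.
  rewrite -big_filter; have -> : [seq l <- S | lam X == l] = [:: lam X].
    rewrite (eq_filter (a2 := pred1 (lam X))) => [|l]; last by rewrite /= eq_sym.
    rewrite filter_pred1_uniq ?undup_uniq // mem_undup; apply/mapP; exists X => //.
    by rewrite mem_filter nX mem_enum.
  by rewrite big_seq1.
apply: eq_big_seq => l; rewrite mem_undup => /mapP[X0]; rewrite mem_filter => /andP[/asboolP nX0 _].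
have [pl sl s0] := lamP X0 nX0 => lE; rewrite -lE in pl sl s0.
have dl : ndim (Spart k l) = r by rewrite ndim_Spart.
rewrite (eq_bigr (fun _ => (gl k r)%:R^-1 *: (f (size l) *: c (nmx (Spart k l))))); last first.
  move=> X /andP[/asboolP /lamP[_ _ s] /eqP lX]; rewrite lX in s.
  rewrite (c_sim s) (sim_rank s); congr (_ *: (f _ *: _)).
  by rewrite -(corank_Spart k pl); move: (\rank _) => rk; rewrite dl.
rewrite sumr_const -scaler_nat !scalerA.
have -> : #|[pred X | nilb X & lam X == l]| = #|[set X : 'M[k]_r | sim X 0 (nmx (Spart k l)) 0]|.
  apply: eq_card => X; rewrite !inE; apply/andP/idP => [[/asboolP /lamP[_ _ s] /eqP lX]|].
    by rewrite lX in s.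
  by case/(lamS l X pl) => nX ->.
have := card_sim dl => /(congr1 (fun x => x%:R : F)); rewrite natrM => E.
have g0 := glr_neq0 k char0 r; congr (_ *: _); rewrite -E invfM.
move: g0; rewrite -E mulf_eq0 negb_or => /andP[h1 h2].
by move: (_%:R) (_%:R) h1 h2 => x y h1 h2; field; rewrite h1 h2.
Qed.

End SumOverPartitions.

Section HatSeries.
Variables (k : finFieldType) (F : fieldType).
Hypothesis char0 : [pchar F] =i pred0.
Local Notation q := (#|k|%:R : F).
Local Notation A := (iHall k F).

Lemma icl_stalk (M : nrep k) : icl F (nmx M) 0 = scls F M.
Proof. exact: (icl_cplx F (stalk M)). Qed.

Lemma scls_sim (M N : nrep k) : sim (nmx M) 0 (nmx N) 0 -> scls F M = scls F N.
Proof. by rewrite -!icl_stalk => /(@icl0_sim k F). Qed.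

Lemma Gpsi_partitions (psi : {poly F} -> F) r : Gpsi k psi r =
  \sum_(l \in partitions r) psi (spoly k F r (size l)) *: scls_aut F (Spart k l).
Proof.
rewrite /Gpsi -(sum_partitions char0 (@icl0_sim k F) (@icl0_nil k F) r (fun c => psi (spoly k F r c))).
by apply: eq_fsbigr => l _; rewrite icl_stalk.
Qed.

Lemma gpsi_partitions (psi : {poly F} -> F) r : gpsi k psi r 0 =
  \sum_(l \in partitions r) psi (spoly k F r (size l)) / (nrep_aut_card (Spart k l))%:R.
Proof.
have := sum_partitions (V := F^o) char0 (@cnil_sim k F) (@cnil_nil k F) r (fun c => psi (spoly k F r c)).
rewrite /gpsi => E; transitivity ((gl k r)%:R^-1 *:
    \sum_(X : 'M[k]_r) psi (spoly k F r (r - \rank X)) *: (cnil F X : F^o)).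
  by congr (_ * _); apply: eq_bigr => X _; rewrite expr0 mulr1; exact: mulrC.
rewrite -E; apply: eq_fsbigr => l _; rewrite /cnil asboolT; last exact: nmx_nil.
by congr (_ * _); exact: mulr1.
Qed.

Lemma Hhat_Hc r : Hhat r = Hc k F r.
Proof.
have := sum_partitions char0 (@icl0_sim k F) (@icl0_nil k F) r (fun _ => 1).
rewrite /Hc /Hhat; under [in RHS]eq_bigr => X _ do rewrite scale1r.
by move=> <-; apply: eq_fsbigr => l _; rewrite icl_stalk scale1r.
Qed.

Lemma fsbig_single (T : choiceType) (V : zmodType) (B : set T) x0 (f : T -> V) :
  B x0 -> (forall x, B x -> x <> x0 -> f x = 0) -> \sum_(x \in B) f x = f x0.
Proof.
move=> Bx0 f0; rewrite -(fsbig_widen [set x0]%classic B) ?fsbig_set1 //.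
- by move=> x ->.
- by move=> x [Bx nx]; exact: f0.
Qed.

Lemma size_partition r l : partitions r l -> (size l <= r)%N.
Proof.
move=> /partitionsP[/andP[_ pos] <-]; elim: l pos => //= n l IH /andP[n0 /IH]; lia.
Qed.

Lemma partitions_ones r : partitions r (nseq r 1%N).
Proof.
apply/partitionsP; rewrite /is_part; split; last by rewrite sumn_nseq mul1n.
rewrite all_nseq leqnn orbT andbT; case: r => // r /=.
by elim: r => //= r IH; rewrite leqnn.
Qed.

Lemma size_partition_max r l : partitions r l -> size l = r -> l = nseq r 1%N.
Proof.
move=> /partitionsP[/andP[_ pos] <-] {r}; elim: l pos => //= n l IH /andP[n0 pos] E.
have sl : (size l <= sumn l)%N.
  by elim: l pos {IH E} => //= m l IH /andP[m0 /IH]; lia.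
have n1 : n = 1%N by lia.
by rewrite n1 add1n /= -IH //; lia.
Qed.

(* The three specialisations of T = q ^ n, giving E(-z), Theta and P. *)
Definition ev0 (p : {poly F}) := p.[0].
Definition evq (p : {poly F}) := p.[q].
Definition dev1 (p : {poly F}) := p^`().[1].

Lemma ev0_lin : linear_for *%R ev0.
Proof. by move=> a x y; rewrite /ev0 hornerD hornerZ. Qed.
Lemma evq_lin : linear_for *%R evq.
Proof. by move=> a x y; rewrite /evq hornerD hornerZ. Qed.
Lemma dev1_lin : linear_for *%R dev1.
Proof. by move=> a x y; rewrite /dev1 derivD derivZ hornerD hornerZ. Qed.

Lemma ev0_spoly r c : (c < r)%N -> ev0 (spoly k F r c) = 0.
Proof.
move=> cr; rewrite /ev0 /spoly hornerM hornerXn expr0n subn_eq0 leqNgt cr.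
exact: mul0r.
Qed.

Lemma ev0_spoly_full r : ev0 (spoly k F r r) = \prod_(i < r) - q ^+ i.
Proof.
rewrite /ev0 /spoly subnn expr0 mul1r horner_prod; apply: eq_bigr => i _.
by rewrite hornerXsubC sub0r.
Qed.

Lemma Gpsi_ev0 (v : F) r : v ^+ 2 = q -> Gpsi k ev0 r = (-1) ^+ r *: Ehat v r.
Proof.
move=> vq; rewrite Gpsi_partitions (fsbig_single (partitions_ones r)) => [|l pl ne].
  rewrite size_nseq ev0_spoly_full /Ehat.
  have -> : \prod_(i < r) - q ^+ i = (-1) ^+ r * v ^+ (r * r.-1).
    elim: r => [|r IH]; first by rewrite big_ord0 mul0n !expr0 mulr1.
    rewrite big_ord_recr /= IH exprS mulN1r mulrN !mulNr; congr (- _).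
    rewrite -vq -exprM -mulrA -exprD; congr (_ * _ ^+ _).
    by case: r {IH} => //= r; lia.
  by rewrite -scalerA.
rewrite ev0_spoly ?scale0r // ltn_neqAle size_partition // andbT.
by apply/eqP => /(size_partition_max pl).
Qed.

Lemma glE m : (gl k m)%:R = \prod_(i < m) (q ^+ m - q ^+ i).
Proof.
rewrite -(card_row_full k F); congr (_%:R); apply: eq_card => g.
by rewrite !inE row_full_unit.
Qed.

Lemma gpsi_ev0 m e : gpsi k ev0 m e = if e == 0%N then (phiq k F m)^-1 else 0.
Proof.
rewrite /gpsi; case: (posnP e) => [->|e0]; last first.
  rewrite big1 ?mulr0 // => I _.
  by rewrite /ev0 hornerM hornerXn expr0n gtn_eqF // !mulr0.
rewrite (bigD1 0) //= [X in _ + X]big1 ?addr0 => [|I I0]; last first.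
  rewrite expr0 mulr1 ev0_spoly ?mulr0 //; have := rank_leq_row I.
  by move: I0; rewrite -mxrank_eq0; lia.
rewrite /spolyX mxrank0 subn0 expr0 mulr1 ev0_spoly_full /cnil asboolT; last by exists 1%N; rewrite expr1.
rewrite mul1r; have := glr_neq0 k char0 m.
have -> : (gl k m)%:R = (\prod_(i < m) - q ^+ i) * phiq k F m.
  rewrite glE /phiq big_add1 /= big_mkord (reindex_inj rev_ord_inj (P := xpredT) (F := fun i : 'I_m => 1 - _)) /=.
  rewrite -big_split; apply: eq_bigr => i _ /=; rewrite subnSK // mulrBr mulr1 mulNr -exprD.
  by rewrite subnKC 1?ltnW // opprK addrC.
rewrite mulf_eq0 negb_or => /andP[h1 h2]; rewrite invfM mulrC mulrA.
by rewrite divff ?mul1r.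
Qed.

Lemma gpsi_evq m e : gpsi k evq m e = gpsi k evq m 0 * q ^+ e.
Proof.
rewrite /gpsi -mulrA; congr (_ * _); rewrite mulr_suml; apply: eq_bigr => I _.
by rewrite /evq !hornerM !hornerXn expr0 mulr1 mulrA.
Qed.

Lemma evq_spoly r c : (1 < c)%N -> evq (spoly k F r c) = 0.
Proof.
move=> c1; rewrite /evq /spoly hornerM horner_prod (bigD1 (Ordinal c1)) //=.
by rewrite hornerXsubC expr1 subrr mul0r mulr0.
Qed.

Lemma Gpsi_evq r : Gpsi k evq r = gpsi k evq r 0 *: Thetahat r.
Proof.
pose l0 := if r is 0 then [::] else [:: r].
have p0 : partitions r l0.
  by apply/partitionsP; rewrite /l0; case: r {l0} => //= r; rewrite addn0.
have one l : partitions r l -> l <> l0 -> evq (spoly k F r (size l)) = 0.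
  move=> /partitionsP[/andP[_ pos] sl] ne; apply: evq_spoly.
  case: l pos sl ne => [|n [|m l]] //= pos sl; first by rewrite /l0 -sl.
  by rewrite /l0 -sl addn0; case: n pos {sl}.
rewrite Gpsi_partitions gpsi_partitions !(fsbig_single p0); last 2 first.
- by move=> l pl ne; rewrite one ?mul0r.
- by move=> l pl ne; rewrite one ?scale0r.
rewrite -scalerA; congr (_ *: (_ *: _)); apply: scls_sim; rewrite /l0; case: r {l0 p0 one} => [|r].
  exact: sim_refl.
apply/simP; exists (col_mx 1%:M 0), (row_mx 1%:M 0).
rewrite mul_row_col mul_col_row mul0mx !mulmx0 !mul0mx mulmx1 addr0 mul_block_col mul_col_mx.
rewrite !mulmx0 !mul0mx !mulmx1 mul1mx addr0 add0r; split=> //.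
by rewrite (scalar_mx_block r.+1 0) (thinmx0 (1%:M : 'M[k]_0)).
Qed.

Lemma dev1_spoly r c : (0 < c)%N -> dev1 (spoly k F r c) = phiq k F c.-1.
Proof.
case: c => // c _; rewrite /dev1 /spoly big_ord_recl /= expr0 mulrCA derivM derivXsubC mul1r.
rewrite hornerD !hornerM hornerXsubC subrr mul0r addr0 hornerXn expr1n mul1r horner_prod.
by rewrite /phiq big_add1 /= big_mkord; apply: eq_bigr => i _; rewrite hornerXsubC.
Qed.

Lemma Gpsi_dev1 r : Gpsi k dev1 r = if r == 0%N then 0 else Phat r.
Proof.
rewrite Gpsi_partitions; case: (posnP r) => [->|r0].
  rewrite (fsbig_single (partitions_ones 0)) => [|l /size_partition]; last by case: l.
  by rewrite /dev1 /spoly big_ord0 mulr1 expr0 derivC horner0 scale0r.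
apply: eq_fsbigr => l; rewrite inE => /partitionsP[_ sl].
by rewrite dev1_spoly //; case: l sl => //= r0'; rewrite -r0' in r0.
Qed.

Lemma gpsi_dev1 m e : gpsi k dev1 m e = gpsi k dev1 m 0 + (if m == 0%N then e%:R else 0).
Proof.
rewrite /gpsi; case: (posnP m) => [->|m0]; last first.
  rewrite addr0; congr (_ * _); apply: eq_bigr => I _.
  rewrite /cnil; case: asboolP => nI; last by rewrite !mul0r.
  have s1 : (spolyX F I).[1] = 0.
    rewrite /spolyX /spoly hornerM horner_prod.
    have c0 : (0 < m - \rank I)%N.
      rewrite subn_gt0 ltn_neqAle rank_leq_row andbT; apply/negP => fI.
      case: nI => s Is; have Iu : I \in unitmx by rewrite -row_free_unit.
      have : I ^+ s \in unitmx.
        by elim: (s) => [|t IH]; rewrite ?expr0 ?unitmx1 // exprS -mulmxE unitmx_mul Iu IH.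
      by rewrite Is -row_free_unit /row_free mxrank0 => /eqP m0'; rewrite -m0' in m0.
    by rewrite (bigD1 (Ordinal c0)) //= hornerXsubC expr0 subrr mul0r mulr0.
  congr (_ * _); move: (spolyX F I) s1 => p p1.
  by rewrite expr0 mulr1 /dev1 derivM hornerD !hornerM hornerXn expr1n mulr1 p1 mul0r addr0.
have gl0 : (gl k 0)%:R = 1 :> F by rewrite glE big_ord0.
rewrite gl0 invr1 !mul1r !(big_pred1 0) => [|I|I]; last 2 first.
- by rewrite [I]thinmx0 /= eqxx.
- by rewrite [I]thinmx0 /= eqxx.
rewrite /cnil asboolT; last by exists 1%N; rewrite expr1.
rewrite !mul1r /spolyX /spoly mxrank0 big_ord0 !expr0 !mulr1 !mul1r /dev1 derivXn derivC.
by rewrite horner0 add0r hornerMn hornerXn expr1n.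
Qed.

End HatSeries.

(** * Formal power series *)

Definition fps (R : comPzRingType) := nat -> R.

Section FormalPowerSeries.
Variable R : comPzRingType.
Implicit Types f g h w : fps R.

HB.instance Definition _ := gen_eqMixin (fps R).
HB.instance Definition _ := gen_choiceMixin (fps R).

Let fps0 : fps R := fun _ => 0.
Let fpsN f : fps R := fun n => - f n.
Let fpsD f g : fps R := fun n => f n + g n.
Let fps1 : fps R := fun n => if n == 0%N then 1 else 0.
Let fpsM f g : fps R := fun n => \sum_(i < n.+1) f i * g (n - i)%N.

Fact fps_addA : associative fpsD.
Proof. by move=> f g h; apply/funext=> n; exact: addrA. Qed.
Fact fps_addC : commutative fpsD.
Proof. by move=> f g; apply/funext=> n; exact: addrC. Qed.
Fact fps_add0 : left_id fps0 fpsD.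
Proof. by move=> f; apply/funext=> n; exact: add0r. Qed.
Fact fps_addN : left_inverse fps0 fpsN fpsD.
Proof. by move=> f; apply/funext=> n; exact: addNr. Qed.

HB.instance Definition _ := GRing.isZmodule.Build (fps R) fps_addA fps_addC fps_add0 fps_addN.

Fact fps_mulC : commutative fpsM.
Proof.
move=> f g; apply/funext=> n; rewrite /fpsM (reindex_inj rev_ord_inj).
by apply: eq_bigr => i _ /=; rewrite subSS subKn ?leq_ord // mulrC.
Qed.

Fact fps_mulA : associative fpsM.
Proof.
move=> f g h; apply/funext=> n; rewrite /fpsM.
pose G i j := f j * (g (i - j)%N * h (n - i)%N).
transitivity (\sum_(j < n.+1) \sum_(i < n.+1 | (j <= i)%N) G i j).
  apply: eq_bigr => j _; rewrite big_distrr /=.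
  rewrite -(big_mkord xpredT (fun i => f j * (g i * h (n - j - i)%N))).
  rewrite -(big_mkord (fun i => j <= i)%N (fun i => G i j)).
  rewrite [RHS](big_cat_nat (n := j)) //=; last exact: ltnW (ltn_ord j).
  rewrite [X in _ = X + _]big_nat_cond [X in _ = X + _]big1 ?add0r => [|i]; last first.
    by case/andP=> /andP[_ ij]; rewrite leqNgt ij.
  have -> : \sum_(j <= i < n.+1 | (j <= i)%N) G i j = \sum_(0 + j <= i < n.+1 | (j <= i)%N) G i j.
    by [].
  rewrite big_addn subSn ?leq_ord // [RHS]big_mkcond /=.
  by apply: eq_bigr => i _; rewrite leq_addl /G addnK subnDA subnAC.
rewrite (exchange_big_dep predT) //=; apply: eq_bigr => i _.
rewrite big_distrl /=.
rewrite -(big_mkord (fun j => j <= i)%N (G i)) -(big_mkord xpredT (fun j => f j * g (i - j)%N * h (n - i)%N)).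
rewrite [LHS](big_cat_nat (n := i.+1)) //= [X in _ + X]big_nat_cond [X in _ + X]big1 ?addr0; last first.
  by move=> j /andP[/andP[ij _]]; rewrite leqNgt ij.
rewrite big_nat_cond [RHS]big_nat_cond; apply: eq_big => [j|j _].
  by rewrite !andbT /= ltnS andbb.
by rewrite /G mulrA.
Qed.

Fact fps_mul1 : left_id fps1 fpsM.
Proof.
move=> f; apply/funext=> n; rewrite /fpsM big_ord_recl /= mul1r subn0 big1 ?addr0 // => i _.
by rewrite mul0r.
Qed.

Fact fps_mulD : left_distributive fpsM fpsD.
Proof.
move=> f g h; apply/funext=> n; rewrite /fpsM /fpsD -big_split; apply: eq_bigr => i _.
exact: mulrDl.
Qed.

HB.instance Definition _ :=
  GRing.Zmodule_isComPzRing.Build (fps R) fps_mulA fps_mulC fps_mul1 fps_mulD.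

Lemma fpsE1 n : (1 : fps R) n = if n == 0%N then 1 else 0. Proof. by []. Qed.
Lemma fpsEN f n : (- f) n = - f n. Proof. by []. Qed.
Lemma fpsED f g n : (f + g) n = f n + g n. Proof. by []. Qed.
Lemma fpsEM f g n : (f * g) n = \sum_(i < n.+1) f i * g (n - i)%N. Proof. by []. Qed.

Lemma fpsEM0 f g : (f * g) 0%N = f 0%N * g 0%N.
Proof. by rewrite fpsEM big_ord_recl big_ord0 addr0. Qed.

(* z d/dz *)
Definition fpsdiff f : fps R := fun n => f n *+ n.

Lemma fpsdiffM f g : fpsdiff (f * g) = fpsdiff f * g + f * fpsdiff g.
Proof.
apply/funext=> n; rewrite fpsED !fpsEM /fpsdiff fpsEM -sumrMnl -big_split.
apply: eq_bigr => i _ /=; rewrite mulrnAl mulrnAr -mulrnDr; congr (_ *+ _).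
by rewrite subnKC // -ltnS.
Qed.

Lemma fpsdiffD f g : fpsdiff (f + g) = fpsdiff f + fpsdiff g.
Proof. by apply/funext=> n; rewrite fpsED /fpsdiff fpsED mulrnDl. Qed.

Lemma fpsdiff0 f : fpsdiff f 0%N = 0. Proof. exact: mulr0n. Qed.

Lemma fps_mulI f g h : f 0%N = 1 -> f * g = f * h -> g = h.
Proof.
move=> f0 E; apply/funext=> n; elim/ltn_ind: n => n IH.
have := congr1 (fun u : fps R => u n) E; rewrite /= !fpsEM !big_ord_recl /= f0 !mul1r subn0.
rewrite (eq_bigr (fun i : 'I_n => f (lift ord0 i) * h (n - lift ord0 i)%N)) => [/addIr//|i _].
by rewrite IH // /bump /= add1n; have := ltn_ord i; lia.
Qed.

Hypothesis mulrnI : forall n (x : R), x *+ n.+1 = 0 -> x = 0.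

Lemma fps_ode f g w : w 0%N = 0 -> fpsdiff f = w * f -> fpsdiff g = w * g ->
  f 0%N = g 0%N -> f = g.
Proof.
move=> w0 fE gE fg0; apply/funext=> n; elim/ltn_ind: n => -[//|n] IH.
apply/eqP; rewrite -subr_eq0; apply/eqP; apply: (@mulrnI n); rewrite mulrnBl.
have := congr1 (fun u : fps R => u n.+1) fE; have := congr1 (fun u : fps R => u n.+1) gE.
rewrite /= /fpsdiff !fpsEM ![\sum_(i < n.+2) _]big_ord_recl /= w0 !mul0r !add0r => -> ->.
rewrite (eq_bigr (fun i : 'I_n.+1 => w (lift ord0 i) * g (n.+1 - lift ord0 i)%N)) ?subrr // => i _.
by rewrite IH // /bump /= add1n subSS ltnS leq_subr.
Qed.

End FormalPowerSeries.

Section Dilation.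
Variable R : comPzRingType.
Implicit Types (a : R) (f g : fps R).

Definition dil a f : fps R := fun n => a ^+ n * f n.

Lemma dilM a f g : dil a (f * g) = dil a f * dil a g.
Proof.
apply/funext=> n; rewrite /dil !fpsEM mulr_sumr; apply: eq_bigr => i _.
by rewrite mulrACA -exprD subnKC // -ltnS.
Qed.

Lemma dilD a f g : dil a (f + g) = dil a f + dil a g.
Proof. by apply/funext=> n; rewrite /dil !fpsED mulrDr. Qed.

Lemma dilN a f : dil a (- f) = - dil a f.
Proof. by apply/funext=> n; rewrite /dil !fpsEN mulrN. Qed.

Lemma dil1 a : dil a 1 = 1.
Proof.
by apply/funext=> -[|n]; rewrite /dil !fpsE1 /= ?expr0 ?mul1r ?mulr0.
Qed.

Lemma dil_dil a b f : dil a (dil b f) = dil (a * b) f.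
Proof. by apply/funext=> n; rewrite /dil mulrA exprMn. Qed.

Lemma dil_id f : dil 1 f = f.
Proof. by apply/funext=> n; rewrite /dil expr1n mul1r. Qed.

Lemma dil0E a f : dil a f 0%N = f 0%N.
Proof. by rewrite /dil expr0 mul1r. Qed.

Lemma dil_diff a f : fpsdiff (dil a f) = dil a (fpsdiff f).
Proof. by apply/funext=> n; rewrite /dil /fpsdiff mulrnAr. Qed.

Definition mono a m : fps R := fun n => if n == m then a else 0.

Lemma dil_mono a b m : dil a (mono b m) = mono (a ^+ m * b) m.
Proof. by apply/funext=> n; rewrite /dil /mono; case: eqP => [->|]; rewrite ?mulr0. Qed.

Lemma fpsEMn f i n : (f *+ i) n = f n *+ i.
Proof. by elim: i => [|i IH]; rewrite ?mulr0n // !mulrS fpsED IH. Qed.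

End Dilation.

Section SubstSquare.
Variables (F R : comPzRingType) (iota : {rmorphism F -> R}) (K : R).

(* c(K z^2) *)
Definition sqsubst (c : fps F) : fps R :=
  fun n => if odd n then 0 else iota (c n./2) * K ^+ n./2.

Lemma sqsubst1 : sqsubst 1 = 1.
Proof.
apply/funext=> n; rewrite /sqsubst !fpsE1; case: n => [|n]; first by rewrite rmorph1 mulr1.
case: ifP => // nodd; rewrite -[_./2 == 0%N]/(n.+1./2 == 0%N) ifN ?rmorph0 ?mul0r //; lia.
Qed.

Lemma sqsubstD c d : sqsubst (c + d) = sqsubst c + sqsubst d.
Proof.
by apply/funext=> n; rewrite /sqsubst !fpsED; case: ifP; rewrite ?addr0 // rmorphD mulrDl.
Qed.

Lemma sqsubstN c : sqsubst (- c) = - sqsubst c.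
Proof.
by apply/funext=> n; rewrite /sqsubst !fpsEN; case: ifP; rewrite ?oppr0 // rmorphN mulNr.
Qed.

Lemma sqsubstM c d : sqsubst (c * d) = sqsubst c * sqsubst d.
Proof.
apply/funext=> n; rewrite fpsEM /sqsubst; case: ifPn => [nodd|nev].
  rewrite big1 // => i _; case: ifPn => iodd; rewrite ?mul0r //.
  by rewrite oddB ?nodd ?(negPf iodd) ?mulr0 // -ltnS.
rewrite fpsEM rmorph_sum mulr_suml (bigID (fun i : 'I_n.+1 => odd i)) /=.
rewrite [X in _ = X + _]big1 ?add0r => [|i ->]; last by rewrite mul0r.
rewrite [RHS](reindex_onto (fun j : 'I_(n./2).+1 => inord j.*2 : 'I_n.+1) (fun i => inord i./2)) /=; last first.
  move=> i iev; have lt := ltn_ord i; have E : (inord i./2 : 'I_(n./2).+1) = i./2 :> nat.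
    by rewrite inordK //; lia.
  by apply: val_inj; rewrite /= inordK E; lia.
have bE (j : 'I_(n./2).+1) : (inord j.*2 : 'I_n.+1) = j.*2 :> nat.
  by rewrite inordK //; have := ltn_ord j; lia.
apply: eq_big => [j|j _].
  rewrite bE odd_double /=; apply/esym/eqP/val_inj; rewrite /= inordK; have := ltn_ord j; lia.
rewrite bE odd_double /= oddB; last by have := ltn_ord j; lia.
rewrite (negPf nev) odd_double /= doubleK.
have -> : (n - j.*2)./2 = (n./2 - j)%N by lia.
rewrite rmorphM mulrACA -exprD; congr (_ * _ ^+ _); have := ltn_ord j; lia.
Qed.

Lemma sqsubst0E c : sqsubst c 0%N = iota (c 0%N).
Proof. by rewrite /sqsubst /= mulr1. Qed.

Lemma sqsubst_diff c : fpsdiff (sqsubst c) = sqsubst (fpsdiff c) *+ 2.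
Proof.
apply/funext=> n; rewrite fpsEMn /fpsdiff /sqsubst; case: ifPn => nev; first by rewrite !mul0rn.
rewrite rmorphMn mulrnAl -mulrnA; congr (_ *+ _); lia.
Qed.

Lemma sqsubst_dil a c : dil (iota a) (sqsubst c) = sqsubst (dil (a ^+ 2) c).
Proof.
apply/funext=> n; rewrite /dil /sqsubst; case: ifPn => nev; first by rewrite mulr0.
rewrite rmorphM mulrA !rmorphXn -exprM; congr (_ ^+ _ * _ * _); lia.
Qed.

Lemma sqsubst_mono a : sqsubst (mono a 1) = mono (iota a * K) 2.
Proof.
apply/funext=> n; rewrite /sqsubst /mono; case: (n =P 2%N) => [->//|n2].
case: ifPn => // nev; rewrite ifN ?rmorph0 ?mul0r //; lia.
Qed.

End SubstSquare.

Section SeriesIdentities.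
Variables (F R : comPzRingType) (iota : {rmorphism F -> R}) (K : R) (q : F).
Hypothesis mulrnI : forall n (x : R), x *+ n.+1 = 0 -> x = 0.
Variables h eps gq gd : fps F.
Hypotheses (h0 : h 0%N = 1) (eps0 : eps 0%N = 1).
Hypotheses (h_eps : h * eps = 1) (h_gq : h * gq = dil q h) (h_gd : h * gd = fpsdiff h).
Hypothesis eps_q : dil q eps = (1 - mono 1 1) * eps.
Variables H E Theta P : fps R.
Hypotheses (H0 : H 0%N = 1) (E0 : E 0%N = 1) (P0 : P 0%N = 0).
Local Notation KK := (sqsubst iota K).
Hypothesis HE : H * dil (-1) E = KK eps.
Hypothesis HTheta : H * Theta = KK gq * dil (iota q) H.
Hypothesis HP : H * P = KK gd * H + fpsdiff H.

Let y : fps F := mono 1 1.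
Let Kz2 : fps R := mono K 2.
Let qKz2 : fps R := mono (iota q * K) 2.

Let KKy : KK y = Kz2. Proof. by rewrite /y sqsubst_mono rmorph1 mul1r. Qed.
Let KKqy : KK (mono q 1) = qKz2. Proof. exact: sqsubst_mono. Qed.

Lemma gq_eps : gq * (1 - y) = 1.
Proof.
apply: (fps_mulI h0); rewrite mulrA h_gq.
apply: (@fps_mulI _ eps) => //; have -> : eps * (h * 1) = h * eps by ring.
rewrite h_eps.
have : dil q h * dil q eps = 1 by rewrite -dilM h_eps dil1.
by rewrite eps_q -/y => E1; rewrite -[RHS]E1; ring.
Qed.

Let gd0 : gd 0%N = 0.
Proof. by have := congr1 (fun u : fps F => u 0%N) h_gd; rewrite /= fpsEM0 h0 mul1r fpsdiff0. Qed.

Let eps_gd : eps * gd = - fpsdiff eps.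
Proof.
have E1 : fpsdiff h * eps + h * fpsdiff eps = 0.
  rewrite -fpsdiffM h_eps; apply/funext=> -[|n]; first exact: fpsdiff0.
  by rewrite /fpsdiff fpsE1 /= mul0rn.
apply: (fps_mulI h0); rewrite mulrN -[RHS]add0r -E1 addrK -h_gd; ring.
Qed.

Let eps_q2 : dil (q ^+ 2) eps = (1 - mono q 1) * (1 - y) * eps.
Proof.
rewrite expr2 -dil_dil eps_q dilM eps_q dilD dilN dil1 dil_mono expr1 mulr1.
by rewrite mulrA.
Qed.

Lemma fps_mul2I (f g : fps R) : f *+ 2 = g *+ 2 -> f = g.
Proof.
move=> E1; apply/funext=> n; apply/eqP; rewrite -subr_eq0; apply/eqP/(@mulrnI 1).
by rewrite mulrnBl -!fpsEMn E1 subrr.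
Qed.

Let w : fps R := KK gd.
Let w0 : w 0%N = 0. Proof. by rewrite /w sqsubst0E gd0 rmorph0. Qed.

Lemma fpsdiff_H : fpsdiff H = (P - w) * H.
Proof. by rewrite mulrBl mulrC HP -/w [_ + fpsdiff H]addrC addrK. Qed.

Lemma sqrt_ode (s : fps R) : s 0%N = 1 -> s * s = KK eps -> fpsdiff s = - w * s.
Proof.
move=> s0 ss; apply: (fps_mulI s0); apply: fps_mul2I.
have : fpsdiff (s * s) = s * fpsdiff s *+ 2 by rewrite fpsdiffM; ring.
move=> <-; rewrite ss sqsubst_diff.
have -> : fpsdiff eps = - (eps * gd) by rewrite eps_gd opprK.
rewrite sqsubstN sqsubstM -ss -/w; ring.
Qed.

Lemma H_formula (e s : fps R) : e 0%N = 1 -> fpsdiff e = P * e ->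
  s 0%N = 1 -> s * s = KK eps -> H = e * s.
Proof.
move=> e0 eE s0 ss; apply: (fps_ode mulrnI (w := P - w)).
- by rewrite fpsED fpsEN P0 w0 subr0.
- exact: fpsdiff_H.
- rewrite fpsdiffM eE (sqrt_ode s0 ss); ring.
- by rewrite fpsEM0 e0 s0 H0 mulr1.
Qed.

Lemma fpsdiff_dil_E : fpsdiff (dil (-1) E) = (- P - w) * dil (-1) E.
Proof.
apply: (fps_mulI H0).
have := congr1 (@fpsdiff R) HE; rewrite fpsdiffM sqsubst_diff fpsdiff_H => E1.
have E2 : KK (fpsdiff eps) = - (w * (H * dil (-1) E)).
  have -> : fpsdiff eps = - (eps * gd) by rewrite eps_gd opprK.
  rewrite sqsubstN sqsubstM -HE -/w; ring.
rewrite -[LHS](addKr ((P - w) * H * dil (-1) E)) E1 E2; ring.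
Qed.

Lemma E_formula (e s : fps R) : e 0%N = 1 -> fpsdiff e = - dil (-1) P * e ->
  s 0%N = 1 -> s * s = KK eps -> E = e * s.
Proof.
move=> e0 eE s0 ss.
have dd (f : fps R) : dil (-1) (dil (-1) f) = f by rewrite dil_dil mulrNN mulr1 dil_id.
have dw : dil (-1) w = w.
  have -> : (-1 : R) = iota (-1) by rewrite rmorphN1.
  by rewrite /w sqsubst_dil sqrrN expr1n dil_id.
apply: (fps_ode mulrnI (w := - dil (-1) P - w)).
- by rewrite fpsED !fpsEN dil0E P0 w0 subr0 oppr0.
- rewrite -[E in LHS]dd dil_diff fpsdiff_dil_E dilM dd dilD !dilN dw; ring.
- rewrite fpsdiffM eE (sqrt_ode s0 ss); ring.
- by rewrite fpsEM0 e0 s0 E0 mulr1.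
Qed.

Lemma Theta_H : (1 - Kz2) * (H * Theta) = dil (iota q) H.
Proof.
rewrite HTheta mulrA -KKy -(sqsubst1 iota K) -sqsubstN -sqsubstD -sqsubstM.
by rewrite mulrC [(1 - y) * gq]mulrC gq_eps sqsubst1 mulr1.
Qed.

Lemma Kz2_0 : (1 - Kz2) 0%N = 1.
Proof. by rewrite fpsED fpsEN fpsE1 /Kz2 /mono subr0. Qed.

Lemma Theta_formula_H (X Y : fps R) : (1 - Kz2) * X = 1 -> H * Y = 1 ->
  Theta = X * (dil (iota q) H * Y).
Proof.
move=> X1 Y1; rewrite -Theta_H.
have -> : X * ((1 - Kz2) * (H * Theta) * Y) = ((1 - Kz2) * X) * (H * Y) * Theta by ring.
by rewrite X1 Y1 !mul1r.
Qed.

Lemma Theta_formula_E (X : fps R) : dil (- iota q) E * X = 1 ->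
  Theta = (1 - qKz2) * (dil (-1) E * X).
Proof.
move=> X1; apply: (@fps_mulI _ ((1 - Kz2) * H)); first by rewrite fpsEM0 Kz2_0 H0 mulr1.
rewrite -mulrA Theta_H.
have -> : (1 - Kz2) * H * ((1 - qKz2) * (dil (-1) E * X)) =
  (1 - qKz2) * (1 - Kz2) * (H * dil (-1) E) * X by ring.
rewrite HE -KKy -KKqy -(sqsubst1 iota K) -!sqsubstN -!sqsubstD -!sqsubstM -eps_q2.
rewrite -sqsubst_dil -HE dilM dil_dil mulrN1 -mulrA X1 mulr1 //.
Qed.

Lemma Theta_formula_P (e1 e2 : fps R) : e1 0%N = 1 -> fpsdiff e1 = (dil (iota q) P - P) * e1 ->
  e2 0%N = 1 -> fpsdiff e2 = KK (fun j => 1 - q ^+ j) * e2 -> Theta = e1 * e2.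
Proof.
move=> e10 e1E e20 e2E; set v : fps F := fun j => 1 - q ^+ j in e2E.
have vE : (1 - y) * (1 - mono q 1) * v = y - mono q 1.
  have yE a (f : fps F) n : ((1 - mono a 1) * f) n = f n - (if n is n'.+1 then a * f n' else 0).
    rewrite mulrBl mul1r fpsED fpsEN fpsEM; case: n => [|n].
      by rewrite big_ord_recl big_ord0 /mono /= mul0r addr0.
    rewrite big_ord_recl big_ord_recl big1 /mono /= ?mul0r ?add0r ?addr0 ?subSS ?subn0 // => i _.
    by rewrite mul0r.
  apply/funext=> n; rewrite -mulrA /y yE fpsED fpsEN.
  case: n => [|n]; first by rewrite yE /v /mono /= expr0; ring.
  rewrite !yE /v /mono; case: n => [|n] /=; first by rewrite expr0 expr1; ring.
  by rewrite !exprS; ring.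
have gdE : (gd - dil (q ^+ 2) gd) * ((1 - mono q 1) * (1 - y)) = - mono q 1 * (1 - y) - y * (1 - mono q 1).
  apply: (fps_mulI eps0).
  have E1 : dil (q ^+ 2) eps * dil (q ^+ 2) gd = - fpsdiff (dil (q ^+ 2) eps).
    by rewrite -dilM eps_gd dilN dil_diff.
  rewrite eps_q2 !fpsdiffM !fpsdiffD in E1.
  have dN a : fpsdiff (- mono a 1 : fps F) = - mono a 1.
    by apply/funext=> n; rewrite /fpsdiff !fpsEN /mono; case: eqP => [->|]; rewrite ?mulr1n // oppr0 mul0rn.
  have d1 : fpsdiff (1 : fps F) = 0.
    by apply/funext=> -[|n]; rewrite /fpsdiff !fpsE1 ?mulr0n ?mul0rn.
  rewrite /y !dN d1 -/y !add0r in E1.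
  have -> : eps * ((gd - dil (q ^+ 2) gd) * ((1 - mono q 1) * (1 - y))) =
    (eps * gd) * ((1 - mono q 1) * (1 - y)) - (1 - mono q 1) * (1 - y) * eps * dil (q ^+ 2) gd by ring.
  rewrite E1 eps_gd; ring.
have ThetaD : (1 - Kz2) * fpsdiff Theta =
    ((dil (iota q) P - P - dil (iota q) w + w) * (1 - Kz2) + Kz2 *+ 2) * Theta.
  apply: (fps_mulI H0).
  have := congr1 (@fpsdiff R) Theta_H.
  rewrite dil_diff fpsdiff_H dilM -Theta_H !fpsdiffM fpsdiff_H dilD dilN => E1.
  have dK : fpsdiff (1 - Kz2) = - (Kz2 *+ 2).
    apply/funext=> -[|n]; first by rewrite fpsdiff0 fpsEN fpsEMn /Kz2 /mono mul0rn oppr0.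
    rewrite /fpsdiff fpsED !fpsEN fpsE1 add0r fpsEMn /Kz2 /mono.
    by case: eqP => [->|_]; rewrite mulNrn ?mul0rn ?oppr0.
  rewrite dK in E1.
  rewrite -[LHS](addrK (- (Kz2 *+ 2) * (H * Theta) + (1 - Kz2) * ((P - w) * H * Theta))).
  have -> : H * ((1 - Kz2) * fpsdiff Theta) +
     (- (Kz2 *+ 2) * (H * Theta) + (1 - Kz2) * ((P - w) * H * Theta)) =
     - (Kz2 *+ 2) * (H * Theta) + (1 - Kz2) * ((P - w) * H * Theta + H * fpsdiff Theta) by ring.
  rewrite E1; ring.
have wq : dil (iota q) w = KK (dil (q ^+ 2) gd) by rewrite /w sqsubst_dil.
have KKv : (1 - Kz2) * KK v = (w - dil (iota q) w) * (1 - Kz2) + Kz2 *+ 2.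
  rewrite wq /w -KKy -(sqsubst1 iota K) -!sqsubstN -!sqsubstD -!sqsubstM mulr2n -!sqsubstD.
  congr (sqsubst _ _ _); apply: (@fps_mulI _ (1 - mono q 1)).
    by rewrite fpsED fpsEN fpsE1 /mono subr0.
  have -> : (1 - mono q 1) * ((1 - y) * v) = (1 - y) * (1 - mono q 1) * v by ring.
  rewrite vE.
  have -> : (1 - mono q 1) * ((gd - dil (q ^+ 2) gd) * (1 - y) + (y + y)) =
    (gd - dil (q ^+ 2) gd) * ((1 - mono q 1) * (1 - y)) + (1 - mono q 1) * (y + y) by ring.
  rewrite gdE; ring.
apply: (fps_ode mulrnI (w := dil (iota q) P - P + KK v)).
- by rewrite !fpsED fpsEN dil0E P0 subr0 sqsubst0E /v expr0 subrr rmorph0 addr0.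
- apply: (fps_mulI Kz2_0); rewrite ThetaD.
  have -> : (1 - Kz2) * ((dil (iota q) P - P + KK v) * Theta) =
    ((dil (iota q) P - P) * (1 - Kz2) + (1 - Kz2) * KK v) * Theta by ring.
  rewrite KKv; ring.
- rewrite fpsdiffM e1E e2E; ring.
- rewrite fpsEM0 e10 e20 mulr1.
  have := congr1 (fun u : fps R => u 0%N) Theta_H.
  by rewrite /= !fpsEM0 Kz2_0 H0 dil0E H0 !mul1r.
Qed.

End SeriesIdentities.

(** * Series over the iHall algebra *)

Section IHallPowerSeries.
Variables (k : finFieldType) (F : fieldType).
Hypothesis char0 : [pchar F] =i pred0.
Local Notation q := (#|k|%:R : F).
Local Notation A := (iHall k F).

Definition iHring : comPzRingType := HB.pack A
  (GRing.Zmodule_isComPzRing.Build A (imulA char0) (imulC char0) (imul1r char0) (@imulDl k F)).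
Local Notation R := iHring.

Definition iscal (a : F) : R := a *: (ione : A).

Lemma iscal_mul (a : F) (x : R) : iscal a * x = a *: (x : A).
Proof. by rewrite /iscal -[LHS]/(imul (a *: ione) x) iscale_imull (imul1r char0). Qed.

Lemma iscal_is_zmod_morphism : zmod_morphism iscal.
Proof. by move=> a b; rewrite /iscal scalerBl. Qed.

Lemma iscal_is_monoid_morphism : monoid_morphism iscal.
Proof.
split=> [|a b]; first exact: scale1r.
by rewrite iscal_mul /iscal scalerA.
Qed.

HB.instance Definition _ := GRing.isZmodMorphism.Build F R iscal iscal_is_zmod_morphism.
HB.instance Definition _ := GRing.isMonoidMorphism.Build F R iscal iscal_is_monoid_morphism.

Lemma iHring_mulrnI n (x : R) : x *+ n.+1 = 0 -> x = 0.
Proof.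
move=> E; have n0 : n.+1%:R != 0 :> F by rewrite (natr_neq0 char0).
apply: (@scalerI F A _ n0); rewrite scaler0 scaler_nat; exact: E.
Qed.

Lemma srec_eq (step : series k F -> nat -> A) n :
  (forall g g' n, (forall i, (i < n)%N -> g i = g' i) -> step g n = step g' n) ->
  srec step n = step (srec step) n.
Proof.
move=> ext.
have sz m : size (srec_seq step m) = m by elim: m => //= m IH; rewrite size_rcons IH.
have nthE m i : (i < m)%N -> nth 0 (srec_seq step m) i = srec step i.
  elim: m => // m IH; rewrite ltnS leq_eqVlt => /orP[/eqP -> //|im].
  by rewrite /= nth_rcons sz im IH.
rewrite {1}/srec /= nth_rcons sz ltnn eqxx; apply: ext => i; exact: nthE.
Qed.

Lemma sinvE (f : series k F) n : sinv f n =
  if n == 0%N then ione else - \sum_(1 <= i < n.+1) imul (f i) (sinv f (n - i)%N).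
Proof.
pose step (g : series k F) m := if m == 0%N then ione else
  - \sum_(1 <= i < m.+1) imul (f i) (g (m - i)%N).
have ext g g' m : (forall i, (i < m)%N -> g i = g' i) -> step g m = step g' m.
  rewrite /step; case: m => [|m] gg' /=; first exact: erefl.
  apply: (congr1 (fun x : A => - x)).
  by apply: eq_big_nat => i /andP[i1 im]; apply: (congr1 (imul (f i))); apply: gg'; lia.
exact: (@srec_eq step n ext).
Qed.

Lemma ssqrtE (f : series k F) n : ssqrt f n =
  if n == 0%N then ione else
  2%:R^-1 *: (f n - \sum_(1 <= i < n) imul (ssqrt f i) (ssqrt f (n - i)%N)).
Proof.
pose step (g : series k F) m := if m == 0%N then ione else
  2%:R^-1 *: (f m - \sum_(1 <= i < m) imul (g i) (g (m - i)%N)).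
have ext g g' m : (forall i, (i < m)%N -> g i = g' i) -> step g m = step g' m.
  rewrite /step; case: m => [|m] gg' /=; first exact: erefl.
  apply: (congr1 (fun x : A => 2%:R^-1 *: (f m.+1 - x))).
  by apply: eq_big_nat => i /andP[i1 im]; apply: f_equal2; apply: gg'; lia.
exact: (@srec_eq step n ext).
Qed.

Lemma smul_sinv (f : fps R) : f 0%N = 1 -> f * (sinv f : fps R) = 1.
Proof.
move=> f0; set g : fps R := sinv f.
have g0 : g 0%N = 1 by exact: sinvE.
have gS n : g n.+1 = - \sum_(1 <= i < n.+2) f i * g (n.+1 - i)%N by exact: sinvE.
apply/funext=> n; rewrite fpsEM fpsE1; case: n => [|n].
  by rewrite big_ord_recl big_ord0 addr0 f0 g0 mulr1.
rewrite -(big_mkord xpredT (fun i => f i * g (n.+1 - i)%N)) big_ltn // f0 mul1r subn0.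
by rewrite {1}gS /= addNr.
Qed.

Lemma ssqrt_sqr (f : fps R) : f 0%N = 1 ->
  (ssqrt f : fps R) 0%N = 1 /\ (ssqrt f : fps R) * (ssqrt f : fps R) = f.
Proof.
move=> f0; set g : fps R := ssqrt f.
have g0 : g 0%N = 1 by exact: ssqrtE.
have gS n : g n.+1 = iscal 2%:R^-1 * (f n.+1 - \sum_(1 <= i < n.+1) g i * g (n.+1 - i)%N).
  by rewrite iscal_mul; exact: ssqrtE.
split=> //; apply/funext=> n; rewrite fpsEM; case: n => [|n].
  by rewrite big_ord_recl big_ord0 addr0 g0 mulr1 f0.
rewrite -(big_mkord xpredT (fun i => g i * g (n.+1 - i)%N)) big_ltn // big_nat_recr //=.
rewrite subnn subn0 g0 mul1r mulr1 addrCA -mulr2n -mulr_natl.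
have -> : (2%:R : R) * g n.+1 = f n.+1 - \sum_(1 <= i < n.+1) g i * g (n.+1 - i)%N.
  have -> : (2%:R : R) = iscal 2%:R by rewrite rmorph_nat.
  rewrite [in LHS]gS mulrA -rmorphM divff ?rmorph1 ?mul1r // (natr_neq0 char0) //.
by rewrite addrC subrK.
Qed.

Lemma spowE (u : fps R) m : (spow u m : fps R) = u ^+ m.
Proof. by elim: m => [//|m IH]; rewrite exprS -IH. Qed.

Lemma exp_low (u : fps R) m n : u 0%N = 0 -> (n < m)%N -> (u ^+ m) n = 0.
Proof.
move=> u0; elim: m n => // m IH n nm; rewrite exprS fpsEM big_ord_recl /= u0 mul0r add0r.
by rewrite big1 // => i _; rewrite IH ?mulr0 // /bump /= add1n; have := ltn_ord i; lia.
Qed.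

Lemma ssubst_wide (c : nat -> F) (u : fps R) n N : u 0%N = 0 -> (n < N)%N ->
  ssubst c u n = \sum_(m < N) iscal (c m) * (u ^+ m) n :> R.
Proof.
move=> u0 nN; rewrite /ssubst.
transitivity (\sum_(m < n.+1) iscal (c m) * (u ^+ m) n).
  by apply: eq_bigr => m _; rewrite iscal_mul -spowE.
rewrite (big_ord_widen N (fun m => iscal (c m) * (u ^+ m) n)) // big_mkcond /=.
apply: eq_bigr => m _; case: ltnP => // nm; rewrite exp_low // ?mulr0 //.
Qed.

Lemma sexp_ode (u : fps R) : u 0%N = 0 ->
  (sexp u : fps R) 0%N = 1 /\ fpsdiff (sexp u : fps R) = fpsdiff u * (sexp u : fps R).
Proof.
move=> u0; have E n N : (n < N)%N ->
    (sexp u : fps R) n = \sum_(m < N) iscal (m`!%:R^-1) * (u ^+ m) n.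
  exact: ssubst_wide.
split; first by rewrite (E 0%N 1%N) // big_ord_recl big_ord0 addr0 invr1 rmorph1 mul1r.
have du m : fpsdiff (u ^+ m.+1) = (u ^+ m * fpsdiff u) *+ m.+1.
  elim: m => [|m IH]; first by rewrite expr1 expr0 mul1r.
  by rewrite exprS fpsdiffM IH [in RHS]mulrS exprS; ring.
apply/funext=> n; rewrite {1}/fpsdiff (E n n.+1) // big_ord_recl /=.
rewrite mulrnDl -mulrnAr; have -> : ((u ^+ 0 : fps R) n) *+ n = 0 by rewrite expr0; case: n => // n; rewrite mul0rn.
rewrite mulr0 add0r -sumrMnl.
transitivity (\sum_(m < n) iscal (m`!%:R^-1) * (fpsdiff u * u ^+ m) n).
  apply: eq_bigr => m _; rewrite -mulrnAr -[_ *+ n]/(fpsdiff (u ^+ m.+1) n) du fpsEMn.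
  rewrite [u ^+ m * fpsdiff u]mulrC /bump leq0n add1n.
  have -> : m`!%:R^-1 = m.+1`!%:R^-1 *+ m.+1 :> F.
    rewrite -[RHS]mulr_natl factS natrM invfM mulrA divff ?mul1r //.
    by rewrite (natr_neq0 char0).
  by rewrite rmorphMn mulrnAl mulrnAr.
rewrite fpsEM.
transitivity (\sum_(i < n.+1) \sum_(m < n) fpsdiff u i * (iscal (m`!%:R^-1) * (u ^+ m) (n - i)%N)).
  rewrite exchange_big /=; apply: eq_bigr => m _; rewrite fpsEM mulr_sumr.
  by apply: eq_bigr => i _; rewrite mulrCA.
apply: eq_bigr => i _; rewrite -mulr_sumr; case: (posnP i) => [->|i0].
  by rewrite fpsdiff0 !mul0r.
apply: (congr1 (fun x : R => fpsdiff u i * x)); symmetry; apply: E.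
by have := ltn_ord i; lia.
Qed.

Lemma mono_exp (a : R) j m : (mono a j : fps R) ^+ m = mono (a ^+ m) (j * m)%N.
Proof.
elim: m => [|m IH]; first by rewrite muln0 !expr0; apply/funext=> -[].
rewrite exprS IH; apply/funext=> n; rewrite fpsEM /mono.
have [nE|ne] := eqVneq n (j * m.+1)%N; last first.
  rewrite big1 // => i _; case: eqP => ij; last by rewrite mul0r.
  case: eqP => ij'; last by rewrite mulr0.
  case/eqP: ne; rewrite mulnS -ij' -ij subnKC // -ltnS; exact: ltn_ord.
have jn : (j < n.+1)%N by rewrite nE; nia.
rewrite (bigD1 (Ordinal jn)) //= eqxx [X in _ + X]big1 ?addr0 => [|i ne].
  by rewrite nE mulnS addKn eqxx exprS.
by rewrite -val_eqE /= in ne; rewrite (negPf ne) mul0r.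
Qed.

Lemma ssubst_mono2 (c : nat -> F) (a : R) :
  (ssubst c (smono (a : A) 2) : fps R) = sqsubst iscal a c.
Proof.
apply/funext=> n; rewrite (@ssubst_wide c (mono a 2) n n.+1) //.
under eq_bigr => m _ do rewrite mono_exp /mono.
rewrite /sqsubst; case: ifPn => nodd.
  by rewrite big1 // => m _; case: eqP => nm; rewrite ?mulr0 //; lia.
have lt : (n./2 < n.+1)%N by lia.
rewrite (bigD1 (Ordinal lt)) //= [X in _ + X]big1 ?addr0 => [|i ne]; last first.
  case: eqP => ni; rewrite ?mulr0 //; case/eqP: ne; apply: val_inj => /=; lia.
rewrite ifT //; apply/eqP; lia.
Qed.

Lemma KpowE m : Kpow k F m = (KS : R) ^+ m :> R.
Proof. by elim: m => [//|m IH]; rewrite exprS -IH. Qed.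

Lemma sqsubst_mulE (c : fps F) (f : fps R) r :
  (sqsubst iscal KS c * f) r = \sum_(m < r.+1 | (m.*2 <= r)%N) c m *: (imul (Kpow k F m) (f (r - m.*2)%N) : A).
Proof.
rewrite fpsEM (bigID (fun i : 'I_r.+1 => odd i)) /= big1 ?add0r => [|i iodd]; last first.
  by rewrite /sqsubst iodd mul0r.
rewrite (reindex_onto (fun j : 'I_(r./2).+1 => inord j.*2 : 'I_r.+1) (fun i => inord i./2)) /=; last first.
  move=> i iev; have lt := ltn_ord i; have E : (inord i./2 : 'I_(r./2).+1) = i./2 :> nat.
    by rewrite inordK //; lia.
  by apply: val_inj; rewrite /= inordK E; lia.
have bE (j : 'I_(r./2).+1) : (inord j.*2 : 'I_r.+1) = j.*2 :> nat.
  by rewrite inordK //; have := ltn_ord j; lia.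
transitivity (\sum_(j < (r./2).+1) c j *: (imul (Kpow k F j) (f (r - j.*2)%N) : A)).
  apply: eq_big => [j|j _].
    rewrite bE odd_double /=; apply/eqP/val_inj; rewrite /= inordK; have := ltn_ord j; lia.
  by rewrite bE /sqsubst odd_double doubleK -mulrA iscal_mul -KpowE.
have r2 : ((r./2).+1 <= r.+1)%N by lia.
rewrite (big_ord_widen r.+1 (fun j => c j *: (imul (Kpow k F j) (f (r - j.*2)%N) : A)) r2).
apply: eq_bigl => j /=; lia.
Qed.

End IHallPowerSeries.

Lemma fieldExt_rat_char0 (F : fieldExtType rat) : [pchar F] =i pred0.
Proof.
apply/pcharf0P => n; rewrite -(@scaler_nat rat F n 1) scaler_eq0 oner_eq0 orbF.
exact: Num.Theory.pnatr_eq0.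
Qed.

Section Conclusion.
Variables (k : finFieldType) (F : fieldType) (v : F).
Hypothesis char0 : [pchar F] =i pred0.
Local Notation q := (#|k|%:R : F).
Local Notation R := (iHring k char0).
Local Notation iscal := (@iscal k F char0).
Hypothesis vq : v ^+ 2 = q.

Lemma sdil_dil a (f : fps R) : sdil a f = dil (iscal a) f.
Proof. by apply/funext=> n; rewrite /dil -(rmorphXn iscal) iscal_mul. Qed.

Let K : R := KS.
Let h : fps F := hc k F.
Let eps : fps F := fun m => (phiq k F m)^-1.
Let gq : fps F := fun m => gpsi k (@evq k F) m 0.
Let gd : fps F := fun m => gpsi k (@dev1 F) m 0.
Let H : fps R := @Hhat k F.
Let E : fps R := @Ehat k F v.
Let Theta : fps R := @Thetahat k F.
Let P : fps R := fun r => if r == 0%N then 0 else Phat r.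
Local Notation KK := (sqsubst iscal K).

Let h0 : h 0%N = 1.
Proof.
rewrite /h /hc glE big_ord0 invr1 mul1r (big_pred1 0) => [|X]; last by rewrite [X]thinmx0 /= eqxx.
by rewrite /cnil asboolT //; exists 1%N; rewrite expr1.
Qed.

Let eps0 : eps 0%N = 1. Proof. by rewrite /eps /phiq big_geq // invr1. Qed.

Let fps_mulE (f g : fps F) r : (f * g) r = \sum_(b < r.+1) f (r - b)%N * g b.
Proof. by rewrite mulrC fpsEM; apply: eq_bigr => b _; rewrite mulrC. Qed.

Let h_eps : h * eps = 1.
Proof.
apply/funext=> r; rewrite fps_mulE.
transitivity (ev0 'X^r * h r).
  rewrite -(hc_psi k char0 r (@ev0_lin F)); apply: eq_bigr => b _.
  by rewrite (gpsi_ev0 k char0).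
by rewrite /ev0 hornerXn expr0n fpsE1; case: eqP => [->|]; rewrite ?h0 ?mulr1 ?mul0r.
Qed.

Let h_gq : h * gq = dil q h.
Proof.
by apply/funext=> r; rewrite fps_mulE (hc_psi k char0 r (@evq_lin k F)) /evq hornerXn.
Qed.

Let h_gd : h * gd = fpsdiff h.
Proof.
apply/funext=> r; rewrite fps_mulE (hc_psi k char0 r (@dev1_lin F)) /dev1 derivXn.
by rewrite hornerMn hornerXn expr1n mulr_natl.
Qed.

Let eps_q : dil q eps = (1 - mono 1 1) * eps.
Proof.
apply/funext=> n; rewrite mulrBl mul1r fpsED fpsEN fpsEM; case: n => [|n].
  by rewrite big_ord_recl big_ord0 /mono /dil /= mul0r addr0 subr0 mul1r.
rewrite big_ord_recl big_ord_recl big1 /mono /= => [|i _]; last by rewrite mul0r.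
rewrite mul0r add0r addr0 mul1r /bump /= subSS subn0 /dil /eps.
have q0 : 1 - q ^+ n.+1 != 0.
  by rewrite subr_eq0 -(expr0 q); apply/eqP => /(qcard_inj char0).
have -> : phiq k F n.+1 = phiq k F n * (1 - q ^+ n.+1) by rewrite /phiq big_nat_recr.
rewrite invfM; set x := (phiq k F n)^-1.
by rewrite -[X in _ = _ - X](divfK q0); ring.
Qed.

Let gq1 n : gq n = 1.
Proof.
have E1 : gq * (1 - mono 1 1) = 1 by exact: gq_eps h0 eps0 h_eps h_gq eps_q.
elim: n => [|n IH]; first by have := congr1 (fun u : fps F => u 0%N) E1; rewrite /= fpsEM0 fpsED fpsEN /mono subr0 mulr1.
have := congr1 (fun u : fps F => u n.+1) E1; rewrite mulrBr mulr1 fpsED fpsEN mulrC fpsEM.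
rewrite big_ord_recl big_ord_recl big1 /mono /= => [|i _]; last by rewrite mul0r.
by rewrite mul0r add0r addr0 mul1r /bump /= subSS subn0 IH => /eqP; rewrite subr_eq0 => /eqP.
Qed.

Let Hc0 : Hc k F 0 = ione.
Proof.
rewrite /Hc glE big_ord0 invr1 scale1r.
rewrite (big_pred1 0) => [|X]; last by rewrite [X]thinmx0 /= eqxx.
transitivity (icl F (nmx (Sn k 0)) 0); last exact: icl_stalk.
by apply: (congr1 (fun X : 'M[k]_0 => icl F X 0)); rewrite [RHS]thinmx0.
Qed.

Let H0 : H 0%N = 1.
Proof. by rewrite /H Hhat_Hc // Hc0. Qed.

Let H_mulE (f : fps R) r : (H * f) r = \sum_(b < r.+1) imul (Hc k F (r - b)) (f b) :> R.
Proof.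
rewrite mulrC fpsEM; apply: eq_bigr => b _.
by rewrite mulrC /H Hhat_Hc.
Qed.

Let HE : H * dil (-1) E = KK eps.
Proof.
apply/funext=> r; rewrite H_mulE.
transitivity (\sum_(b < r.+1) imul (Hc k F (r - b)) (Gpsi k (@ev0 F) b) : R).
  apply: eq_bigr => b _; apply: (congr1 (imul _)); rewrite (Gpsi_ev0 char0 b vq).
  have -> : (-1 : R) = iscal (-1) by rewrite rmorphN1.
  by rewrite -sdil_dil.
rewrite (imul_HG_psi k char0 r (@ev0_lin F)) -[KK eps]mulr1 sqsubst_mulE.
apply: eq_bigr => m m2; rewrite (gpsi_ev0 k char0) fpsE1.
case: (posnP (r - m.*2)) => [->|_]; last by rewrite scale0r (@imulr0 k F) scaler0.
by rewrite Hc0; exact: erefl.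
Qed.

Let HTheta : H * Theta = KK gq * dil (iscal q) H.
Proof.
apply/funext=> r; rewrite H_mulE.
transitivity (\sum_(b < r.+1) imul (Hc k F (r - b)) (Gpsi k (@evq k F) b) : R).
  apply: eq_bigr => b _; apply: (congr1 (imul _)).
  by rewrite Gpsi_evq // -[gpsi _ _ _ _]/(gq b) gq1 scale1r.
rewrite (imul_HG_psi k char0 r (@evq_lin k F)) sqsubst_mulE.
apply: eq_bigr => m m2; rewrite gpsi_evq -[gpsi _ _ m 0]/(gq m) -sdil_dil.
by rewrite /sdil iscale_imulr scalerA /H Hhat_Hc.
Qed.

Let HP : H * P = KK gd * H + fpsdiff H.
Proof.
apply/funext=> r; rewrite H_mulE fpsED.
transitivity (\sum_(b < r.+1) imul (Hc k F (r - b)) (Gpsi k (@dev1 F) b) : R).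
  by apply: eq_bigr => b _; apply: (congr1 (imul _)); rewrite Gpsi_dev1.
rewrite (imul_HG_psi k char0 r (@dev1_lin F)) sqsubst_mulE.
pose t (m : nat) : R := if m == 0%N then H r *+ r else 0.
transitivity (\sum_(m < r.+1 | (m.*2 <= r)%N)
    ((gd m *: (imul (Kpow k F m) (H (r - m.*2)%N) : iHall k F) : R) + t m) : R).
  apply: eq_bigr => m m2; rewrite gpsi_dev1 // -[gpsi _ _ m 0]/(gd m) scalerDl /H Hhat_Hc //.
  apply: (congr1 (fun x : R => _ + x)); rewrite /t; case: eqP => [->|_]; last exact: scale0r.
  by rewrite double0 subn0 [Kpow _ _ _]/= (imul1r char0) scaler_nat /H Hhat_Hc.
rewrite big_split; apply: (congr1 (fun x : R => _ + x)).
rewrite (bigD1 ord0) //= [X in _ + X]big1 ?addr0 // => m /andP[_ m0].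
by rewrite /t ifN.
Qed.

Let E0 : E 0%N = 1.
Proof.
have := congr1 (fun u : fps R => u 0%N) HE.
by rewrite /= fpsEM0 H0 mul1r dil0E sqsubst0E eps0 rmorph1.
Qed.

Let mulrnI := @iHring_mulrnI k F char0.

Let dilNE : sdil (-1) E = dil (-1) E :> fps R.
Proof. by rewrite sdil_dil rmorphN1. Qed.

Let sexpqE : sexpq (smono K 2) = KK eps :> fps R.
Proof. exact: ssubst_mono2. Qed.

Let H_E : smul H (sdil (-1) E) = sexpq (smono K 2) :> fps R.
Proof. by rewrite sexpqE -HE -dilNE. Qed.

Let Theta_E : Theta = smul (ssub sone (smono (q *: (K : iHall k F)) 2))
  (sdiv (sdil (-1) E) (sdil (- q) E)) :> fps R.
Proof.
have X1 : dil (- iscal q) E * (sinv (sdil (- q) E) : fps R) = 1.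
  rewrite -rmorphN -sdil_dil; apply: smul_sinv.
  by rewrite sdil_dil dil0E E0.
have -> := Theta_formula_E h0 eps0 h_eps h_gq eps_q H0 HE HTheta X1.
by rewrite -dilNE iscal_mul.
Qed.

Let Theta_H : Theta = smul (sinv (ssub sone (smono K 2))) (sdiv (sdil q H) H) :> fps R.
Proof.
have Y1 : H * (sinv H : fps R) = 1 by exact: smul_sinv.
have X1 : (1 - mono K 2) * (sinv (ssub sone (smono K 2)) : fps R) = 1.
  by apply: smul_sinv; exact: (Kz2_0 K).
transitivity ((sinv (ssub sone (smono K 2)) : fps R) * (dil (iscal q) H * (sinv H : fps R))).
  exact: (Theta_formula_H h0 eps0 h_eps h_gq eps_q HTheta X1 Y1).
by rewrite -sdil_dil; exact: erefl.
Qed.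

Let sqrt0 : (ssqrt (sexpq (smono K 2)) : fps R) 0%N = 1.
Proof. by apply: (proj1 (ssqrt_sqr _)); rewrite sexpqE sqsubst0E eps0 rmorph1. Qed.

Let sqrt_sqr : (ssqrt (sexpq (smono K 2)) : fps R) * (ssqrt (sexpq (smono K 2)) : fps R) = KK eps.
Proof.
by rewrite -sexpqE; apply: (proj2 (ssqrt_sqr _)); rewrite sexpqE sqsubst0E eps0 rmorph1.
Qed.

Let expP (c : nat -> F) (w : fps R) (u : fps R := fun r => (c r / r%:R) *: Phat r) :
  (forall r, w r = c r *: (P r : iHall k F)) ->
  (sexp u : fps R) 0%N = 1 /\ fpsdiff (sexp u : fps R) = w * (sexp u : fps R).
Proof.
move=> wE; have u0 : u 0%N = 0 by rewrite /u invr0 mulr0 scale0r.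
have [e0 eE] := sexp_ode u0; split; first exact: e0.
apply: etrans eE _; apply: (congr1 (fun x : fps R => x * _)).
apply/funext=> -[|r]; first by rewrite fpsdiff0 wE scaler0.
rewrite wE /fpsdiff /u -[LHS]scaler_nat scalerA; apply: (congr1 (fun a => a *: _)).
by rewrite mulrC divfK // (natr_neq0 char0).
Qed.

Let H_P : H = smul (sexp (fun r => r%:R^-1 *: Phat r)) (ssqrt (sexpq (smono K 2))) :> fps R.
Proof.
have -> : (fun r => r%:R^-1 *: Phat r) = (fun r => (1 / r%:R) *: Phat r) :> series k F.
  by apply/funext=> r; rewrite div1r.
have [r|e0 eE] := @expP (fun _ => 1) P; first by rewrite scale1r.
exact: (H_formula mulrnI h0 h_eps h_gd H0 (erefl _) HP e0 eE sqrt0 sqrt_sqr).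
Qed.

Let E_P : E = smul (sexp (fun r => ((-1) ^+ r.-1 / r%:R) *: Phat r))
  (ssqrt (sexpq (smono K 2))) :> fps R.
Proof.
have [[|r]|e0 eE] := @expP (fun r => (-1) ^+ r.-1) (- dil (-1) P).
- by rewrite fpsEN dil0E /P oppr0 scaler0.
- have -> : (-1 : R) = iscal (-1) by rewrite rmorphN1.
  rewrite fpsEN -sdil_dil /sdil exprS mulN1r scaleNr; exact: opprK.
exact: (E_formula mulrnI h0 h_eps h_gd H0 E0 (erefl _) HE HP e0 eE sqrt0 sqrt_sqr).
Qed.

Let Theta_P : Theta = smul (sexp (fun r => ((q ^+ r - 1) / r%:R) *: Phat r))
  (sexp (ssubst (fun j => (1 - q ^+ j) / (2 * j)%:R) (smono K 2))) :> fps R.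
Proof.
have [r|e0 eE] := @expP (fun r => q ^+ r - 1) (dil (iscal q) P - P).
  rewrite fpsED fpsEN -sdil_dil scalerBl scale1r; exact: erefl.
pose c : fps F := fun j => (1 - q ^+ j) / (2 * j)%:R.
pose u : fps R := ssubst c (smono K 2).
have uE : u = KK c by exact: ssubst_mono2.
have u0 : u 0%N = 0 by rewrite uE sqsubst0E /c expr0 subrr mul0r rmorph0.
have [e20 e2E] := sexp_ode u0.
have cE : fpsdiff c + fpsdiff c = (fun j => 1 - q ^+ j : F).
  apply/funext=> -[|j]; first by rewrite fpsED fpsdiff0 addr0 expr0 subrr.
  rewrite fpsED /fpsdiff -mulr2n -mulrnA mulnC -[LHS]mulr_natr /c divfK // (natr_neq0 char0) //.
have duE : fpsdiff u = KK (fun j => 1 - q ^+ j).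
  apply: etrans (congr1 (@fpsdiff R) uE) _; apply: etrans (sqsubst_diff iscal K c) _.
  apply: etrans (mulr2n _) _; apply: etrans (esym (sqsubstD iscal K _ _)) _.
  exact: (congr1 (sqsubst iscal K) cE).
exact: (Theta_formula_P mulrnI h0 eps0 h_eps h_gq h_gd eps_q H0 (erefl _) HTheta HP e0 eE e20
  (etrans e2E (congr1 (fun x : fps R => x * _) duE))).
Qed.

Lemma generating_series_identities :
  let q := qcard k F in let Kz2 := smono (KS : iHall k F) 2 in
  (smul Hhat (sdil (-1) (Ehat v)) =1 sexpq Kz2)
  /\ (Thetahat =1 smul (ssub sone (smono (q *: (KS : iHall k F)) 2))
         (sdiv (sdil (-1) (Ehat v)) (sdil (- q) (Ehat v)))
     /\ Thetahat =1 smul (sinv (ssub sone Kz2)) (sdiv (sdil q Hhat) Hhat))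
  /\ Thetahat =1 smul (sexp (fun r => ((q ^+ r - 1) / r%:R) *: Phat r))
       (sexp (ssubst (fun j => (1 - q ^+ j) / (2 * j)%:R) Kz2))
  /\ Ehat v =1 smul (sexp (fun r => ((-1) ^+ r.-1 / r%:R) *: Phat r)) (ssqrt (sexpq Kz2))
  /\ Hhat =1 smul (sexp (fun r => r%:R^-1 *: Phat r)) (ssqrt (sexpq Kz2)).
Proof.
move=> q' Kz2; split; [|split; [split|split; [|split]]] => n.
- exact: (congr1 (fun f : fps R => f n) H_E).
- exact: (congr1 (fun f : fps R => f n) Theta_E).
- exact: (congr1 (fun f : fps R => f n) Theta_H).
- exact: (congr1 (fun f : fps R => f n) Theta_P).
- exact: (congr1 (fun f : fps R => f n) E_P).
- exact: (congr1 (fun f : fps R => f n) H_P).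
Qed.

End Conclusion.

Theorem theoremD (k : finFieldType) (F : fieldExtType rat) (v : F)
    (v_sqrt_q : v ^+ 2 = #|k|%:R) (F_gen : <<1; v>>%VS = fullv) :
  let q : F := qcard k F in
  let K : iHall k F := KS in
  let E : series k F := Ehat v in
  let H : series k F := Hhat in
  let Theta : series k F := Thetahat in
  let P : nat -> iHall k F := Phat in
  let Kz2 : series k F := smono K 2 in
  let qKz2 : series k F := smono (q *: K) 2 in
  (H * sdil (-1)%R E)%PS =1 sexpq Kz2
  /\ (Theta =1 ((1 - qKz2) * (sdil (-1)%R E / sdil (- q)%R E))%PS
      /\ Theta =1 (sinv (1 - Kz2) * (sdil q H / H))%PS)
  /\ Theta =1
       (sexp (fun r => ((q ^+ r - 1) / r%:R) *: P r)%R
        * sexp (ssubst (fun j => (1 - q ^+ j) / (2 * j)%:R)%R Kz2))%PS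
  /\ E =1 (sexp (fun r => ((-1) ^+ r.-1 / r%:R) *: P r)%R
           * ssqrt (sexpq Kz2))%PS
  /\ H =1 (sexp (fun r => r%:R^-1 *: P r)%R * ssqrt (sexpq Kz2))%PS.
Proof.
exact: generating_series_identities (fieldExt_rat_char0 F) v_sqrt_q.
Qed.
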